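(* Let $\mathbf Z$ be an AV-bundle over $M$. There are subbundles of the vector bundle $\mathsf R\mathbf Z$: vector subbundles $\widetilde{\mathsf T}\mathbf Z$, $\widetilde{\mathsf L}\mathbf Z$, $\breve{\mathsf L}\mathbf Z$, and affine subbundles $\overline{\mathsf T}\mathbf Z$ modelled on $\widetilde{\mathsf T}\mathbf Z$ and $\overline{\mathsf L}\mathbf Z$ modelled on $\widetilde{\mathsf L}\mathbf Z$, characterized respectively by the equations - $\widetilde{\mathsf T}\mathbf Z$: $\phi^0=\phi^1=0$; - $\widetilde{\mathsf L}\mathbf Z$: $\phi^1-\phi^0=0$; - $\breve{\mathsf L}\mathbf Z$: $\phi^1=0$; - $\overline{\mathsf T}\mathbf Z$: $\phi^0=-1$ and $\phi^1=0$; - $\overline{\mathsf L}\mathbf Z$: $\phi^1-\phi^0=1$; such that (a) $\mathrm{ADer}(\mathbf Z)=\mathrm{Sec}(\widetilde{\mathsf T}\mathbf Z)=\widetilde{\mathcal X}(\mathbf Z)$; (b) $\mathrm{ADer}(\mathbf Z;\mathbf Z)=\mathrm{Sec}(\overline{\mathsf T}\mathbf Z)$; (c) $\mathrm{ADO}^1(\mathbf Z)=\mathrm{Sec}(\widetilde{\mathsf L}\mathbf Z)$; (d) $\mathrm{ADO}^1(\mathbf Z;\mathbf Z)=\mathrm{Sec}(\overline{\mathsf L}\mathbf Z)$; where the action $\sigma\mapsto D(\sigma)$ of sections $D$ of these bundles, regarded as elements of $\mathrm{Sec}(\mathsf R\mathbf Z)=\mathcal D^1_{ah}(\mathbf Z)$,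 on sections $\sigma$ of $\mathbf Z$ is given by $$\mathbf F_{D(\sigma)}=D(\mathbf F_\sigma).$$
   Context: An AV-bundle $\zeta:\mathbf Z\to M$ is a rank-one affine bundle modelled on $M\times\mathbb R$ (equivalently a principal $(\mathbb R,+)$-bundle). $X_{\mathbf Z}$ is the vertical vector field on $\mathbf Z$ with flow $z\mapsto z-t$; in local affine coordinates $(x^a,s)$ ($x^a$ coordinates on $M$, $s(z)=z-\sigma_0(\zeta(z))$ for a local section $\sigma_0$) it is $X_{\mathbf Z}=-\partial_s$. For a section $\sigma$ of $\mathbf Z$, $\mathbf F_\sigma\in C^\infty(\mathbf Z)$ is $\mathbf F_\sigma(z)=\sigma(\zeta(z))-z$; for $f\in C^\infty(M)$, $\mathbf F_f:=f\circ\zeta$. The map $\mathbf F$ is injective on sections and on functions, which gives meaning to $\mathbf F_{D(\sigma)}=D(\mathbf F_\sigma)$: $D(\sigma)\in C^\infty(M)$ in cases (a), (c) and $D(\sigma)\in\mathrm{Sec}(\mathbf Z)$ in cases (b), (d). $\mathrm{Pol}^n(\mathbf Z)=\{f\in C^\infty(\mathbf Z):X_{\mathbf Z}^{n+1}(f)=0\}$. $\mathcal D^1_{ah}(\mathbf Z)$ is the Lie algebra of linear first-order differential operators $D$ (vector field plus multiplication by a function) on $C^\infty(\mathbf Z)$ with $D(\mathrm{Pol}^n(\mathbf Z))\subset\mathrm{Pol}^n(\mathbf Z)$ for all $n\ge0$; locally $D=f_a(x)\partial_{x^a}-(\alpha(x)s+\beta(x))\partial_s+\gamma(x)$. It is the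 $C^\infty(M)$-module of sections of a vector bundle $\mathsf R\mathbf Z\to M$. The sections $\phi^0,\phi^1$ of $(\mathsf R\mathbf Z)^*$ are defined by $[D,X_{\mathbf Z}]=\phi^0(D)X_{\mathbf Z}$ and $\phi^1(D)=D(1)$; locally $\phi^0(D)=\alpha$, $\phi^1(D)=\gamma$. $\widetilde{\mathcal X}(\mathbf Z)$ is the Lie algebra of vector fields $X$ on $\mathbf Z$ with $[X_{\mathbf Z},X]=0$. The phase bundle $\mathsf P\mathbf Z\to M$ consists of classes $\boldsymbol d\sigma(m)$ of pairs $(m,\sigma)$ ($\sigma$ a section of $\mathbf Z$) with $(m,\sigma)\sim(m,\sigma')$ iff $\mathrm d(\sigma'-\sigma)(m)=0$; it is an affine bundle modelled on $T^*M$. The contact bundle $\mathsf C\mathbf Z=J^1\mathbf Z\to M$ consists of first jets $\mathrm c\sigma(m)$; it is an affine bundle modelled on $T^*M\oplus\mathbb R$. For an affine bundle $A$ over $M$, $\mathrm{ADer}(\mathbf Z;A)$ (affine derivations on $\mathbf Z$ with values in $A$) is the space of affine bundle morphisms $\mathsf D:\mathsf P\mathbf Z\to A$ over $\mathrm{id}_M$, acting on sections of $\mathbf Z$ by $\sigma\mapsto\mathsf D(\boldsymbol d\sigma)$; $\mathrm{ADO}^1(\mathbf Z;A)$ (affine first-order differential operators) is the space of affine bundle morphisms $\mathsf D:\mathsf C\mathbf Z\to A$ over $\mathrm{id}_M$, acting by $\sigma\mapsto\mathsf D(\mathrm c\sigma)$. $\mathrm{ADer}(\mathbf Z)=\mathrm{ADer}(\mathbf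 Z;M\times\mathbb R)$ and $\mathrm{ADO}^1(\mathbf Z)=\mathrm{ADO}^1(\mathbf Z;M\times\mathbb R)$. The equalities in (a)–(d) mean that sections of the indicated bundle correspond bijectively to elements of the indicated space so that the actions on sections of $\mathbf Z$ agree. *)

(* Defs.v *)
From HB Require Import structures.
From mathcomp Require Import all_boot all_order all_algebra.
From mathcomp Require Import boolp classical_sets functions reals topology.
From mathcomp Require Import normedtype derive numfun.

Set Implicit Arguments.
Unset Strict Implicit.
Unset Printing Implicit Defensive.

Import Order.TTheory GRing.Theory Num.Theory.
Import numFieldNormedType.Exports.

Local Open Scope classical_set_scope.
Local Open Scope ring_scope.

Section Smooth.
Variable R : realType.

Definition partials n (l : seq 'I_n) (g : 'rV[R]_n -> R) : 'rV[R]_n -> R :=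
  foldr (fun i h => 'D_(delta_mx 0 i) h) g l.

(* For U open: g is C^oo on U, i.e. all its iterated partial derivatives exist
   and are continuous at every point of U. *)
Definition smooth_on n (U : set 'rV[R]_n) (g : 'rV[R]_n -> R) : Prop :=
  forall l x, U x ->
    {for x, continuous (partials l g)} /\
    forall i, derivable (partials l g) x (delta_mx 0 i).

(* [cinv] is only meaningful on the image of [cdom]. *)
Record chart (T : Type) (n : nat) := Chart {
  cdom : set T;
  cmap : T -> 'rV[R]_n;
  cinv : 'rV[R]_n -> T }.

Definition smooth_fun T n (atl : set (chart T n)) (U : set T) (f : T -> R) :=
  forall c, atl c -> smooth_on (cmap c @` (U `&` cdom c)) (f \o cinv c).

Definition partial T n (c : chart T n) (i : 'I_n) (f : T -> R) (t : T) : R :=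
  'D_(delta_mx 0 i) (f \o cinv c) (cmap c t).

Record manifold (n : nat) := Manifold {
  carrier :> topologicalType;
  matlas : set (chart carrier n);
  manifold_hausdorff : hausdorff_space carrier;
  manifold_countable : @second_countable carrier;
  matlas_cover : forall m : carrier, exists2 c, matlas c & cdom c m;
  matlas_dom : forall c, matlas c -> open (cdom c);
  matlas_img : forall c, matlas c -> open (cmap c @` cdom c);
  matlas_cont : forall c, matlas c -> {within cdom c, continuous (cmap c)};
  matlas_invcont : forall c, matlas c ->
    {within cmap c @` cdom c, continuous (cinv c)};
  matlas_inv : forall c, matlas c -> {in cdom c, cancel (cmap c) (cinv c)};
  matlas_compat : forall c, matlas c -> forall i,
    smooth_fun matlas (cdom c) (fun m => cmap c m 0 i) }.

End Smooth.

Section SmoothTheory.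
Variables (R : realType) (p : nat).
Implicit Types (U : set 'rV[R]_p) (g h : 'rV[R]_p -> R).

Lemma partials_eq U g h l : open U -> (forall x, U x -> g x = h x) ->
  forall x, U x -> partials l g x = partials l h x.
Proof.
move=> Uo gh; elim: l => [|i l IH] x Ux //=; first exact: gh.
apply: near_eq_derive.
by move: (open_nbhs_nbhs (conj Uo Ux)); apply: filterS => y; exact: IH.
Qed.

Lemma smooth_on_ext U g h : open U -> (forall x, U x -> g x = h x) ->
  smooth_on U g -> smooth_on U h.
Proof.
move=> Uo gh gs l x Ux; have [gc gd] := gs l x Ux.
have e : \forall y \near x, partials l g y = partials l h y.
  move: (open_nbhs_nbhs (conj Uo Ux)); apply: filterS => y.
  exact: (partials_eq l Uo gh).
split; last by move=> i; apply: near_eq_derivable (gd i); exact: e.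
rewrite /prop_for /continuous_at -(partials_eq l Uo gh Ux).
apply: cvg_trans gc; apply: (@near_eq_cvg _ _ (nbhs x)).
by apply: filterS e => y ->.
Qed.

Lemma partials_cst l (a : R) :
  partials l (cst a : 'rV[R]_p -> R) = cst (if l is [::] then a else 0).
Proof.
elim: l => [//|i l IH]; apply/funext => x.
by rewrite /= -/(partials l _) IH derive_cst.
Qed.

Lemma smooth_on_cst U (a : R) : smooth_on U (cst a).
Proof.
move=> l x Ux; rewrite partials_cst; split; first exact: cst_continuous.
by move=> i; exact: derivable_cst.
Qed.

Lemma smooth_on_partial U g i : smooth_on U g ->
  smooth_on U ('D_(delta_mx 0 i) g).
Proof.
move=> gs l x Ux.
have -> : partials l ('D_(delta_mx 0 i) g) = partials (rcons l i) g.
  by rewrite /partials foldr_rcons.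
exact: gs.
Qed.

Lemma smooth_on_sub U g h : open U -> smooth_on U g -> smooth_on U h ->
  smooth_on U (g - h).
Proof.
move=> Uo gs hs.
have e l : forall x, U x ->
    partials l (g - h) x = (partials l g - partials l h) x.
  elim: l => [//|i l IH] x Ux /=.
  have [[_ gd] [_ hd]] := (gs l x Ux, hs l x Ux).
  apply: (etrans _ (deriveB (gd i) (hd i))); apply: near_eq_derive.
  by move: (open_nbhs_nbhs (conj Uo Ux)); apply: filterS => y; exact: IH.
move=> l x Ux; have [[gc gd] [hc hd]] := (gs l x Ux, hs l x Ux).
have ne : \forall y \near x,
    (partials l g - partials l h) y = partials l (g - h) y.
  move: (open_nbhs_nbhs (conj Uo Ux)); apply: filterS => y Uy.
  by rewrite e.
split; last first.
  by move=> i; apply: near_eq_derivable (derivableB (gd i) (hd i)); exact: ne.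
rewrite /prop_for /continuous_at e//.
apply: cvg_trans (cvgB gc hc).
by apply: (@near_eq_cvg _ _ (nbhs x)); exact: ne.
Qed.

Lemma lsubmx_quotient q (h : 'rV[R]_p -> R) (v y : 'rV[R]_(p + q)) :
  (fun t : R => t^-1 *: (((h \o lsubmx) \o shift y) (t *: v)
    - (h \o lsubmx) y)) =
  (fun t : R => t^-1 *: ((h \o shift (lsubmx y)) (t *: lsubmx v)
    - h (lsubmx y))).
Proof. by apply/funext => t /=; rewrite !linearD !linearZ. Qed.

Lemma derive_lsubmx q (h : 'rV[R]_p -> R) (v y : 'rV[R]_(p + q)) :
  'D_v (h \o lsubmx) y = 'D_(lsubmx v) h (lsubmx y).
Proof. by rewrite /derive lsubmx_quotient. Qed.

Lemma derivable_lsubmx q (h : 'rV[R]_p -> R) (v y : 'rV[R]_(p + q)) :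
  derivable h (lsubmx y) (lsubmx v) -> derivable (h \o lsubmx) y v.
Proof. by rewrite /derivable lsubmx_quotient. Qed.

Lemma lsubmx_delta q (i : 'I_(p + q)) :
  lsubmx (delta_mx 0 i : 'rV[R]_(p + q)) =
  if fintype.split i is inl j then delta_mx 0 j else 0.
Proof.
case: splitP => [j|k] ij; apply/rowP => a; rewrite !mxE eqxx /=.
  by congr (_%:R); rewrite -!val_eqE /= ij.
by rewrite -val_eqE /= ij ltn_eqF// ltn_addr.
Qed.

Lemma smooth_on_lsubmx q U h : smooth_on U h ->
  smooth_on (lsubmx @^-1` U : set 'rV[R]_(p + q)) (h \o lsubmx).
Proof.
move=> hs.
have e (l : seq 'I_(p + q)) :
    (exists l', partials l (h \o lsubmx) = partials l' h \o lsubmx) \/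
    partials l (h \o lsubmx) = cst 0.
  elim: l => [|i l [[l' IH]|IH]] /=; first by left; exists [::].
    rewrite IH; have := lsubmx_delta i; case: (fintype.split i) => [j|k] ij.
      left; exists (j :: l'); apply/funext => y /=.
      by rewrite derive_lsubmx ij.
    right; apply/funext => y; rewrite derive_lsubmx ij.
    by rewrite derive0.
  by right; rewrite IH; apply/funext => y; rewrite derive_cst.
move=> l x Ux; case: (e l) => [[l' ->]|->]; last first.
  split; first exact: cst_continuous.
  by move=> i; exact: derivable_cst.
have [hc hd] := hs l' _ Ux; split.
  apply: (@continuous_comp _ _ _ lsubmx (partials l' h) x); last exact: hc.
  exact: (@continuous_lsubmx R 1 p q).
move=> i; apply: derivable_lsubmx; rewrite lsubmx_delta.
case: (fintype.split i) => [j|k]; first exact: hd.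
exact: derivable0.
Qed.

Lemma smooth_on_coord U (j : 'I_p) : smooth_on U (fun y => y 0 j).
Proof.
have lim_coord (v y : 'rV[R]_p) :
    (fun t : R => t^-1 *: (((fun y : 'rV[R]_p => y 0 j) \o shift y) (t *: v)
      - y 0 j)) t @[t --> 0^'] --> v 0 j.
  have c : cst (v 0 j) t @[t --> (0 : R)^'] --> v 0 j by exact: cvg_cst.
  apply: cvg_trans c; apply: (@near_eq_cvg _ _ (0 : R)^').
  near=> t; have t0 : t != 0 by near: t; exact: nbhs_dnbhs_neq.
  by rewrite /= !mxE addrK /GRing.scale /= mulrA mulVf ?mul1r.
have d (i : 'I_p) : 'D_(delta_mx 0 i) (fun y : 'rV[R]_p => y 0 j) =
    cst ((delta_mx 0 i : 'rV[R]_p) 0 j).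
  apply/funext => y; apply: cvg_lim => //; exact: lim_coord.
case/lastP => [|l i] x Ux.
  split; first exact: coord_continuous.
  by move=> i; apply/cvg_ex; eexists; exact: lim_coord.
have := smooth_on_cst ((delta_mx 0 i : 'rV[R]_p) 0 j) l Ux.
by rewrite -d /partials foldr_rcons.
Unshelve. all: by end_near. Qed.

Lemma deriveNv (g : 'rV[R]_p -> R) (v x : 'rV[R]_p) :
  derivable g x v -> 'D_(- v) g x = - 'D_v g x.
Proof.
move=> gd; apply: cvg_lim => //.
have opp0 : -%R t @[t --> (0 : R)^'] --> (0 : R)^'.
  move=> P P0; have : (- (0 : R))^' P by rewrite oppr0.
  by rewrite dnbhsN => -[A A0 <-]; apply: filterS A0 => t At; exists t.
have gN := @cvg_comp _ _ _ -%R _ _ _ _ opp0 gd.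
apply: cvg_trans (cvgN gN); apply: (@near_eq_cvg _ _ (0 : R)^').
by near=> t; rewrite /= fctE /= invrN !scaleNr opprK scalerN.
Unshelve. all: by end_near. Qed.

End SmoothTheory.

Section AVBundles.
Variables (R : realType) (n : nat).

(* A rank-one affine bundle modelled on [M * R], given as a principal
   (R,+)-bundle: [act z t] is z + t, and [avatlas] is a family of smooth local
   sections over open sets, whose differences are smooth. *)
Record AVbundle (M : manifold R n) := AVBundle {
  avtot :> Type;
  zeta : avtot -> M;
  act : avtot -> R -> avtot;
  avatlas : set (set M * (M -> avtot));
  act0 : forall z, act z 0 = z;
  actD : forall z t u, act z (t + u) = act (act z t) u;
  zeta_act : forall z t, zeta (act z t) = zeta z;
  act_trans : forall z z', zeta z = zeta z' -> exists t, act z' t = z;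
  act_free : forall z t, act z t = z -> t = 0;
  avatlas_cover : forall m, exists2 l, avatlas l & l.1 m;
  avatlas_open : forall l, avatlas l -> open l.1;
  avatlas_sec : forall l, avatlas l -> forall m, l.1 m -> zeta (l.2 m) = m;
  avatlas_compat : forall l l', avatlas l -> avatlas l' ->
    exists2 g : M -> R, smooth_fun (@matlas R n M) (l.1 `&` l'.1) g &
      forall m, l.1 m -> l'.1 m -> l'.2 m = act (l.2 m) (g m) }.

Variables (M : manifold R n) (Z : AVbundle M).

(* [sub z z'] is the number z - z', for z and z' in the same fibre. *)
Definition sub (z z' : Z) : R := xget 0 [set t | act z' t = z].

Definition is_section (sigma : M -> Z) : Prop :=
  (forall m, zeta (sigma m) = m) /\
  forall l, @avatlas M Z l ->
    smooth_fun (@matlas R n M) l.1 (fun m => sub (sigma m) (l.2 m)).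

Definition sec := {sigma : M -> Z | is_section sigma}.
Definition sec_fun (sigma : sec) : M -> Z := sval sigma.
Coercion sec_fun : sec >-> Funclass.

(* The affine coordinates (x, s) on Z, with s z = z - l.2 (zeta z). *)
Definition avchart (c : chart R M n) (l : set M * (M -> Z)) :
    chart R Z (n + 1) :=
  Chart ((@zeta M Z) @^-1` (l.1 `&` cdom c))
    (fun z => row_mx (cmap c (zeta z)) (sub z (l.2 (zeta z)))%:M)
    (fun y => act (l.2 (cinv c (lsubmx y))) (rsubmx y 0 0)).

Definition zatlas : set (chart R Z (n + 1)) :=
  [set k | exists c l, [/\ matlas c, @avatlas M Z l & k = avchart c l]].

Definition smoothZ (f : Z -> R) : Prop := smooth_fun zatlas setT f.
Definition Cinf := {f : Z -> R | smoothZ f}.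
Definition Cinf_fun (f : Cinf) : Z -> R := sval f.
Coercion Cinf_fun : Cinf >-> Funclass.

Lemma act_inj (z : Z) : injective (act z).
Proof.
move=> t u e; have : act (act z u) (t - u) = act z u.
  by rewrite -actD addrC subrK.
by move/act_free/eqP; rewrite subr_eq0 => /eqP.
Qed.

Lemma sub_unique (z z' : Z) t : act z' t = z -> sub z z' = t.
Proof.
move=> e; apply: (@act_inj z').
by rewrite e; apply: (xgetPex 0 (P := [set t | act z' t = z])); exists t.
Qed.

Lemma sub_act (z z' : Z) : zeta z = zeta z' -> act z' (sub z z') = z.
Proof. by move=> /act_trans [t e]; rewrite (sub_unique e). Qed.

Lemma sub_actr (z z' : Z) t :
  zeta z = zeta z' -> sub z (act z' t) = sub z z' - t.
Proof.
by move=> e; apply: sub_unique; rewrite -actD addrC subrK sub_act.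
Qed.

Lemma open_cmap (c : chart R M n) (U : set M) :
  matlas c -> open U -> open (cmap c @` (U `&` cdom c)).
Proof.
move=> ac Uo.
have -> : cmap c @` (U `&` cdom c) =
    (cmap c @` cdom c) `&` cinv c @^-1` U.
  apply/seteqP; split => [_ [m [Um cm] <-]|_ [[m cm <-]]] /=.
    by split; [exists m|rewrite /= (matlas_inv ac) ?inE].
  by rewrite (matlas_inv ac) ?inE // => Um; exists m.
have := matlas_invcont ac.
rewrite continuous_open_subspace; last exact: matlas_img.
move=> ic; rewrite openE => y [cy Uy]; apply: filterI.
  by apply: open_nbhs_nbhs; split => //; exact: matlas_img.
apply: (ic y); first by rewrite inE.
by apply: open_nbhs_nbhs; split.
Qed.

Lemma avchart_img (c : chart R M n) l : matlas c -> @avatlas M Z l ->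
  cmap (avchart c l) @` (setT `&` cdom (avchart c l)) =
  lsubmx @^-1` (cmap c @` (l.1 `&` cdom c)).
Proof.
move=> ac al; rewrite setTI; apply/seteqP; split =>
  [_ [z zU <-]|y [m mU my]] /=.
  by exists (zeta z); rewrite ?row_mxKl.
have zm : zeta (l.2 m) = m by apply: avatlas_sec; case: mU.
exists (act (l.2 m) (rsubmx y 0 0)) => /=; first by rewrite zeta_act zm.
rewrite zeta_act zm my (sub_unique erefl) -[RHS]hsubmxK; congr row_mx.
by apply/rowP => j; rewrite (ord1 j) mxE.
Qed.

Lemma open_avchart_img (c : chart R M n) l : matlas c -> @avatlas M Z l ->
  open (cmap (avchart c l) @` (setT `&` cdom (avchart c l))).
Proof.
move=> ac al; rewrite avchart_img //.
apply: (@open_comp _ _ (lsubmx : 'rV[R]_(n + 1) -> 'rV[R]_n)).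
  by move=> y _; exact: (@continuous_lsubmx R 1 n 1).
by apply: open_cmap => //; exact: avatlas_open.
Qed.

Lemma smoothZ_cst (a : R) : smoothZ (cst a).
Proof. by move=> _ [c [l [_ _ ->]]]; exact: smooth_on_cst. Qed.

Definition Cinf_cst (a : R) : Cinf := exist _ (cst a) (smoothZ_cst a).

(* F_tau *)
Definition Fsec (tau : M -> Z) : Z -> R := fun z => sub (tau (zeta z)) z.

Lemma smooth_Fsec (sigma : sec) : smoothZ (Fsec sigma).
Proof.
case: sigma => sigma [szeta ssmooth] _ [c [l [ac al ->]]].
set U := cmap _ @` _.
pose h := (fun m => sub (sigma m) (l.2 m)) \o cinv c.
have Uo : open U by exact: open_avchart_img.
have last0 : (fun y : 'rV[R]_(n + 1) => rsubmx y 0 0) =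
    (fun y => y 0 (rshift n ord0)) by apply/funext => y; rewrite mxE.
apply: (@smooth_on_ext _ _ _ ((h \o lsubmx) - (fun y => rsubmx y 0 0))) => //.
  rewrite /U avchart_img // => y [m [lm cm] my].
  rewrite /= /Fsec /h /= fctE /= zeta_act -my (matlas_inv ac) ?inE //.
  have zm : zeta (l.2 m) = m by exact: avatlas_sec.
  by rewrite zm sub_actr // szeta.
apply: smooth_on_sub => //; last by rewrite last0; exact: smooth_on_coord.
rewrite /U avchart_img //; apply: smooth_on_lsubmx.
exact: (ssmooth l al c ac).
Qed.

Definition FZ (sigma : sec) : Cinf := exist _ _ (smooth_Fsec sigma).

(* X_Z, whose flow is z |-> z - t. *)
Definition XZ_fun (f : Z -> R) : Z -> R :=
  fun z => derive1 (fun t : R => f (act z (- t))) 0.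

Lemma smooth_XZ (f : Cinf) : smoothZ (XZ_fun f).
Proof.
case: f => f fs _ [c [l [ac al ->]]]; set k := avchart c l.
set U := cmap _ @` _.
have Uo : open U by exact: open_avchart_img.
have ks : smooth_on U (f \o cinv k) by apply: fs; exists c, l.
pose e : 'rV[R]_(n + 1) := delta_mx 0 (rshift n ord0).
have -> : XZ_fun f \o cinv k = 'D_(- e) (f \o cinv k).
  apply/funext => y; rewrite /XZ_fun /= derive1E /derive.
  have -> // : (fun h : R => h^-1 *: (((fun t : R =>
        f (act (act (l.2 (cinv c (lsubmx y))) (rsubmx y 0 0)) (- t)))
        \o shift 0) (h *: 1) -
        f (act (act (l.2 (cinv c (lsubmx y))) (rsubmx y 0 0)) (- 0)))) =
      (fun h : R => h^-1 *: (((f \o cinv k) \o shift y) (h *: - e) -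
        (f \o cinv k) y)).
  apply/funext => h /=; congr (_ *: (f _ - f _)); last by rewrite oppr0 act0.
  rewrite -actD /GRing.scale /= mulr1 addr0.
  have -> : lsubmx (h *: - e + y) = lsubmx y.
    apply/rowP => j; rewrite !mxE eqxx /= -val_eqE /=.
    by rewrite ltn_eqF ?ltn_addr // oppr0 mulr0 add0r.
  by rewrite !mxE !eqxx mulrN mulr1 addrC.
have D y : U y -> 'D_(- e) (f \o cinv k) y = - 'D_e (f \o cinv k) y.
  by move=> Uy; apply: deriveNv; have [_] := ks [::] y Uy; exact.
apply: (@smooth_on_ext _ _ _ (cst 0 - 'D_e (f \o cinv k))) => //.
  by move=> y Uy; rewrite D // fctE sub0r.
apply: smooth_on_sub => //; first exact: smooth_on_cst.
exact: smooth_on_partial.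
Qed.

Definition XZ (f : Cinf) : Cinf := exist _ _ (smooth_XZ f).

Definition Pol (k : nat) : set Cinf :=
  [set f | forall z, iter k.+1 XZ f z = 0].

Definition vector_field (X : Cinf -> Cinf) : Prop :=
  forall k, zatlas k -> exists2 a : 'I_(n + 1) -> Z -> R,
    (forall i, smooth_on (cmap k @` cdom k) (a i \o cinv k)) &
    forall f z, cdom k z -> X f z = \sum_i a i z * partial k i f z.

Definition diff_op1 (D : Cinf -> Cinf) : Prop :=
  exists X (c : Cinf), vector_field X /\
    forall f z, D f z = X f z + c z * f z.

Definition D1ah : set (Cinf -> Cinf) :=
  [set D | diff_op1 D /\ forall k, D @` Pol k `<=` Pol k].

Definition invariant_fields : set (Cinf -> Cinf) :=
  [set X | vector_field X /\ forall f z, XZ (X f) z - X (XZ f) z = 0].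

(* phi0 D is the function with [D, X_Z] = phi0 D * X_Z, phi1 D the function on
   M whose pullback to Z is D 1. *)
Definition phi0 (D : Cinf -> Cinf) : M -> R :=
  xget (cst 0) [set a : M -> R |
    forall f z, D (XZ f) z - XZ (D f) z = a (zeta z) * XZ f z].

Definition phi1 (D : Cinf -> Cinf) : M -> R :=
  xget (cst 0) [set a : M -> R | forall z, D (Cinf_cst 1) z = a (zeta z)].

(* The value at m of D, seen as a section of RZ: the operator f |-> D f
   restricted to the fibre of Z over m (and extended by 0). The fibres of RZ
   are linear subspaces of [Cinf -> Z -> R], and Sec(RZ) is [D1ah]. *)
Definition value (D : Cinf -> Cinf) (m : M) : Cinf -> Z -> R :=
  fun f => (D f : Z -> R) \_ (@zeta M Z @^-1` [set m]).

Definition RZ (m : M) : set (Cinf -> Z -> R) := [set value D m | D in D1ah].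

Definition lfree r (v : 'I_r -> Cinf -> Z -> R) : Prop :=
  forall c : 'I_r -> R,
    (forall f z, \sum_i c i * v i f z = 0) -> forall i, c i = 0.

Definition lspan r (P : pred 'I_r) (v : 'I_r -> Cinf -> Z -> R) :
    set (Cinf -> Z -> R) :=
  [set w | exists c : 'I_r -> R,
    forall f z, w f z = \sum_(i | P i) c i * v i f z].

(* E is a vector subbundle of rank k of the rank r vector bundle RZ: locally
   RZ has a smooth frame whose first k members form a frame of E. *)
Definition vector_subbundle (E : M -> set (Cinf -> Z -> R)) : Prop :=
  exists r k : nat, (k <= r)%N /\
  forall m0, exists U (e : 'I_r -> Cinf -> Cinf),
    [/\ open U, U m0, forall i, D1ah (e i) &
      forall m, U m ->
        [/\ lfree (fun i => value (e i) m),
            RZ m = lspan xpredT (fun i => value (e i) m) &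
            E m = lspan (fun i => (i < k)%N) (fun i => value (e i) m)]].

Definition affine_subbundle (A E : M -> set (Cinf -> Z -> R)) : Prop :=
  vector_subbundle E /\
  forall m0, exists U (a : Cinf -> Cinf),
    [/\ open U, U m0, D1ah a &
      forall m, U m ->
        A m = [set (fun f z => value a m f z + v f z) | v in E m]].

Definition Sec (A : M -> set (Cinf -> Z -> R)) : set (Cinf -> Cinf) :=
  [set D | D1ah D /\ forall m, A m (value D m)].

(* The points of RZ at which (phi0, phi1) satisfies the relation P. As phi0 and
   phi1 are sections of the dual of RZ, phi0 D m and phi1 D m only depend on
   value D m. *)
Definition locus (P : R -> R -> Prop) (m : M) : set (Cinf -> Z -> R) :=
  [set value D m | D in [set D | D1ah D /\ P (phi0 D m) (phi1 D m)]].

Definition Ttilde := locus (fun p0 p1 => p0 = 0 /\ p1 = 0).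
Definition Ltilde := locus (fun p0 p1 => p1 - p0 = 0).
Definition Lbreve := locus (fun p0 p1 => p1 = 0).
Definition Tbar := locus (fun p0 p1 => p0 = - 1 /\ p1 = 0).
Definition Lbar := locus (fun p0 p1 => p1 - p0 = 1).

(* An affine bundle presented by its local trivializations: over the open set
   t.1, the map a |-> (aproj a, t.2 a) identifies the bundle with the product
   t.1 * R^arank. They determine the smooth structure and the affine structure
   of the fibres. *)
Record affbundle := AffBundle {
  atot :> Type;
  aproj : atot -> M;
  arank : nat;
  atrivs : set (set M * (atot -> 'rV[R]_arank)) }.

Definition affine_morphism (A B : affbundle) : set (A -> B) :=
  [set h | (forall a, aproj (h a) = aproj a) /\
    forall u v, @atrivs A u -> @atrivs B v ->
    exists (L : M -> 'M[R]_(arank A, arank B)) (b : M -> 'rV[R]_(arank B)),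
      [/\ forall i j, smooth_fun (@matlas R n M) (u.1 `&` v.1)
              (fun m => L m i j),
          forall j, smooth_fun (@matlas R n M) (u.1 `&` v.1)
              (fun m => b m 0 j) &
          forall a, u.1 (aproj a) -> v.1 (aproj a) ->
            v.2 (h a) = u.2 a *m L (aproj a) + b (aproj a)]].

Definition trivial_bundle : affbundle :=
  @AffBundle (M * R)%type fst 1
    [set (setT, fun p : M * R => (p.2)%:M : 'rV[R]_1)].

Definition av_bundle : affbundle :=
  @AffBundle Z (@zeta M Z) 1
    [set (l.1, fun z : Z => (sub z (l.2 (zeta z)))%:M : 'rV[R]_1) |
      l in @avatlas M Z].

Definition quot (T : Type) (e : T -> set T) : Type :=
  {P : set T | exists t, P = e t}.
Definition qclass T (e : T -> set T) (t : T) : quot e :=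
  exist _ (e t) (ex_intro _ t erefl).
Definition qrepr T (e : T -> set T) (q : quot e) : T := sval (cid (svalP q)).

Definition differential_zero (f : M -> R) (m : M) : Prop :=
  forall c, matlas c -> cdom c m -> forall i, partial c i f m = 0.

Definition phase_equiv (p : M * sec) : set (M * sec) :=
  [set q : M * sec | p.1 = q.1 /\
    differential_zero (fun m => sub (q.2 m) (p.2 m)) p.1].

Definition jet_equiv (p : M * sec) : set (M * sec) :=
  [set q : M * sec | [/\ p.1 = q.1, p.2 p.1 = q.2 p.1 :> Z &
    differential_zero (fun m => sub (q.2 m) (p.2 m)) p.1]].

(* Coordinates induced by (x^a, s): the derivatives of s \o sigma along x^a,
   preceded, for jets, by the value of s \o sigma. *)
Definition local_rep (l : set M * (M -> Z)) (p : M * sec) : M -> R :=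
  fun m => sub (p.2 m) (l.2 m).

Definition gradient (c : chart R M n) l (p : M * sec) : 'rV[R]_n :=
  \row_i partial c i (local_rep l p) p.1.

Definition phase_bundle : affbundle :=
  @AffBundle (quot phase_equiv) (fun q => (qrepr q).1) n
    [set t | exists c l, [/\ matlas c, @avatlas M Z l &
      t = (l.1 `&` cdom c, fun q => gradient c l (qrepr q))]].

Definition contact_bundle : affbundle :=
  @AffBundle (quot jet_equiv) (fun q => (qrepr q).1) (1 + n)
    [set t | exists c l, [/\ matlas c, @avatlas M Z l &
      t = (l.1 `&` cdom c, fun q =>
        row_mx (local_rep l (qrepr q) (qrepr q).1)%:M
               (gradient c l (qrepr q)))]].

Definition dsec (sigma : sec) (m : M) : phase_bundle :=
  qclass phase_equiv (m, sigma).
Definition jsec (sigma : sec) (m : M) : contact_bundle :=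
  qclass jet_equiv (m, sigma).

Definition ADer (A : affbundle) := affine_morphism (A := phase_bundle) (B := A).
Definition ADO1 (A : affbundle) :=
  affine_morphism (A := contact_bundle) (B := A).

(* F_{D(sigma)} = D(F_sigma), where D(sigma) = h (j sigma) is a function on M
   (a section of M * R), resp. a section of Z. *)
Definition same_action_fun (J : affbundle) (j : sec -> M -> J)
    (D : Cinf -> Cinf) (h : J -> trivial_bundle) : Prop :=
  forall sigma, (D (FZ sigma) : Z -> R) =
    (fun m => (h (j sigma m)).2) \o @zeta M Z.

Definition same_action_sec (J : affbundle) (j : sec -> M -> J)
    (D : Cinf -> Cinf) (h : J -> av_bundle) : Prop :=
  forall sigma, (D (FZ sigma) : Z -> R) = Fsec (fun m => h (j sigma m)).

Definition identified T T' (S : set T) (S' : set T')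
    (agree : T -> T' -> Prop) :=
  exists2 Phi : T -> T', set_bij S S' Phi & forall D, S D -> agree D (Phi D).

End AVBundles.

Arguments Ttilde {R n M} Z _.
Arguments Ltilde {R n M} Z _.
Arguments Lbreve {R n M} Z _.
Arguments Tbar {R n M} Z _.
Arguments Lbar {R n M} Z _.
Arguments ADer {R n M} Z A _.
Arguments ADO1 {R n M} Z A _.
Arguments invariant_fields {R n M} Z _.
Arguments dsec {R n M} Z _ _.
Arguments jsec {R n M} Z _ _.

(* Main.v *)
(* Bump functions on M and its second countability give a global section s0 of
   Z, hence a global affine fibre coordinate F = F_s0 with X_Z F = 1. In terms
   of it every operator in D^1_ah has the form D = Y + (A F + B) X_Z + C,
   where Y is a vector field on M lifted along the translates of s0 and A, B,
   C are functions on M: the action of D on 1, on F and on functions pulled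
   back from M lies in Pol^0 or Pol^1, which determines C, A, B and Y.
   Conversely such an operator satisfies [D, X_Z] = - A X_Z (symmetry of
   second derivatives), so it preserves every Pol^k, with phi^0 = - A and
   phi^1 = C. Local frames of RZ are then formed by coordinate vector fields,
   X_Z, F X_Z and the identity, and for sigma = s0 + u one finds D F_sigma = Y
   u + B + C u + (A + C) F. Since A + C = phi^1 - phi^0 is 0 or 1 in the four
   cases, this is the pull-back of a function, resp. F_tau for a section tau,
   and u |-> Y u + B + C u is the general affine first-order operator, which
   factors through PZ exactly when C = 0. *)
Require Import Defs.
From mathcomp Require Import all_boot all_order all_algebra.
From mathcomp Require Import boolp classical_sets functions reals topology.
From mathcomp Require Import normedtype derive numfun.
From mathcomp Require Import cardinality realfun sequences exp ring lra.

Set Implicit Arguments.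
Unset Strict Implicit.
Unset Printing Implicit Defensive.

Import Order.TTheory GRing.Theory Num.Theory.
Import numFieldNormedType.Exports.

Local Open Scope classical_set_scope.
Local Open Scope ring_scope.

(** * Smooth functions on open subsets of coordinate space *)

(** Smoothness here means that all iterated partial derivatives exist and are continuous, so the
    calculus (quotients, chain rule, symmetry of second derivatives) is derived from partial
    derivatives alone. A global section can be obtained because each fibre is an affine line: local
    sections may be averaged with weights of sum 1. The functions 1, F and the pull-backs suffice as
    test functions because a vector field on Z is determined by its values on F and on pull-backs:
    subtracting (X F) X_Z leaves a field tangent to the translates of s0. All four identifications
    are instances of one statement with two parameters: whether C must vanish, and the value kappa
    of A + C. Operators and bundle morphisms are compared through an intermediate notion, maps on
    sections given in every chart by an affine first-order formula; this notion mentions no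
    quotient, so the choice of representatives of jets and of differentials is dealt with once for
    all cases. *)

Section Generated.
Variables (R : realType) (p : nat).
Implicit Types (U : set 'rV[R]_p) (g h : 'rV[R]_p -> R).

(** Smoothness of products, quotients and composites follows one scheme: if the first derivatives of
    the generators lie in the algebra they generate, the Leibniz rule closes the whole algebra under
    derivation, and closure yields every higher derivative without a formula for it. *)
Inductive gen_alg (S : set ('rV[R]_p -> R)) : set ('rV[R]_p -> R) :=
| gen_cst a : gen_alg S (cst a)
| gen_base g : S g -> gen_alg S g
| gen_add g h : gen_alg S g -> gen_alg S h -> gen_alg S (g + h)
| gen_mul g h : gen_alg S g -> gen_alg S h -> gen_alg S (g * h).

Lemma gen_sum (S : set ('rV[R]_p -> R)) (I : Type) (r : seq I) (P : pred I)
    (F : I -> 'rV[R]_p -> R) :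
  (forall i, P i -> gen_alg S (F i)) -> gen_alg S (\sum_(i <- r | P i) F i).
Proof.
move=> SF; apply: big_ind => //; first exact: gen_cst.
exact: gen_add.
Qed.

(** The derivative is matched with [h'] only on [U], where formulas such as that for 1/g are valid.
    [S] and [T] are separate so that a generator may have its derivatives in the generated
    algebra. *)
Definition stable_on U (S T : set ('rV[R]_p -> R)) := forall h, S h ->
  (forall x, U x -> {for x, continuous h} /\
     forall i, derivable h x (delta_mx 0 i)) /\
  forall i, exists2 h', T h' & forall x, U x -> 'D_(delta_mx 0 i) h x = h' x.

Lemma stable_gen U S : stable_on U S (gen_alg S) ->
  stable_on U (gen_alg S) (gen_alg S).
Proof.
move=> HS h; elim => {h}.
- move=> a; split.
    by move=> x Ux; split; [exact: cst_continuous|move=> i;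
      exact: derivable_cst].
  by move=> i; exists (cst 0); [exact: gen_cst|move=> x Ux; rewrite derive_cst].
- by move=> g /HS.
- move=> g h Sg [gr gd] Sh [hr hd]; split.
    move=> x Ux; have [[gc g1] [hc h1]] := (gr x Ux, hr x Ux); split.
      exact: cvgD gc hc.
    by move=> i; exact: derivableD.
  move=> i; have [[g' Sg' eg] [h' Sh' eh]] := (gd i, hd i).
  exists (g' + h'); first exact: gen_add.
  move=> x Ux; have [[gc g1] [hc h1]] := (gr x Ux, hr x Ux).
  by rewrite deriveD // eg // eh.
- move=> g h Sg [gr gd] Sh [hr hd]; split.
    move=> x Ux; have [[gc g1] [hc h1]] := (gr x Ux, hr x Ux); split.
      exact: cvgM gc hc.
    by move=> i; exact: derivableM.
  move=> i; have [[g' Sg' eg] [h' Sh' eh]] := (gd i, hd i).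
  exists (g * h' + h * g').
    by apply: gen_add; apply: gen_mul.
  move=> x Ux; have [[gc g1] [hc h1]] := (gr x Ux, hr x Ux).
  by rewrite deriveM // eg // eh.
Qed.

(** Closure lets each iterated derivative be replaced, on the open set [U], by a member of [S],
    which can be differentiated once more. *)
Lemma stable_smooth U S : open U -> stable_on U S S ->
  forall h, S h -> smooth_on U h.
Proof.
move=> Uo HS h Sh l.
have [h' Sh' e] : exists2 h', S h' & forall x, U x -> partials l h x = h' x.
  elim: l => [|i l [h' Sh' e]]; first by exists h.
  have [_ /(_ i) [h'' Sh'' e']] := HS _ Sh'.
  exists h'' => // x Ux /=; rewrite -/(partials l h) -e' //.
  apply: near_eq_derive.
  by move: (open_nbhs_nbhs (conj Uo Ux)); apply: filterS => y; exact: e.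
move=> x Ux; have [/(_ x Ux) [hc hd] _] := HS _ Sh'.
have ne : \forall y \near x, h' y = partials l h y.
  by move: (open_nbhs_nbhs (conj Uo Ux)); apply: filterS => y /e.
split; last by move=> i; apply: near_eq_derivable (hd i).
rewrite /prop_for /continuous_at e //.
by apply: cvg_trans hc; apply: (@near_eq_cvg _ _ (nbhs x)).
Qed.

Lemma smooth_gen U S : open U -> stable_on U S (gen_alg S) ->
  forall h, gen_alg S h -> smooth_on U h.
Proof. by move=> Uo /stable_gen HS; exact: stable_smooth. Qed.

Lemma smooth_on_reg U h : smooth_on U h ->
  (forall x, U x -> {for x, continuous h} /\
     forall i, derivable h x (delta_mx 0 i)).
Proof. by move=> hs x Ux; exact: (hs [::] x Ux). Qed.

Lemma smooth_stable U (S : set ('rV[R]_p -> R)) :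
  smooth_on U `<=` S -> stable_on U (smooth_on U) (gen_alg S).
Proof.
move=> US h hs; split; first exact: smooth_on_reg.
move=> i; exists ('D_(delta_mx 0 i) h) => //.
by apply: gen_base; apply: US; exact: smooth_on_partial.
Qed.

Lemma gen_smooth U h : open U -> gen_alg (smooth_on U) h -> smooth_on U h.
Proof. by move=> Uo; apply: smooth_gen => //; exact: smooth_stable. Qed.

Lemma smooth_onD U g h : open U -> smooth_on U g -> smooth_on U h ->
  smooth_on U (g + h).
Proof.
by move=> Uo gs hs; apply: gen_smooth => //; apply: gen_add; exact: gen_base.
Qed.

Lemma smooth_onM U g h : open U -> smooth_on U g -> smooth_on U h ->
  smooth_on U (g * h).
Proof.
by move=> Uo gs hs; apply: gen_smooth => //; apply: gen_mul; exact: gen_base.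
Qed.

Lemma smooth_on_sum U (I : Type) (r : seq I) (P : pred I)
    (F : I -> 'rV[R]_p -> R) : open U ->
  (forall i, P i -> smooth_on U (F i)) ->
  smooth_on U (\sum_(i <- r | P i) F i).
Proof.
move=> Uo Fs; apply: gen_smooth => //; apply: gen_sum => i /Fs.
exact: gen_base.
Qed.

(** The generators are the smooth functions and 1/g, whose derivative -(1/g)^2 dg is a product of
    generators. *)
Lemma smooth_onV U g : open U -> (forall x, U x -> g x != 0) ->
  smooth_on U g -> smooth_on U (fun x => (g x)^-1).
Proof.
move=> Uo g0 gs.
pose S := smooth_on U `|` [set (fun x => (g x)^-1)].
have Sg : gen_alg S (fun x => (g x)^-1) by apply: gen_base; right.
apply: smooth_gen Sg => // h [hs|->]; first by apply: smooth_stable hs => k;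
  left.
split.
  move=> x Ux; have [gc gd] := smooth_on_reg gs Ux; split.
    exact: (cvgV (g0 x Ux) gc).
  by move=> i; apply: derivableV => //; exact: g0.
move=> i; exists (cst (-1) * ((fun x => (g x)^-1) * (fun x => (g x)^-1)) *
    'D_(delta_mx 0 i) g).
  do ![apply: gen_mul|apply: gen_cst]; apply: gen_base; do ?by right.
  by left; exact: smooth_on_partial.
move=> x Ux; have [_ gd] := smooth_on_reg gs Ux.
rewrite deriveV //; last exact: g0.
by rewrite /GRing.scale /= !fctE expr2 invfM !mulNr mul1r.
Qed.

Lemma smooth_on_subset U V g : V `<=` U -> smooth_on U g -> smooth_on V g.
Proof. by move=> VU gs l x /VU; exact: gs. Qed.

Lemma smooth_on_local U g :
  (forall x, U x -> exists2 V, V x & smooth_on V g) -> smooth_on U g.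
Proof. by move=> sec_coord l x Ux; have [V Vx gs] := sec_coord x Ux;
  exact: gs. Qed.

End Generated.

(** * Mean value theorem, Hadamard's decomposition and the chain rule *)

Section Chain.
Variable R : realType.

(** Absolute values allow increments of either sign, and zero, to be treated alike. *)
Lemma MVT_norm (f df : R -> R) (h : R) :
  (forall t : R, `|t| <= `|h| -> is_derive t (1 : R) f (df t)) ->
  exists2 c, `|c| <= `|h| & f h - f 0 = df c * h.
Proof.
move=> fd; have [h0|h0|->] := ltgtP h 0.
- have [||c] := @MVT _ f df h 0 h0.
  + move=> t; rewrite in_itv /= => /andP[ht t0]; apply: fd.
    by rewrite !ltr0_norm // lerN2 ltW.
  + apply: derivable_within_continuous => t; rewrite in_itv /= => /andP[ht t0].
    have : is_derive t (1 : R) f (df t) by apply: fd;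
      rewrite !ler0_norm // ?lerN2 // ltW.
    by case.
  + rewrite in_itv /= => /andP[hc c0] e; exists c.
      by rewrite !ltr0_norm // lerN2 ltW.
    by rewrite -opprB e sub0r mulrN opprK.
- have [||c] := @MVT _ f df 0 h h0.
  + move=> t; rewrite in_itv /= => /andP[t0 ht]; apply: fd.
    by rewrite !gtr0_norm // ltW.
  + apply: derivable_within_continuous => t; rewrite in_itv /= => /andP[t0 ht].
    have : is_derive t (1 : R) f (df t) by apply: fd; rewrite !ger0_norm // ltW.
    by case.
  + rewrite in_itv /= => /andP[c0 hc] e; exists c.
      by rewrite !gtr0_norm // ltW.
    by rewrite e subr0.
- by exists 0 => //; rewrite subrr mulr0.
Qed.

Lemma cvg_near_eq (T : Type) (V : topologicalType) (F : set_system T)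
    {FF : Filter F} (f g : T -> V) (l : V) :
  {near F, f =1 g} -> f t @[t --> F] --> l -> g t @[t --> F] --> l.
Proof.
move=> e; apply: cvg_trans; apply: near_eq_cvg.
by apply: filterS e => t ->.
Qed.

Lemma cvg_sumr (T I : Type) (F : set_system T) {FF : Filter F} (r : seq I)
    (P : pred I) (f : I -> T -> R) (l : I -> R) :
  (forall i, P i -> f i t @[t --> F] --> l i) ->
  (\sum_(i <- r | P i) f i t) @[t --> F] --> \sum_(i <- r | P i) l i.
Proof.
move=> fl; rewrite -fct_sumE; elim/big_rec2: _ => [|i a g Pi gc].
  exact: cvg_cst.
by apply: cvgD => //; exact: fl.
Qed.

Variable p : nat.
Implicit Types (U : set 'rV[R]_p) (g h : 'rV[R]_p -> R).

Lemma is_derive_line g (x v : 'rV[R]_p) (t : R) :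
  derivable g (x + t *: v) v ->
  is_derive t (1 : R) (fun s : R => g (x + s *: v)) ('D_v g (x + t *: v)).
Proof.
move=> gd.
have e : (fun h : R => h^-1 *: (((fun s : R => g (x + s *: v)) \o shift t)
  (h *: 1)
      - g (x + t *: v))) =
    (fun h : R => h^-1 *: ((g \o shift (x + t *: v)) (h *: v) - g
      (x + t *: v))).
  apply/funext => h /=; congr (_ *: (g _ - _)).
  by rewrite /GRing.scale /= mulr1 -/(_ *: _) scalerDl addrCA.
by apply: DeriveDef; rewrite /derivable /derive e.
Qed.

Lemma ball_rV (x y : 'rV[R]_p) (r : R) : 0 < r ->
  (forall i, `|y 0 i - x 0 i| < r) -> ball x r y.
Proof.
by move=> r0 H; split => // i j; rewrite (ord1 i) -ball_normE /= distrC.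
Qed.

Lemma ball_rV_coord (x y : 'rV[R]_p) (r : R) i :
  ball x r y -> `|y 0 i - x 0 i| < r.
Proof. by case=> _ /(_ 0 i); rewrite -ball_normE /= distrC. Qed.

Lemma nbhs_rV (x : 'rV[R]_p) (A : set 'rV[R]_p) : nbhs x A ->
  exists2 r : R, 0 < r & forall y : 'rV[R]_p, (forall i, `|y 0 i - x 0 i| < r)
    -> A y.
Proof.
move=> /nbhs_ballP[r /= r0 rA]; exists r => // y H; apply: rA.
exact: ball_rV.
Qed.

Lemma cvg_rV (T : Type) (F : set_system T) {FF : Filter F}
    (f : T -> 'rV[R]_p) (x : 'rV[R]_p) :
  (forall i, f t 0 i @[t --> F] --> x 0 i) -> f t @[t --> F] --> x.
Proof.
move=> fc; apply/cvg_ballP => e e0.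
have : forall i, \forall t \near F, `|f t 0 i - x 0 i| < e.
  move=> i; move/cvg_ballP: (fc i) => /(_ e e0).
  by apply: filterS => t; rewrite -ball_normE /= distrC.
move=> /filter_forall; apply: filterS => t H; exact: ball_rV.
Qed.

(** The path from x to y that changes one coordinate at a time splits g y - g x into increments
    along axes. The mean value theorem turns each into a partial derivative at a nearby point, and
    continuity at x gives the limit. *)
Lemma hadamard U g (x : 'rV[R]_p) : open U -> U x ->
  (forall i y, U y -> derivable g y (delta_mx 0 i)) ->
  (forall i, {for x, continuous ('D_(delta_mx 0 i) g)}) ->
  exists2 G : 'I_p -> 'rV[R]_p -> R,
    forall i, G i y @[y --> x] --> 'D_(delta_mx 0 i) g x &
    forall y, g y - g x = \sum_i (y 0 i - x 0 i) * G i y.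
Proof.
move=> Uo Ux gd gc.
(* [P k y] is the k-th vertex of the path: k coordinates of y, the others of x. *)
pose P (k : nat) (y : 'rV[R]_p) : 'rV[R]_p :=
  \row_i if (i < k)%N then y 0 i else x 0 i.
have PS (i : 'I_p) y : P i.+1 y = P i y + (y 0 i - x 0 i) *: delta_mx 0 i.
  apply/rowP => j; rewrite !mxE eqxx /= ltnS leq_eqVlt -(inj_eq val_inj) /=.
  have [ji|ji] := eqVneq (j : nat) i; last by rewrite mulr0 addr0.
  by rewrite (ord_inj ji) ltnn mulr1 addrC subrK.
(* Where the i-th coordinates agree the quotient is undefined; the derivative at x is the value that
   keeps the limit. *)
pose G (i : 'I_p) (y : 'rV[R]_p) := if y 0 i == x 0 i then 'D_(delta_mx 0 i) g x
  else (g (P i.+1 y) - g (P i y)) / (y 0 i - x 0 i).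
exists G; last first.
  move=> y; have -> : g y = g (P p y).
    by congr g; apply/rowP => i; rewrite mxE ltn_ord.
  have -> : g x = g (P 0 y).
    by congr g; apply/rowP => i; rewrite mxE.
  rewrite -(telescope_sumr (fun k => g (P k y))) // big_mkord.
  apply: eq_bigr => i _; rewrite /G; case: eqP => [e|/eqP ne].
    by rewrite PS e subrr scale0r addr0 subrr mul0r.
  by rewrite mulrC divfK // subr_eq0.
have FF : Filter (nbhs x) by exact: nbhs_filter.
move=> i; apply/(@cvgrPdist_lt _ _ _ _ (fmap_filter _ FF)) => e e0.
have [r r0 rU] : exists2 r : R, 0 < r &
    forall y : 'rV[R]_p, (forall i, `|y 0 i - x 0 i| < r) ->
      (U `&` [set y | `|'D_(delta_mx 0 i) g x - 'D_(delta_mx 0 i) g y| < e]) y.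
  apply: nbhs_rV; apply: (@filterI _ _ (nbhs_filter x));
    first exact: open_nbhs_nbhs.
  by move/cvgrPdist_lt: (gc i); exact.
have : \forall y \near x, ball x r y by exact: nbhsx_ballx.
apply: filterS => y xy; rewrite /= /G; case: (@eqP _ (y 0 i)) => [_|/eqP ne];
  first by rewrite subrr normr0.
have seg (t : R) : `|t| <= `|y 0 i - x 0 i| ->
    U (P i y + t *: delta_mx 0 i) /\
    `|'D_(delta_mx 0 i) g x - 'D_(delta_mx 0 i) g (P i y + t *: delta_mx 0 i)|
      < e.
  move=> ty; apply: rU => j; rewrite !mxE eqxx /= -(inj_eq val_inj) /=.
  have [ji|ji] := eqVneq (j : nat) i.
    rewrite ji ltnn (ord_inj ji) mulr1 addrAC subrr add0r.
    by apply: le_lt_trans ty _; exact: ball_rV_coord.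
  rewrite mulr0 addr0; case: ifP => _; first exact: ball_rV_coord.
  by rewrite subrr normr0.
have [t /seg [Ut] gt] := @MVT_norm (fun t => g (P i y + t *: delta_mx 0 i)) _
  (y 0 i - x 0 i) (fun t ty => is_derive_line (gd i _ (seg t ty).1)).
rewrite -PS scale0r addr0 => ->.
by rewrite mulfK // subr_eq0.
Qed.

(** Hadamard's decomposition at phi x, evaluated at phi (x + tv) and divided by t, is a sum of
    difference quotients of the coordinates of phi times factors that converge. *)
Lemma is_derive_comp q U g (phi : 'rV[R]_q -> 'rV[R]_p) (x v : 'rV[R]_q) :
  open U -> U (phi x) ->
  (forall i y, U y -> derivable g y (delta_mx 0 i)) ->
  (forall i, {for phi x, continuous ('D_(delta_mx 0 i) g)}) ->
  (forall i, derivable (fun y => phi y 0 i) x v) ->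
  is_derive x v (g \o phi) (\sum_i 'D_v (fun y => phi y 0 i) x *
                                   'D_(delta_mx 0 i) g (phi x)).
Proof.
move=> Uo Ux gd gc phid.
have [G Gc Ge] := hadamard Uo Ux gd gc.
have coordc i : phi (t *: v + x) 0 i @[t --> (0 : R)^'] --> phi x 0 i.
  have dq := phid i; rewrite /derivable in dq.
  have id0 : t @[t --> (0 : R)^'] --> (0 : R) by exact: (@nbhs_dnbhs R 0).
  have cc : cst (phi x 0 i) t @[t --> (0 : R)^'] --> phi x 0 i by exact:
    cvg_cst.
  have C := cvgD (FF := dnbhs_filter _) cc
    (cvgM (FF := dnbhs_filter _) id0 dq); rewrite mul0r addr0 in C.
  apply: (cvg_near_eq _ C).
  near=> t; have t0 : t != 0 by near: t; exact: nbhs_dnbhs_neq.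
  by rewrite /= !fctE /= /GRing.scale /= mulrA mulfV // mul1r addrC subrK.
have phic : phi (t *: v + x) @[t --> (0 : R)^'] --> phi x by exact: cvg_rV.
have key : (fun t : R => t^-1 *: (((g \o phi) \o shift x) (t *: v) - (g \o phi)
  x))
    t @[t --> (0 : R)^'] -->
    \sum_i 'D_v (fun y => phi y 0 i) x * 'D_(delta_mx 0 i) g (phi x).
  have -> : (fun t : R => t^-1 *: (((g \o phi) \o shift x) (t *: v) -
    (g \o phi) x))
    = (fun t : R => \sum_i (t^-1 *: (((fun y => phi y 0 i) \o shift x) (t *: v)
          - phi x 0 i)) * G i (phi (t *: v + x))).
    apply/funext => t /=; rewrite Ge scaler_sumr; apply: eq_bigr => i _.
    by rewrite scalerAl.
  apply: cvg_sumr => i _; apply: cvgM; first exact: phid.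
  exact: (cvg_comp _ _ phic (Gc i)).
by apply: DeriveDef; [apply/cvg_ex; eexists; exact: key|apply: cvg_lim].
Unshelve. all: by end_near. Qed.

End Chain.

Section SmoothComp.
Variables (R : realType) (p q : nat).

Lemma smooth_on_derive_comp (U : set 'rV[R]_p) (g : 'rV[R]_p -> R)
    (phi : 'rV[R]_q -> 'rV[R]_p) (x v : 'rV[R]_q) :
  open U -> smooth_on U g -> U (phi x) ->
  (forall i, derivable (fun y => phi y 0 i) x v) ->
  is_derive x v (g \o phi) (\sum_i 'D_v (fun y => phi y 0 i) x *
                                   'D_(delta_mx 0 i) g (phi x)).
Proof.
move=> Uo gs Ux phid; apply: (is_derive_comp Uo Ux _ _ phid).
  by move=> i y Uy; have [_] := smooth_on_reg gs Uy; exact.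
by move=> i; have [] := smooth_on_reg (smooth_on_partial i gs) Ux.
Qed.

(** The generators are the smooth functions on [V] and all composites with phi; by the chain rule a
    derivative of a composite is a sum of products of these. *)
Lemma smooth_on_comp (U : set 'rV[R]_p) (V : set 'rV[R]_q)
    (g : 'rV[R]_p -> R) (phi : 'rV[R]_q -> 'rV[R]_p) :
  open U -> open V -> (forall x, V x -> U (phi x)) ->
  smooth_on U g -> (forall i, smooth_on V (fun y => phi y 0 i)) ->
  smooth_on V (g \o phi).
Proof.
move=> Uo Vo VU gs phis.
pose S := smooth_on V `|` [set (h \o phi) | h in smooth_on U].
have Sg : gen_alg S (g \o phi) by apply: gen_base; right; exists g.
have Sl h : smooth_on V h -> gen_alg S h by move=> hs; apply: gen_base; left.
apply: smooth_gen Sg => // h [hs|[k ks <-]].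
  by apply: smooth_stable hs => k; left.
have kd x (i : 'I_q) : V x -> is_derive x (delta_mx 0 i) (k \o phi)
    (\sum_j 'D_(delta_mx 0 i) (fun y => phi y 0 j) x *
            'D_(delta_mx 0 j) k (phi x)).
  move=> Vx; apply: (smooth_on_derive_comp Uo ks (VU _ Vx)) => j.
  by have [_] := smooth_on_reg (phis j) Vx; exact.
split.
  move=> x Vx; split; last by move=> i; case: (kd x i Vx).
  apply: (@continuous_comp _ _ _ phi k x).
    have FF : Filter (nbhs x) by exact: nbhs_filter.
    by apply: (@cvg_rV _ _ _ _ FF) => i; have [] := smooth_on_reg (phis i) Vx.
  by have [] := smooth_on_reg ks (VU _ Vx).
move=> i; exists (\sum_j 'D_(delta_mx 0 i) (fun y => phi y 0 j) *
    ('D_(delta_mx 0 j) k \o phi)).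
  apply: gen_sum => j _; apply: gen_mul.
    by apply: Sl; exact: smooth_on_partial.
  have kjs := smooth_on_partial j ks.
  by apply: gen_base; right; exact: (ex_intro2 _ _ _ kjs erefl).
move=> x Vx; have [_ ->] := kd x i Vx.
by rewrite fct_sumE.
Qed.

End SmoothComp.

(** * Symmetry of second derivatives *)

Section Schwarz.
Variables (R : realType) (p : nat).

(** Two applications of the mean value theorem to the second difference over a square of side s:
    first along u, to the difference in direction v, then along v. *)
Lemma mixed_difference (g : 'rV[R]_p -> R) (x : 'rV[R]_p) (i j : 'I_p)
  (r s : R) :
  let u := delta_mx 0 i in let v := delta_mx 0 j in
  (forall y : 'rV[R]_p, (forall k, `|y 0 k - x 0 k| < r) ->
    derivable g y u /\ derivable ('D_u g) y v) ->
  0 < s -> s + s < r ->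
  exists2 y : 'rV[R]_p, (forall k, `|y 0 k - x 0 k| <= s + s) &
    g (x + s *: u + s *: v) - g (x + s *: u) - g (x + s *: v) + g x =
    'D_v ('D_u g) y * s * s.
Proof.
move=> u v gd s0 sr.
have near_x (a b : R) : `|a| <= s -> `|b| <= s ->
    forall k, `|(x + a *: u + b *: v) 0 k - x 0 k| <= s + s.
  move=> a_s bs k; rewrite !mxE eqxx /=.
  have -> (y z w : R) : y + z + w - y = z + w by ring.
  apply: le_trans (ler_normD _ _) _; apply: lerD; rewrite normrM.
    by apply: le_trans a_s; rewrite ler_piMr //; case: eqP;
      rewrite ?normr1 ?normr0.
  by apply: le_trans bs; rewrite ler_piMr //; case: eqP;
    rewrite ?normr1 ?normr0.
have near_lt (a b : R) : `|a| <= s -> `|b| <= s ->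
    forall k, `|(x + a *: u + b *: v) 0 k - x 0 k| < r.
  by move=> ? ? k; apply: le_lt_trans sr; exact: near_x.
have sE : `|s| = s by rewrite gtr0_norm.
have s1 : `|s| <= s by rewrite sE.
have n0 : `|0 : R| <= s by rewrite normr0 ltW.
have shuffle (a b : R) : x + a *: u + b *: v = x + b *: v + a *: u.
  by rewrite addrAC.
pose f (a : R) := g (x + s *: v + a *: u) - g (x + a *: u).
have [|a] := @MVT_norm _ f (fun a => 'D_u g (x + s *: v + a *: u) -
    'D_u g (x + a *: u)) s.
  move=> a; rewrite sE => a_s; apply: is_deriveB; apply: is_derive_line.
    by rewrite -shuffle; have [] := gd _ (near_lt a s a_s s1).
  by have := (gd _ (near_lt a 0 a_s n0)).1; rewrite scale0r addr0.
rewrite sE => a_s e1.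
have [|b] := @MVT_norm _ (fun b => 'D_u g (x + a *: u + b *: v))
    (fun b => 'D_v ('D_u g) (x + a *: u + b *: v)) s.
  move=> b; rewrite sE => b_s; apply: is_derive_line.
  by have [] := gd _ (near_lt a b a_s b_s).
rewrite sE scale0r addr0 => b_s e2.
exists (x + a *: u + b *: v); first exact: near_x.
rewrite -e2 [x + a *: u + _]shuffle -e1 /f !scale0r !addr0 -shuffle; ring.
Qed.

Lemma close_values (a b c d u v s e : R) : (s == 0) = false ->
  a = c * s * s -> b = d * s * s -> a = b ->
  `|u - d| < e / 2 -> `|v - c| < e / 2 -> `|u - v| <= e.
Proof.
move=> /negbT s0 -> -> /(mulIf s0) /(mulIf s0) <- uc vc.
rewrite [e]splitr; apply/ltW; apply: le_lt_trans (ltrD uc vc).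
have -> : u - v = (u - c) - (v - c) by ring.
exact: ler_normB.
Qed.

(** The second difference is symmetric in the two directions, so both mixed derivatives take a
    common value at points arbitrarily close to x; continuity moves these points to x. *)
Lemma schwarz (U : set 'rV[R]_p) (g : 'rV[R]_p -> R) (x : 'rV[R]_p)
    (i j : 'I_p) : open U -> smooth_on U g -> U x ->
  'D_(delta_mx 0 i) ('D_(delta_mx 0 j) g) x =
  'D_(delta_mx 0 j) ('D_(delta_mx 0 i) g) x.
Proof.
move=> Uo gs Ux; set u := delta_mx 0 i; set v := delta_mx 0 j.
apply/eqP; rewrite -subr_eq0 -normr_le0; apply/ler_addgt0Pl => e e0.
rewrite addr0; have e2 : 0 < e / 2 by rewrite divr_gt0.
have FF : Filter (nbhs x) by exact: nbhs_filter.
have cont (k l : 'I_p) : \forall y \near x,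
    `|'D_(delta_mx 0 k) ('D_(delta_mx 0 l) g) x -
      'D_(delta_mx 0 k) ('D_(delta_mx 0 l) g) y| < e / 2.
  have [+ _] := smooth_on_reg (smooth_on_partial k (smooth_on_partial l gs)) Ux.
  by move/(@cvgrPdist_lt _ _ _ _ (fmap_filter _ FF)); exact.
have N : nbhs x (U `&` ([set y | `|'D_u ('D_v g) x - 'D_u ('D_v g) y| < e / 2]
    `&` [set y | `|'D_v ('D_u g) x - 'D_v ('D_u g) y| < e / 2])).
  by do ![apply: filterI]; [exact: open_nbhs_nbhs|exact: cont|exact: cont].
have [r r0 rU] := nbhs_rV N.
have gd (k l : 'I_p) (y : 'rV[R]_p) : (forall m, `|y 0 m - x 0 m| < r) ->
    derivable g y (delta_mx 0 k) /\
    derivable ('D_(delta_mx 0 k) g) y (delta_mx 0 l).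
  move=> /rU[Uy _]; split; first by have [_] := smooth_on_reg gs Uy; exact.
  by have [_] := smooth_on_reg (smooth_on_partial k gs) Uy; exact.
have s0 : 0 < r / 3 by rewrite divr_gt0.
have sr : r / 3 + r / 3 < r by lra.
have [y yr ey] := mixed_difference (gd i j) s0 sr.
have [z zr ez] := mixed_difference (gd j i) s0 sr.
have [_ [_ yu]] := rU y (fun k => le_lt_trans (yr k) sr).
have [_ [zv _]] := rU z (fun k => le_lt_trans (zr k) sr).
apply: (close_values (gt_eqF s0) ey ez _ zv yu).
rewrite [x + _ *: v + _ *: u]addrAC; congr (_ + _); exact: addrAC.
Qed.

End Schwarz.

(** * Bump functions *)

Section Bump.
Variable R : realType.

(** The function e^(-1/t) extended by 0, with a polynomial factor in 1/t that makes the family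
    closed under differentiation. *)
Definition flat (P : {poly R}) (t : R) : R :=
  if 0 < t then P.[t^-1] * expR (- t^-1) else 0.

(** With n at least the degree of P, the term x^(n+1)/(n+1)! of the series of e^x at x = 1/t
    dominates P(x) and leaves one factor t to spare. *)
Lemma flat_bound (P : {poly R}) :
  exists2 K : R, 0 <= K & forall t, `|t| <= 1 -> `|flat P t| <= K * `|t|.
Proof.
pose n := size P; pose K := \sum_(i < n) `|P`_i|.
have K0 : 0 <= K by apply: sumr_ge0.
exists (K * (n.+1)`!%:R); first by rewrite mulr_ge0.
move=> t t1; rewrite /flat; case: ifPn => [t0|_]; last first.
  by rewrite normr0 !mulr_ge0.
have x0 : 0 < t^-1 by rewrite invr_gt0.
have x1 : 1 <= t^-1 by rewrite invf_ge1 // (le_trans (ler_norm _)).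
have hP : `|P.[t^-1]| <= K * t^-1 ^+ n.
  rewrite horner_coef mulr_suml; apply: le_trans (ler_norm_sum _ _ _) _.
  apply: ler_sum => i _; rewrite normrM ler_wpM2l // ger0_norm ?exprn_ge0
    ?(ltW x0) //.
  by apply: ler_weXn2l => //; rewrite ltnW.
have he : t^-1 ^+ n.+1 / (n.+1)`!%:R <= expR (t^-1).
  apply: le_trans (expR_ge1Dxn n (ltW x0)).
  by rewrite lerDr.
rewrite normrM (gtr0_norm (expR_gt0 _)) (gtr0_norm t0) expRN.
rewrite ler_pdivrMr ?expR_gt0 //; apply: le_trans hP _.
have f0 : 0 < (n.+1)`!%:R :> R by rewrite ltr0n fact_gt0.
have -> : K * t^-1 ^+ n = K * (n.+1)`!%:R * t * (t^-1 ^+ n.+1 / (n.+1)`!%:R).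
  by rewrite exprS; field; rewrite gt_eqF //= gt_eqF.
by rewrite ler_wpM2l // !mulr_ge0 // ltW.
Qed.

Lemma flat_cvg0 (P : {poly R}) : flat P t @[t --> (0 : R)] --> (0 : R).
Proof.
have [K K0 KP] := flat_bound P.
apply/cvgrPdist_le => e e0; near=> t.
have t1 : `|t| <= 1.
  by near: t; exact: (@nbhs0_le R R 1 ltr01).
rewrite sub0r normrN; apply: le_trans (KP t t1) _.
have te : `|t| <= e / (K + 1).
  by near: t; apply: (@nbhs0_le R R); rewrite divr_gt0 // ltr_wpDl.
apply: le_trans (ler_wpM2l K0 te) _.
rewrite mulrCA ler_piMr ?ltW // ltr_pdivrMr ?mul1r ?ltrDl //.
by rewrite ltr_wpDl.
Unshelve. all: by end_near. Qed.

(* For t > 0, P(1/t) e^(-1/t) has derivative Q(1/t) e^(-1/t) with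
   Q = X^2 (P - P'). *)
Definition flat_deriv (P : {poly R}) : {poly R} := 'X^2 * (P - P^`()).

Lemma is_derive_flat (P : {poly R}) (t : R) :
  is_derive t (1 : R) (flat P) (flat (flat_deriv P) t).
Proof.
have [t0|t0|->] := ltgtP t 0.
- have -> : flat (flat_deriv P) t = 0 by rewrite /flat ltNge (ltW t0).
  apply: (near_eq_is_derive _ (is_derive_cst (0 : R) t (1 : R))).
  near=> s; rewrite /flat ifF //; apply/negbTE; rewrite -leNgt ltW //.
  by near: s; exact: lt_nbhsl.
- pose f (s : R) := P.[s^-1] * expR (- s^-1).
  have ti : t != 0 by rewrite gt_eqF.
  have di : is_derive t (1 : R) (fun s : R => s^-1) (- t ^- 2).
    apply: is_derive_eq (@is_deriveV R id t 1 1 ti (is_derive_id _ _)) _.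
    by rewrite /GRing.scale /= mulr1.
  have dp : is_derive t (1 : R) (fun s : R => P.[s^-1])
    (- t ^- 2 * P^`().[t^-1]).
    rewrite [_ * P^`().[_]]mulrC.
    exact: (@is_derive1_comp R (horner P) (fun s => s^-1) _ _ _
      (is_derive_poly _ _) di).
  have de : is_derive t (1 : R) (fun s : R => expR (- s^-1))
    (t ^- 2 * expR (- t^-1)).
    have dn : is_derive t (1 : R) (fun s : R => - s^-1) (t ^- 2).
      by have := is_deriveN di; rewrite opprK.
    rewrite [_ * expR _]mulrC.
    exact: (@is_derive1_comp R expR (fun s => - s^-1) _ _ _ (is_derive_expR _)
      dn).
  have df : is_derive t (1 : R) f (flat (flat_deriv P) t).
    apply: is_derive_eq (is_deriveM dp de) _.
    rewrite /flat t0 /flat_deriv !hornerE /= /GRing.scale /= exprVn; ring.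
  apply: (near_eq_is_derive _ df).
  near=> s; rewrite /flat ifT //.
  by near: s; exact: lt_nbhsr.
(* At 0 the difference quotient of [flat P] is [flat ('X * P)], which tends to 0. *)
- have c : (fun h : R => h^-1 *: (flat P (h *: 1 + 0) - flat P 0)) h
      @[h --> (0 : R)^'] --> (0 : R).
    have C : flat ('X * P) h @[h --> (0 : R)^'] --> (0 : R).
      exact: cvg_trans (cvg_app _ (@nbhs_dnbhs R 0)) (@flat_cvg0 ('X * P)).
    apply: (cvg_near_eq _ C); near=> h.
    rewrite /GRing.scale /= mulr1 addr0 /flat ltxx subr0.
    by case: ifP => _; rewrite ?mulr0 // hornerM hornerX mulrA.
  have -> : flat (flat_deriv P) 0 = 0 by rewrite /flat ltxx.
  by apply: DeriveDef; [apply/cvg_ex; exists 0; exact: c|apply: cvg_lim].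
Unshelve. all: by end_near. Qed.

Variable p : nat.

Lemma is_derive_of_line (h : 'rV[R]_p -> R) (x v : 'rV[R]_p) (d : R) :
  is_derive (0 : R) (1 : R) (fun t : R => h (x + t *: v)) d -> is_derive x v h
    d.
Proof.
have e : (fun s : R => s^-1 *: (((fun t : R => h (x + t *: v)) \o shift 0)
  (s *: 1)
      - h (x + 0 *: v))) =
    (fun s : R => s^-1 *: ((h \o shift x) (s *: v) - h x)).
  apply/funext => s /=; rewrite scale0r !addr0.
  congr (_ *: (h _ - _)); rewrite addrC; congr (_ *: _ + _); exact: mulr1.
by move=> [hd <-]; apply: DeriveDef; rewrite /derivable /derive -e.
Qed.

(** The generators are the smooth functions and the composites of g with all [flat Q], since
    [flat_deriv] stays in this family. *)
Lemma smooth_on_flat (U : set 'rV[R]_p) (g : 'rV[R]_p -> R) (P : {poly R}) :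
  open U -> smooth_on U g -> smooth_on U (flat P \o g).
Proof.
move=> Uo gs; pose S := smooth_on U `|` range (fun P => flat P \o g).
have SP : gen_alg S (flat P \o g) by apply: gen_base; right; exists P.
apply: smooth_gen SP => // h [hs|[Q _ <-]];
  first by apply: smooth_stable hs => k; left.
have gd x i : U x -> is_derive x (delta_mx 0 i) (flat Q \o g)
    (flat (flat_deriv Q) (g x) * 'D_(delta_mx 0 i) g x).
  move=> Ux; apply: is_derive_of_line.
  have gd : derivable g (x + 0 *: delta_mx 0 i) (delta_mx 0 i).
    by rewrite scale0r addr0; have [_] := smooth_on_reg gs Ux; exact.
  have := @is_derive1_comp R (flat Q) (fun t : R => g (x + t *: delta_mx 0 i))
    0 _ _
    (is_derive_flat _ _) (is_derive_line gd).
  by rewrite scale0r addr0; exact.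
split.
  move=> x Ux; split; last by move=> i; case: (gd x i Ux).
  apply: (@continuous_comp _ _ _ g (flat Q) x);
    first by have [] := smooth_on_reg gs Ux.
  apply: differentiable_continuous; apply/derivable1_diffP.
  by case: (is_derive_flat Q (g x)).
move=> i; exists ((flat (flat_deriv Q) \o g) * 'D_(delta_mx 0 i) g).
  apply: gen_mul; apply: gen_base; last by left; exact: smooth_on_partial.
  by right; exists (flat_deriv Q).
by move=> x Ux; have [_ ->] := gd x i Ux.
Qed.

(** The bump is u/(u + w), where q is the squared distance to a, u > 0 exactly for q < 2d and w > 0
    exactly for q > d, so that the denominator never vanishes. The choice d = r^2/2 makes the bump
    vanish from distance r on. *)
Lemma bump_rV (a : 'rV[R]_p) (r : R) : 0 < r ->
  exists chi : 'rV[R]_p -> R, [/\ smooth_on setT chi,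
    \forall y \near a, chi y = 1 &
    forall y, chi y != 0 -> forall i, `|y 0 i - a 0 i| <= r].
Proof.
move=> r0; pose c (i : 'I_p) : 'rV[R]_p -> R := (fun y => y 0 i) - cst (a 0 i).
pose q : 'rV[R]_p -> R := \sum_i c i * c i.
pose d := r ^+ 2 / 2; have d0 : 0 < d by rewrite divr_gt0 ?exprn_gt0.
have qs : smooth_on setT q.
  apply: smooth_on_sum => [|i _]; first exact: openT.
  have cs : smooth_on setT (c i).
    by apply: (smooth_on_sub openT _ _);
      [exact: smooth_on_coord|exact: smooth_on_cst].
  exact: (smooth_onM openT cs cs).
have qE y : q y = \sum_i (y 0 i - a 0 i) ^+ 2.
  by rewrite /q fct_sumE; apply: eq_bigr => i _; rewrite expr2.
pose u : 'rV[R]_p -> R := flat 1 \o (cst (d + d) - q).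
pose w : 'rV[R]_p -> R := flat 1 \o (q - cst d).
have us : smooth_on setT u.
  apply: (smooth_on_flat _ openT).
  exact: (smooth_on_sub openT (@smooth_on_cst R p setT _) qs).
have ws : smooth_on setT w.
  apply: (smooth_on_flat _ openT).
  exact: (smooth_on_sub openT qs (@smooth_on_cst R p setT _)).
have f1 t : flat 1 t = if 0 < t then expR (- t^-1) else 0.
  by rewrite /flat hornerC mul1r.
have f_ge0 t : 0 <= flat 1 t by rewrite f1; case: ifP => // _; exact: expR_ge0.
have uw0 y : u y + w y != 0.
  rewrite gt_eqF //; have [qd|qd] := ltP (q y) (d + d).
    by rewrite ltr_pwDl // ?f_ge0 // /u /= f1 fctE /= subr_gt0 qd expR_gt0.
  rewrite ltr_wpDl // ?f_ge0 // /w /= f1 fctE /= subr_gt0 ifT ?expR_gt0 //.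
  by apply: lt_le_trans qd; rewrite ltrDl.
exists (u * (fun y => ((u + w) y)^-1)); split.
- apply: (smooth_onM openT us); apply: (smooth_onV openT) => [x _|].
    exact: uw0.
  exact: (smooth_onD openT us ws).
- have qa : q a = 0 by rewrite qE big1 // => i _; rewrite subrr expr0n.
  have qc : {for a, continuous q} by have [] := smooth_on_reg qs (I : setT a).
  have FF : Filter (nbhs a) by exact: nbhs_filter.
  have : \forall y \near a, q y < d.
    have := @cvgr_lt _ _ _ FF _ _ qc d; rewrite qa; exact.
  apply: filterS => y qd.
  have w0 : w y = 0 by rewrite /w /= f1 fctE /= subr_gt0 ltNge ltW.
  have := uw0 y; rewrite !fctE /= w0 addr0 => u0; exact: divff.
- move=> y chi0 i; have u0 : u y != 0.
    by apply: contraNneq chi0 => u0; rewrite fctE /= u0 mul0r.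
  have qd : q y < d + d.
    rewrite ltNge; apply: contra u0 => qd.
    by rewrite /u /= f1 fctE /= subr_gt0 ltNge qd.
  suff : `|y 0 i - a 0 i| ^+ 2 <= r ^+ 2 by rewrite ler_pXn2r // nnegrE ltW.
  rewrite real_normK ?num_real //.
  have -> : r ^+ 2 = d + d by rewrite /d; field.
  apply: le_trans (ltW qd); rewrite qE (bigD1 i) //= lerDl.
  by apply: sumr_ge0 => j _; exact: sqr_ge0.
Qed.

End Bump.

(** * Smooth functions on manifolds *)

Section ManifoldSmooth.
Variables (R : realType) (n : nat) (M : manifold R n).
Implicit Types (U V : set M) (f g : M -> R) (c : chart R M n) (m : M).

Definition smooth_in U f : Prop := smooth_fun (@matlas R n M) U f.

Lemma smooth_in_subset U V f : V `<=` U -> smooth_in U f -> smooth_in V f.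
Proof.
move=> VU fs c ac; apply: smooth_on_subset (fs c ac).
by move=> _ [m [Vm cm] <-]; exists m => //; split => //; exact: VU.
Qed.

Lemma smooth_in_local U f : (forall m, U m -> exists2 V, V m & smooth_in V f)
  -> smooth_in U f.
Proof.
move=> sec_coord c ac; apply: smooth_on_local => _ [m [Um cm] <-].
have [V Vm fs] := sec_coord m Um; exists (cmap c @` (V `&` cdom c));
  last exact: fs.
by exists m.
Qed.

Lemma cmapK c m : matlas c -> cdom c m -> cinv c (cmap c m) = m.
Proof. by move=> ac cm; rewrite (matlas_inv ac) ?inE. Qed.

Lemma smooth_in_ext U f g : open U -> (forall m, U m -> f m = g m) -> smooth_in
  U f -> smooth_in U g.
Proof.
move=> Uo fg fs c ac; apply: smooth_on_ext (fs c ac); first exact: open_cmap.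
by move=> _ [m [Um cm] <-] /=; rewrite cmapK // fg.
Qed.

Lemma smooth_in_cst U (a : R) : smooth_in U (cst a).
Proof. by move=> c ac; exact: smooth_on_cst. Qed.

Lemma smooth_inD U f g : open U -> smooth_in U f -> smooth_in U g -> smooth_in
  U (f + g).
Proof.
move=> Uo fs gs c ac; apply: (smooth_onD (open_cmap ac Uo) (fs c ac) (gs c ac)).
Qed.

Lemma smooth_inB U f g : open U -> smooth_in U f -> smooth_in U g -> smooth_in
  U (f - g).
Proof.
move=> Uo fs gs c ac; apply: (smooth_on_sub (open_cmap ac Uo) (fs c ac)
  (gs c ac)).
Qed.

Lemma smooth_inM U f g : open U -> smooth_in U f -> smooth_in U g -> smooth_in
  U (f * g).
Proof.
move=> Uo fs gs c ac; apply: (smooth_onM (open_cmap ac Uo) (fs c ac) (gs c ac)).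
Qed.

Lemma smooth_in_sum U (I : Type) (r : seq I) (P : pred I) (F : I -> M -> R) :
  open U -> (forall i, P i -> smooth_in U (F i)) -> smooth_in U
    (\sum_(i <- r | P i) F i).
Proof.
move=> Uo Fs; apply: (big_ind (smooth_in U));
  [exact: smooth_in_cst| |exact: Fs].
by move=> f g fs gs; exact: (smooth_inD Uo fs gs).
Qed.

Lemma smooth_in_prod U (I : Type) (r : seq I) (P : pred I) (F : I -> M -> R) :
  open U -> (forall i, P i -> smooth_in U (F i)) -> smooth_in U
    (\prod_(i <- r | P i) F i).
Proof.
move=> Uo Fs; apply: (big_ind (smooth_in U));
  [exact: smooth_in_cst| |exact: Fs].
by move=> f g fs gs; exact: (smooth_inM Uo fs gs).
Qed.

Lemma smooth_in_coord c i : matlas c -> smooth_in (cdom c)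
  (fun m => cmap c m 0 i).
Proof. by move=> ac; exact: matlas_compat. Qed.

Lemma smooth_in_cmap c V (g : 'rV[R]_n -> R) : matlas c -> open V ->
  smooth_on (cmap c @` (V `&` cdom c)) g -> smooth_in (V `&` cdom c)
    (g \o cmap c).
Proof.
move=> ac Vo gs c' ac'.
have VcO : open (V `&` cdom c) by apply: openI => //; exact: matlas_dom.
apply: (smooth_on_comp (open_cmap ac Vo) (open_cmap ac' VcO)
  (phi := cmap c \o cinv c') _ gs).
  by move=> _ [m [[Vm cm] c'm] <-] /=; rewrite cmapK //; exists m.
move=> i; apply: smooth_in_subset (smooth_in_coord i ac) _ ac'.
by move=> m [].
Qed.

Lemma smooth_in_of_chart c V f : matlas c -> open V ->
  smooth_on (cmap c @` (V `&` cdom c)) (f \o cinv c) -> smooth_in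
    (V `&` cdom c) f.
Proof.
move=> ac Vo fs; apply: smooth_in_ext (smooth_in_cmap ac Vo fs).
  by apply: openI => //; exact: matlas_dom.
by move=> m [_ cm] /=; rewrite cmapK.
Qed.

Lemma nbhs_cmap c V m : matlas c -> open V -> V m -> cdom c m ->
  nbhs (cmap c m) (cmap c @` (V `&` cdom c)).
Proof.
move=> ac Vo Vm cm; apply: open_nbhs_nbhs; split; first exact: open_cmap.
by exists m.
Qed.

Lemma partial_ext c V f g i m : matlas c -> open V -> V m -> cdom c m ->
  (forall m', V m' -> f m' = g m') -> partial c i f m = partial c i g m.
Proof.
move=> ac Vo Vm cm fg; apply: near_eq_derive.
apply: filterS (nbhs_cmap ac Vo Vm cm) => _ [m' [Vm' cm'] <-] /=.
by rewrite cmapK // fg.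
Qed.

Lemma derivable_chart c V f i m : matlas c -> V m -> cdom c m -> smooth_in V f
  ->
  derivable (f \o cinv c) (cmap c m) (delta_mx 0 i).
Proof.
move=> ac Vm cm fs; have [|_] := smooth_on_reg (fs c ac) (x := cmap c m);
  last exact.
by exists m.
Qed.

Lemma smooth_in_partial c V f i : matlas c -> open V -> smooth_in V f ->
  smooth_in (V `&` cdom c) (partial c i f).
Proof.
move=> ac Vo fs; apply: smooth_in_of_chart => //.
apply: smooth_on_ext (smooth_on_partial i (fs c ac)); first exact: open_cmap.
by move=> _ [m [Vm cm] <-] /=; rewrite /partial cmapK.
Qed.

Lemma partialD c V f g i m : matlas c -> V m -> cdom c m -> smooth_in V f ->
  smooth_in V g ->
  partial c i (f + g) m = partial c i f m + partial c i g m.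
Proof.
move=> ac Vm cm fs gs.
rewrite /partial.
exact: (deriveD (derivable_chart ac Vm cm fs) (derivable_chart ac Vm cm gs)).
Qed.

Lemma partialB c V f g i m : matlas c -> V m -> cdom c m -> smooth_in V f ->
  smooth_in V g ->
  partial c i (f - g) m = partial c i f m - partial c i g m.
Proof.
move=> ac Vm cm fs gs.
rewrite /partial.
exact: (deriveB (derivable_chart ac Vm cm fs) (derivable_chart ac Vm cm gs)).
Qed.

Lemma partial_cst c (a : R) i m : partial c i (cst a) m = 0.
Proof. exact: derive_cst. Qed.

Lemma partial_chain c c' V f i m : matlas c -> matlas c' -> open V -> V m ->
  cdom c m -> cdom c' m -> smooth_in V f ->
  partial c i f m =
  \sum_j partial c i (fun m' => cmap c' m' 0 j) m * partial c' j f m.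
Proof.
move=> ac ac' Vo Vm cm c'm fs.
have VcO : open (V `&` cdom c') by apply: openI => //; exact: matlas_dom.
have mE : (cmap c' \o cinv c) (cmap c m) = cmap c' m by rewrite /= cmapK.
have [||_ e] := @smooth_on_derive_comp R n n _ (f \o cinv c')
  (cmap c' \o cinv c)
   (cmap c m) (delta_mx 0 i) (open_cmap ac' Vo) (fs c' ac').
- by rewrite mE; exists m.
- by move=> j; exact: (derivable_chart ac c'm cm (smooth_in_coord j ac')).
rewrite mE in e; rewrite /partial -[RHS]e; apply: near_eq_derive.
apply: filterS (nbhs_cmap ac VcO (conj Vm c'm) cm) => _
  [m' [[Vm' c'm'] cm'] <-] /=.
by rewrite !cmapK.
Qed.

(** The open sets [U] intersected with [V], and the complement of [K], cover [U]; on the second one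
    the product is 0 whatever f is. *)
Lemma smooth_in_extend U V K (chi f : M -> R) : open U -> open V -> closed K ->
  K `<=` V -> (forall m, ~ K m -> chi m = 0) -> smooth_in U chi -> smooth_in
    (U `&` V) f ->
  smooth_in U (chi * f).
Proof.
move=> Uo Vo Kc KV chi0 chis fs; apply: smooth_in_local => m Um.
have [Km|nKm] := pselect (K m).
  exists (U `&` V); first by split => //; exact: KV.
  apply: (smooth_inM (openI Uo Vo) _ fs).
  by apply: smooth_in_subset chis => ? [].
exists (~` K) => //; apply: (@smooth_in_ext _ (cst 0));
  last exact: smooth_in_cst.
  exact: closed_openC.
by move=> m' nK; rewrite -[RHS]/(chi m' * f m') chi0 // mul0r.
Qed.

(** Extension by zero out of a chart requires the support to be closed in M, not only in the chart.
    It lies in the image of a compact box, which is closed because M is Hausdorff. *)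
Lemma bump_exists V (m0 : M) : open V -> V m0 ->
  exists chi U K, [/\ smooth_in setT chi, open U, U m0, closed K &
    [/\ K `<=` V, forall m, U m -> chi m = 1 & forall m, ~ K m -> chi m = 0]].
Proof.
move=> Vo Vm0; have [c ac cm0] := matlas_cover m0.
have [r r0 rV] := nbhs_rV (nbhs_cmap ac Vo Vm0 cm0).
have r20 : 0 < r / 2 by rewrite divr_gt0.
have [h [hs h1 h0]] := bump_rV (cmap c m0) r20.
pose B := [set y : 'rV[R]_n | forall i, `[cmap c m0 0 i - r / 2, cmap c m0 0 i
  + r / 2]%classic (y 0 i)].
have BE y : B y <-> forall i, `|y 0 i - cmap c m0 0 i| <= r / 2.
  by split => By i; have := By i; rewrite /= in_itv /= ler_distl.
have Bc : compact B.
  by apply: (@rV_compact R n (fun i => `[cmap c m0 0 i - r / 2, cmap c m0 0 i +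
    r / 2]%classic)) => i; exact: segment_compact.
have BV : B `<=` cmap c @` (V `&` cdom c).
  move=> y /BE By; apply: rV => i; apply: le_lt_trans (By i) _.
  by rewrite ltr_pdivrMr // ltr_pMr // ltr1n.
have BD : B `<=` cmap c @` cdom c.
  by move=> y /BV [m [_ cm] <-]; exists m.
pose K := cinv c @` B.
have Kc : closed K.
  apply: compact_closed; first exact: manifold_hausdorff.
  apply: continuous_compact Bc.
  exact: continuous_subspaceW BD (matlas_invcont ac).
have KV : K `<=` V `&` cdom c.
  by move=> _ [y /BV [m [Vm cm] <-] <-]; rewrite cmapK.
have hB y : ~ B y -> h y = 0.
  by move=> nB; apply/eqP; apply: contra_notT nB => /h0 /BE.
pose chi m := if m \in cdom c then h (cmap c m) else 0.
have chiE m : cdom c m -> chi m = h (cmap c m) by move=> cm;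
  rewrite /chi mem_set.
have chi0 m : ~ K m -> chi m = 0.
  move=> nK; rewrite /chi; case: ifPn => // /set_mem cm; apply: hB => Bm.
  by apply: nK; exists (cmap c m) => //; rewrite cmapK.
have cO : open (cdom c) by exact: matlas_dom.
have chis : smooth_in (cdom c) chi.
  apply: (@smooth_in_ext _ (h \o cmap c)) => //; first by move=> m /chiE ->.
  rewrite -[cdom c]setTI; apply: smooth_in_cmap => //; first exact: openT.
  exact: smooth_on_subset hs.
have [U [Uo Um0] U1] : exists2 U, open_nbhs m0 U & forall m, U m -> chi m = 1.
  pose W := interior [set y | h y = 1].
  have Wo : open W by exact: open_interior.
  have Wm0 : W (cmap c m0) by exact: h1.
  have W1 y : W y -> h y = 1 by exact: interior_subset.
  exists (cdom c `&` cmap c @^-1` W).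
    split; last by split.
    have := matlas_cont ac; rewrite continuous_open_subspace // => cc.
    rewrite openE => m [cm Wm]; apply: filterI; first exact: open_nbhs_nbhs.
    by apply: (cc m); [rewrite inE|exact: open_nbhs_nbhs].
  by move=> m [cm Wm]; rewrite chiE // W1.
exists chi, U, K; split => //; last by split => // m /KV[].
apply: smooth_in_local => m _; have [Km|nKm] := pselect (K m).
  by exists (cdom c) => //; have [] := KV m Km.
exists (~` K) => //; apply: (@smooth_in_ext _ (cst 0));
  last exact: smooth_in_cst.
  exact: closed_openC.
by move=> m' nK; rewrite chi0.
Qed.

End ManifoldSmooth.

(** * Global sections *)

Lemma second_countable_cover (T : topologicalType) (A : Type) (P : A -> Prop)
    (U : A -> set T) (a0 : A) : @second_countable T -> P a0 ->
  (forall a, P a -> open (U a)) -> (forall x, exists2 a, P a & U a x) ->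
  exists2 s : nat -> A, forall k, P (s k) & forall x, exists k, U (s k) x.
Proof.
move=> [B /countable_injP[f fI] [_ Bb]] P0 Uo cov.
(* k is read as the code of a basis set b: when some admissible [U a] contains b one such a is
   chosen, and otherwise the default [a0]. *)
have step k : exists a, P a /\
    ((exists2 b, B b /\ f b = k & exists2 a', P a' & b `<=` U a') ->
     exists2 b, B b /\ f b = k & b `<=` U a).
  have [[b bk [a Pa ba]]|no] := pselect (exists2 b, B b /\ f b = k &
      exists2 a', P a' & b `<=` U a').
    by exists a; split => // _; exists b.
  by exists a0; split => // /no.
exists (fun k => sval (cid (step k))).
  by move=> k; case: (cid (step k)) => a [].
move=> x; have [a Pa Uax] := cov x.
have [b [Bb' bx] bU] : filter_from [set b | B b /\ b x] id (U a).
  by apply: Bb; apply: open_nbhs_nbhs; split => //; exact: Uo.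
exists (f b); case: (cid (step (f b))) => a' [_ /=].
case; first by exists b => //; exists a.
move=> b' [Bb'' e]; rewrite (fI b' b) ?inE //; exact.
Qed.

Section Sections.
Variables (R : realType) (n : nat) (M : manifold R n) (Z : AVbundle M).
Implicit Types (z : Z) (m : M) (t : R).

Lemma subzz z : sub z z = 0.
Proof. by apply: sub_unique; rewrite act0. Qed.

Lemma sub_actl z z' t : zeta z = zeta z' -> sub (act z t) z' = sub z z' + t.
Proof. by move=> e; apply: sub_unique; rewrite actD sub_act. Qed.

Lemma sub_trans z z' z'' : zeta z = zeta z' -> zeta z' = zeta z'' ->
  sub z z'' = sub z z' + sub z' z''.
Proof. by move=> e e'; apply: sub_unique; rewrite addrC actD !sub_act. Qed.

Lemma zeta_surj m : exists z : Z, zeta z = m.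
Proof.
have [l al lm] := @avatlas_cover R n M Z m.
by exists (l.2 m); exact: avatlas_sec.
Qed.

(** Bump, local section and open set form one tuple so that second countability selects all three
    along a single sequence. *)
Definition is_local_bump (a : (M -> R) * (set M * (M -> Z)) * set M) : Prop :=
  [/\ smooth_in setT a.1.1, @avatlas R n M Z a.1.2, open a.2 &
    exists2 K, closed K /\ K `<=` a.1.2.1 &
      (forall m, a.2 m -> a.1.1 m = 1) /\ forall m, ~ K m -> a.1.1 m = 0].

Lemma local_bump m : exists2 a, is_local_bump a & a.2 m.
Proof.
have [l al lm] := @avatlas_cover R n M Z m.
have [chi [U [K [cs Uo Um Kc [KV U1 K0]]]]] := bump_exists (avatlas_open al) lm.
by exists ((chi, l), U) => //; split => //; exists K.
Qed.

Lemma avatlas_sub l l' : @avatlas R n M Z l -> @avatlas R n M Z l' ->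
  smooth_in (l.1 `&` l'.1) (fun m => sub (l'.2 m) (l.2 m)).
Proof.
move=> al al'; have [g gs ge] := avatlas_compat al al'.
apply: smooth_in_ext gs; first by apply: openI; exact: avatlas_open.
by move=> m [lm l'm]; rewrite (sub_unique (esym (ge m lm l'm))).
Qed.

(* For bump functions chi_k equal to 1 on sets U_k covering M, the functions
   chi_k prod_(j < k) (1 - chi_j) form a partition of unity, locally finite
   because all those of index > k vanish on U_k. *)
Lemma section_exists : inhabited (sec Z).
Proof.
(* Over an empty base every condition is vacuous; otherwise a point supplies the default bump
   [a0]. *)
have [[m0 _]|noM] := pselect (exists m : M, True); last first.
  have f (m : M) : Z by case: noM; exists m.
  constructor; exists f; split; first by move=> m; case: noM; exists m.
  by move=> l _ c _ l' y [m]; case: noM; exists m.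
have [a0 P0 _] := local_bump m0.
have [s sP scov] := second_countable_cover (@manifold_countable R n M) P0
  (fun a Pa => let: And4 _ _ o _ := Pa in o) local_bump.
pose chi k := (s k).1.1; pose l k := (s k).1.2; pose U k := (s k).2.
have chis k : smooth_in setT (chi k) by have [] := sP k.
have al k : @avatlas R n M Z (l k) by have [] := sP k.
have Uo k : open (U k) by have [] := sP k.
have chi1 k m : U k m -> chi k m = 1 by have [_ _ _ [K _ [+ _]]] := sP k; exact.
pose P k : M -> R := \prod_(0 <= j < k) (cst 1 - chi j).
pose rho k : M -> R := chi k * P k.
have P0' k j m : (k < j)%N -> U k m -> P j m = 0.
  move=> kj Um; rewrite /P fct_prodE (big_cat_nat (n := k.+1)) //= big_nat_recr
    //=.
  by rewrite !fctE /= (chi1 _ _ Um) subrr mulr0 mul0r.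
have rho0 k j m : (k < j)%N -> U k m -> rho j m = 0.
  by move=> kj Um; rewrite /rho fctE (P0' k) // mulr0.
(* The weights telescope: their sum up to k is 1 - P (k+1), and the factor 1 - chi_k of P (k+1)
   vanishes on U_k. *)
have rhoE k m : rho k m = P k m - P k.+1 m.
  by rewrite /rho /P big_nat_recr //= !fctE /=; ring.
have rho1 k m : U k m -> \sum_(0 <= j < k.+1) rho j m = 1.
  move=> Um; under eq_bigr do rewrite rhoE.
  have -> : \sum_(0 <= j < k.+1) (P j m - P j.+1 m) = - (P k.+1 m - P 0 m).
    by rewrite -(telescope_sumr (fun j => P j m)) // -sumrN;
       apply: eq_bigr => j _; rewrite opprB.
  by rewrite (P0' k) // /P big_nil sub0r opprK.
have widen k j (w : nat -> R) m : (k <= j)%N -> U k m ->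
    \sum_(0 <= i < j.+1) rho i m * w i = \sum_(0 <= i < k.+1) rho i m * w i.
  move=> kj Um; rewrite (big_cat_nat (n := k.+1)) //= [X in _ + X]big_nat_cond.
  rewrite [X in _ + X]big1 ?addr0 // => i; rewrite andbT => /andP[ki _].
  by rewrite (rho0 k) // mul0r.
(* [ref] and [N] are arbitrary choices without regularity. Weights of sum 1 make the average
   independent of [ref], and [widen] makes it independent of [N]. *)
pose ref m := sval (cid (zeta_surj m)).
have refE m : zeta (ref m) = m by exact: svalP (cid (zeta_surj m)).
pose N m := sval (cid (scov m)).
have NE m : U (N m) m by exact: svalP (cid (scov m)).
pose w k m := sub ((l k).2 m) (ref m).
pose sigma m := act (ref m) (\sum_(0 <= k < (N m).+1) rho k m * w k m).
have sigmaE m k : U k m -> sigma m =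
    act (ref m) (\sum_(0 <= i < k.+1) rho i m * w i m).
  move=> Um; congr act.
  by have [kN|/ltnW Nk] := leqP k (N m); [|symmetry]; exact: widen.
have lz k m : (l k).1 m -> zeta ((l k).2 m) = m by exact: avatlas_sec.
(* Outside its domain [(l k).2] may take any value, but there its weight is 0. *)
have rhoK k m : rho k m = 0 \/ (l k).1 m.
  have [_ _ _ [K [_ KV] [_ K0]]] := sP k.
  have [Km|nK] := pselect (K m); first by right; exact: KV.
  by left; rewrite -[LHS]/((s k).1.1 m * P k m) (K0 m nK) mul0r.
constructor; exists sigma; split; first by move=> m; rewrite zeta_act.
move=> l' al'; apply: smooth_in_local => m l'm.
have UlO : open (U (N m) `&` l'.1) by apply: openI => //; exact: avatlas_open.
exists (U (N m) `&` l'.1) => //.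
apply: (@smooth_in_ext _ _ _ _ (\sum_(0 <= k < (N m).+1)
    rho k * (fun m' => sub ((l k).2 m') (l'.2 m')))) => //.
  move=> m' [Um' l'm']; rewrite (sigmaE _ _ Um').
  have zl' : zeta (l'.2 m') = m' by exact: avatlas_sec.
  rewrite sub_actl ?refE ?zl' // fct_sumE -[sub _ _ in RHS]mul1r
    -(rho1 _ _ Um').
  rewrite mulr_suml -big_split /=; apply: eq_bigr => k _; rewrite fctE.
  have [->|lk] := rhoK k m'; first by rewrite !mul0r addr0.
  by rewrite -mulrDr addrC /w -sub_trans // ?refE ?zl' ?lz.
apply: smooth_in_sum => // k _; have [_ _ _ [K [Kc KV] [_ K0]]] := sP k.
have Ps : smooth_in setT (P k).
  apply: smooth_in_prod => [|j _]; first exact: openT.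
  by apply: (smooth_inB openT (@smooth_in_cst R n M setT 1)).
(* The bump is grouped with the transition function, defined only on the domain of [l k], so that
   their product extends by zero before the factor [P k] is applied. *)
rewrite /rho mulrAC; apply: smooth_inM => //; last exact: smooth_in_subset Ps.
apply: (smooth_in_extend UlO (avatlas_open (al k)) Kc KV K0).
  exact: smooth_in_subset (chis k).
apply: smooth_in_subset (avatlas_sub al' (al k)).
by move=> x [[_ ?] ?].
Qed.

End Sections.

(** * The total space *)

Lemma derive_coord (R : realType) p (i j : 'I_p) (x : 'rV[R]_p) :
  is_derive x (delta_mx 0 i : 'rV[R]_p) (fun y : 'rV[R]_p => y 0 j) (j == i)%:R.
Proof.
apply: is_derive_of_line.
have -> : (fun t : R => (x + t *: (delta_mx 0 i : 'rV[R]_p)) 0 j) =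
    cst (x 0 j) + (j == i)%:R *: id.
  apply/funext => t; rewrite !mxE eqxx /= -[RHS]/(_ + _ * t).
  by rewrite [in RHS]mulrC.
apply: is_derive_eq (is_deriveD (is_derive_cst _ _ _)
  (is_deriveZ _ (is_derive_id _ _))) _.
by rewrite add0r /GRing.scale /= mulr1.
Qed.

Lemma partial_coord (R : realType) n (M : manifold R n) (c : chart R M n)
    (i j : 'I_n) m : matlas c -> cdom c m ->
  partial c i (fun m' => cmap c m' 0 j) m = (j == i)%:R.
Proof.
move=> ac cm; have [_ <-] := derive_coord i j (cmap c m).
apply: near_eq_derive.
apply: filterS (nbhs_cmap ac openT I cm) => _ [m' [_ cm'] <-] /=.
by rewrite cmapK.
Qed.

Section TotalSpace.
Variables (R : realType) (n : nat) (M : manifold R n) (Z : AVbundle M).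
Implicit Types (z : Z) (m : M) (t : R) (f g : Cinf Z) (s : sec Z)
  (c : chart R M n) (l : set M * (M -> Z)).

Definition sec_coord l (s : M -> Z) : M -> R := fun m => sub (s m) (l.2 m).

Lemma zeta_sec s m : zeta (s m) = m.
Proof. exact: (proj1 (svalP s)). Qed.

Lemma smooth_sec_coord s l : @avatlas R n M Z l -> smooth_in l.1
  (sec_coord l s).
Proof. exact: (proj2 (svalP s)). Qed.

Lemma sub_sec_smooth s s' : smooth_in setT (fun m => sub (s m) (s' m)).
Proof.
apply: smooth_in_local => m _; have [l al lm] := @avatlas_cover R n M Z m.
exists l.1 => //; have lo := avatlas_open al.
apply: (smooth_in_ext lo _ (smooth_inB lo (smooth_sec_coord s al)
  (smooth_sec_coord s' al))) => m' lm'.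
have zl : zeta (l.2 m') = m' by exact: avatlas_sec.
rewrite -[LHS]/(sec_coord l s m' - sec_coord l s' m') /sec_coord.
by rewrite (@sub_trans _ _ _ _ _ (s' m')) ?zeta_sec ?zl // addrK.
Qed.

Lemma is_section_shift s (u : M -> R) : smooth_in setT u ->
  is_section (fun m => act (s m) (u m)).
Proof.
move=> us; split; first by move=> m; rewrite zeta_act zeta_sec.
move=> l al; have lo := avatlas_open al.
have us' : smooth_in l.1 u by exact: smooth_in_subset us.
apply: (smooth_in_ext lo _ (smooth_inD lo (smooth_sec_coord s al) us')) => m lm.
by rewrite sub_actl // zeta_sec avatlas_sec.
Qed.

Definition shift_sec s (u : M -> R) (us : smooth_in setT u) : sec Z :=
  exist _ _ (is_section_shift s us).

Lemma Cinf_ext f g : (forall z, f z = g z) -> f = g.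
Proof.
case: f g => [f fs] [g gs] /= /funext e; rewrite e in fs *.
by congr exist; exact: Prop_irrelevance.
Qed.

Definition avimg c l := cmap (avchart c l) @` (setT `&` cdom (avchart c l)).

Definition smooth_chart c l (f : Z -> R) := smooth_on (avimg c l)
  (f \o cinv (avchart c l)).

Section Chart.
Variables (c : chart R M n) (l : set M * (M -> Z)).
Hypotheses (ac : matlas c) (al : @avatlas R n M Z l).
Let k := avchart c l.
Let e : 'I_(n + 1) := rshift n ord0.

Lemma avcinvK z : cdom k z -> cinv k (cmap k z) = z.
Proof.
move=> [/= lz cz]; rewrite row_mxKl row_mxKr mxE eqxx mulr1n cmapK //.
by rewrite sub_act // avatlas_sec.
Qed.

Lemma avimg_cmap z : cdom k z -> avimg c l (cmap k z).
Proof. by move=> kz; exists z. Qed.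

Lemma open_avimg : open (avimg c l).
Proof. exact: open_avchart_img. Qed.

Lemma smooth_chart_ext (f g : Z -> R) : (forall z, cdom k z -> f z = g z) ->
  smooth_chart c l f -> smooth_chart c l g.
Proof.
move=> fg; apply: smooth_on_ext; first exact: open_avimg.
by move=> _ [z [_ kz] <-]; rewrite /comp (avcinvK kz) fg.
Qed.

Lemma smooth_chartD (f g : Z -> R) : smooth_chart c l f -> smooth_chart c l g
  -> smooth_chart c l (f + g).
Proof. exact: (smooth_onD open_avimg). Qed.

Lemma smooth_chartM (f g : Z -> R) : smooth_chart c l f -> smooth_chart c l g
  -> smooth_chart c l (f * g).
Proof. exact: (smooth_onM open_avimg). Qed.

Lemma smooth_chart_cst (a : R) : smooth_chart c l (cst a).
Proof. exact: smooth_on_cst. Qed.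

Lemma smooth_chart_sum (I : Type) (r : seq I) (P : pred I) (F : I -> Z -> R) :
  (forall i, P i -> smooth_chart c l (F i)) -> smooth_chart c l
    (\sum_(i <- r | P i) F i).
Proof.
move=> Fs; apply: (big_ind (smooth_chart c l));
  [exact: smooth_chart_cst| |exact: Fs].
by move=> f g fs gs; exact: smooth_chartD fs gs.
Qed.

Lemma smooth_chart_Cinf f : smooth_chart c l f.
Proof. by case: f => f fs; apply: fs; exists c, l. Qed.

Lemma smooth_chart_pull (u : M -> R) : smooth_in (l.1 `&` cdom c) u ->
  smooth_chart c l (u \o @zeta R n M Z).
Proof.
move=> us; have := us c ac; rewrite -setIA setIid => h.
have := smooth_on_lsubmx (q := 1) h; rewrite /smooth_chart /avimg
  (avchart_img ac al).
apply: smooth_on_ext.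
  by rewrite -(avchart_img ac al); exact: open_avimg.
move=> y [m [lm cm] my] /=; rewrite zeta_act avatlas_sec //.
by rewrite -my cmapK.
Qed.

Lemma smooth_chart_partial i f : smooth_chart c l (partial k i f).
Proof.
apply: smooth_on_ext (smooth_on_partial i (smooth_chart_Cinf f));
  first exact: open_avimg.
by move=> _ [z [_ kz] <-]; exact: (congr1 (partial k i f) (esym (avcinvK kz))).
Qed.

Lemma cdom_act z t : cdom k (act z t) = cdom k z.
Proof. by rewrite /= zeta_act. Qed.

Lemma cmap_act z t : cdom k z ->
  cmap k (act z t) = cmap k z + t *: delta_mx 0 e.
Proof.
move=> [lz cz]; apply/rowP => j; rewrite /= zeta_act mxE [in RHS]mxE.
have [i ->|i ->] := fintype.split_ordP j.
  by rewrite !row_mxEl !mxE eqxx eq_lrshift mulr0 addr0.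
rewrite !row_mxEr !mxE !ord1 !eqxx !mulr1n mulr1.
by rewrite sub_actl // avatlas_sec.
Qed.

Lemma is_derive_chart_fib (h : 'rV[R]_(n + 1) -> R) z t : cdom k z ->
  smooth_on (avimg c l) h ->
  is_derive (t : R) (1 : R) (fun t => h (cmap k (act z t)))
    ('D_(delta_mx 0 e) h (cmap k (act z t))).
Proof.
move=> kz hs.
have -> : (fun t => h (cmap k (act z t))) =
  (fun t => h (cmap k z + t *: delta_mx 0 e)).
  by apply/funext => u; rewrite cmap_act.
rewrite cmap_act //; apply: is_derive_line; rewrite -cmap_act //.
have kzt : cdom k (act z t) by rewrite cdom_act.
by have [_] := smooth_on_reg hs (avimg_cmap kzt); exact.
Qed.

Lemma is_derive_fib_chart f z t : cdom k z ->
  is_derive (t : R) (1 : R) (fun t => f (act z t)) (partial k e f (act z t)).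
Proof.
move=> kz; have := is_derive_chart_fib t kz (smooth_chart_Cinf f).
congr is_derive; apply/funext => u.
by rewrite -[LHS]/(f (cinv k (cmap k (act z u)))) avcinvK // cdom_act.
Qed.

Lemma XZ_of_derive (h : Z -> R) z d :
  is_derive (0 : R) (1 : R) (fun t => h (act z t)) d -> XZ_fun h z = - d.
Proof.
move=> hd; rewrite /XZ_fun derive1E.
have N : is_derive (0 : R) (1 : R) (-%R : R -> R) (-1) by exact: is_deriveNid.
rewrite -[in X in is_derive X](oppr0 R) in hd.
have [_ ->] := is_derive1_comp hd N.
by rewrite mulrN1.
Qed.

Lemma XZ_partial f z : cdom k z -> XZ f z = - partial k e f z.
Proof.
move=> kz; rewrite -[in RHS](act0 z).
exact: XZ_of_derive (is_derive_fib_chart f 0 kz).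
Qed.

(** Coordinate derivatives commute with X_Z by symmetry of second derivatives; the sign is that of
    X_Z, which moves z to z - t. *)
Lemma is_derive_partial_fib i f z : cdom k z ->
  is_derive (0 : R) (1 : R) (fun t => partial k i f (act z t))
    (- partial k i (XZ f) z).
Proof.
move=> kz; have fs := smooth_chart_Cinf f.
have := is_derive_chart_fib 0 kz (smooth_on_partial i fs).
rewrite act0 -(schwarz i e open_avimg fs (avimg_cmap kz)).
congr is_derive.
have [_ d] := smooth_on_reg (smooth_on_partial e fs) (avimg_cmap kz).
apply: (canRL (@opprK _)); apply: (etrans (esym (deriveN (d i)))).
apply: near_eq_derive.
apply: filterS (open_nbhs_nbhs (conj open_avimg (avimg_cmap kz))).
move=> _ [z' [_ kz'] <-].
rewrite -[RHS]/(XZ f (cinv k (cmap k z'))) avcinvK // XZ_partial //.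
Qed.

Lemma smooth_chart_sec s :
  forall i, smooth_on (cmap c @` (l.1 `&` cdom c))
    (fun y => cmap k (s (cinv c y)) 0 i).
Proof.
move=> j; have lo := avatlas_open al.
have Wo : open (cmap c @` (l.1 `&` cdom c)) by exact: open_cmap.
have [i ->|i ->] := fintype.split_ordP j.
  apply: (smooth_on_ext Wo _ (@smooth_on_coord _ _ _ i)).
  by move=> _ [m [lm cm] <-] /=; rewrite row_mxEl cmapK // zeta_sec.
apply: (smooth_on_ext Wo _ (smooth_sec_coord s al ac)).
move=> _ [m [lm cm] <-] /=; rewrite row_mxEr cmapK // zeta_sec.
by rewrite ord1 mxE eqxx mulr1n.
Qed.

Lemma cdom_sec s m : l.1 m -> cdom c m -> cdom k (s m).
Proof. by move=> lm cm; rewrite /= zeta_sec. Qed.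

Lemma comp_sec_smooth f s : smooth_on (cmap c @` (l.1 `&` cdom c))
  (f \o s \o cinv c).
Proof.
have lo := avatlas_open al.
have Wo : open (cmap c @` (l.1 `&` cdom c)) by exact: open_cmap.
have := smooth_on_comp open_avimg Wo (phi := fun y => cmap k (s (cinv c y))) _
  (smooth_chart_Cinf f) (smooth_chart_sec s).
move=> /(_ _) H; apply: (smooth_on_ext Wo _ (H _)).
  move=> _ [m [lm cm] <-].
  rewrite -[LHS]/(f (cinv k (cmap k (s (cinv c (cmap c m)))))) cmapK //.
  by rewrite avcinvK //= ?cmapK //; exact: cdom_sec.
by move=> _ [m [lm cm] <-]; rewrite cmapK //; apply: avimg_cmap;
  exact: cdom_sec.
Qed.

(** Chain rule along the graph of s: its tangent vectors add to the coordinate vector of M the slope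
    of s times the fibre direction. All coordinate formulas for operators rest on this. *)
Lemma partial_sec f s i m : l.1 m -> cdom c m ->
  partial c i (f \o s) m = partial k (lshift 1 i) f (s m) +
    partial c i (sec_coord l s) m * partial k e f (s m).
Proof.
move=> lm cm; have lo := avatlas_open al.
pose phi y := cmap k (s (cinv c y)).
have phiE : phi (cmap c m) = cmap k (s m) by rewrite /phi cmapK.
have Im : (cmap c @` (l.1 `&` cdom c)) (cmap c m) by exists m.
have [||_ D] := @smooth_on_derive_comp R _ _ _ (f \o cinv k) phi
   (cmap c m) (delta_mx 0 i) open_avimg (smooth_chart_Cinf f).
- by rewrite phiE; apply: avimg_cmap; exact: cdom_sec.
- by move=> j; have [_] := smooth_on_reg (smooth_chart_sec s j) Im; exact.
have N := nbhs_cmap ac lo lm cm.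
transitivity ('D_(delta_mx 0 i) ((f \o cinv k) \o phi) (cmap c m)).
  apply: near_eq_derive; apply: filterS N => _ [m' [lm' cm'] <-].
  rewrite -[RHS]/(f (cinv k (cmap k (s (cinv c (cmap c m')))))) cmapK //.
  by rewrite avcinvK //= ?cmapK //; exact: cdom_sec.
rewrite D phiE big_split_ord /= big_ord1; congr (_ + _ * _).
- rewrite (bigD1 i) //= big1 ?addr0 => [|j ji].
    have -> : 'D_(delta_mx 0 i) (fun y => phi y 0 (lshift 1 i)) (cmap c m) = 1.
      transitivity (partial c i (fun m' => cmap c m' 0 i) m); last first.
        by rewrite partial_coord // eqxx.
      apply: near_eq_derive; apply: filterS N => _ [m' [lm' cm'] <-] /=.
      by rewrite /phi /= row_mxEl cmapK // zeta_sec.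
    by rewrite mul1r.
  have -> : 'D_(delta_mx 0 i) (fun y => phi y 0 (lshift 1 j)) (cmap c m) = 0.
    transitivity (partial c i (fun m' => cmap c m' 0 j) m); last first.
      by rewrite partial_coord // (negbTE ji).
    apply: near_eq_derive; apply: filterS N => _ [m' [lm' cm'] <-] /=.
    by rewrite /phi /= row_mxEl cmapK // zeta_sec.
  by rewrite mul0r.
- apply: near_eq_derive; apply: filterS N => _ [m' [lm' cm'] <-] /=.
  by rewrite /phi /= row_mxEr cmapK // zeta_sec mxE eqxx mulr1n.
Qed.

End Chart.

Lemma smooth_comp_sec f s : smooth_in setT (f \o s).
Proof.
apply: smooth_in_local => m _; have [l al lm] := @avatlas_cover R n M Z m.
exists l.1 => // c ac; exact: comp_sec_smooth.
Qed.

Lemma chart_at m : exists c l, [/\ matlas c, @avatlas R n M Z l, cdom c m & l.1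
  m].
Proof.
have [l al lm] := @avatlas_cover R n M Z m.
by have [c ac cm] := matlas_cover m; exists c, l.
Qed.

Lemma is_derive_fib f z t :
  is_derive (t : R) (1 : R) (fun t => f (act z t)) (- XZ f (act z t)).
Proof.
have [c [l [ac al cz lz]]] := chart_at (zeta z).
rewrite (XZ_partial ac al) ?opprK ?cdom_act //.
by apply: is_derive_fib_chart.
Qed.

Lemma XZ0_fib f z t : (forall u, XZ f (act z u) = 0) -> f (act z t) = f z.
Proof.
move=> f0; rewrite -[in RHS](act0 z).
apply: (@is_derive_0_is_cst _ (fun t => f (act z t))) => u.
by have := is_derive_fib f z u; rewrite f0 oppr0.
Qed.

Lemma smoothZ_chart (f : Z -> R) :
  (forall c l, matlas c -> @avatlas R n M Z l -> smooth_chart c l f) -> smoothZ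
    f.
Proof. by move=> H _ [c [l [ac al ->]]]; exact: H. Qed.

End TotalSpace.

(** * Vector fields on the base *)

Section VectorFields.
Variables (R : realType) (n : nat) (M : manifold R n).
Implicit Types (u : M -> R) (Y : (M -> R) -> M -> R) (c : chart R M n) (m : M).

(** Smoothness is imposed on the images of global functions and not on the coefficients, a condition
    easily checked for fields built from operators on Z; [vfield_coef] recovers smooth
    coefficients. *)
Definition vfield Y : Prop :=
  (forall u, smooth_in setT u -> smooth_in setT (Y u)) /\
  forall c m, matlas c -> cdom c m -> exists a : 'I_n -> R,
    forall u, smooth_in setT u -> Y u m = \sum_i a i * partial c i u m.

Lemma smooth_in_all V u : smooth_in setT u -> smooth_in V u.
Proof. exact: smooth_in_subset. Qed.

(** One chart around each point is enough, the chain rule giving the coefficients in every other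
    chart. *)
Lemma vfield_of_local Y :
  (forall m0, exists c (V : set M) (a : 'I_n -> M -> R),
    [/\ matlas c, open V, V m0, V `<=` cdom c &
      (forall i, smooth_in V (a i)) /\ forall u m, smooth_in setT u -> V m ->
        Y u m = \sum_i a i m * partial c i u m]) -> vfield Y.
Proof.
move=> sec_coord; split.
  move=> u us; apply: smooth_in_local => m _.
  have [c [V [a [ac Vo Vm Vc [as_ aE]]]]] := sec_coord m; exists V => //.
  apply: (@smooth_in_ext _ _ _ _ (\sum_i a i * partial c i u)) => //.
    by move=> m' Vm'; rewrite aE // fct_sumE.
  apply: smooth_in_sum => // i _; apply: smooth_inM => //.
  apply: smooth_in_subset (smooth_in_partial i ac Vo (smooth_in_all us)).
  by move=> m' Vm'; split => //; exact: Vc.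
move=> c' m ac' c'm; have [c [V [a [ac Vo Vm Vc [as_ aE]]]]] := sec_coord m.
exists (fun j => \sum_i a i m * partial c i (fun m' => cmap c' m' 0 j) m) => u
  us.
rewrite aE //.
under eq_bigr => i _.
  rewrite (partial_chain i ac ac' openT I (Vc _ Vm) c'm us) mulr_sumr.
  under eq_bigr do rewrite mulrA.
  over.
by rewrite exchange_big /=; apply: eq_bigr => j _; rewrite mulr_suml.
Qed.

(** Coordinate fields and coordinate functions are multiplied by a bump to become global. The [w j]
    are dual to the fields on [U] and serve to prove independence. *)
Lemma local_frame (m0 : M) : exists c (U : set M)
  (Y : 'I_n -> (M -> R) -> M -> R)
    (w : 'I_n -> M -> R),
  [/\ matlas c, open U, U m0, U `<=` cdom c &
    [/\ forall i, vfield (Y i),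
      forall i u m, U m -> Y i u m = partial c i u m,
      forall i, smooth_in setT (w i) &
      forall i j m, U m -> partial c i (w j) m = (j == i)%:R]].
Proof.
have [c ac cm0] := matlas_cover m0.
have co : open (cdom c) by exact: matlas_dom.
have [chi [U [K [cs Uo Um0 Kc [Kc' U1 K0]]]]] := bump_exists co cm0.
exists c, (U `&` cdom c), (fun i u => chi * partial c i u),
  (fun j => chi * (fun m => cmap c m 0 j)).
have Uco : open (U `&` cdom c) by exact: openI.
split; [exact: ac|exact: Uco|by split|by move=> m []|split].
- move=> i; apply: vfield_of_local => m.
  have [Km|nK] := pselect (K m).
    exists c, (cdom c), (fun j => if j == i then chi else cst 0).
    split => //; first exact: Kc'.
    split; first by move=> j; case: ifP => _;
      [exact: smooth_in_all|exact: smooth_in_cst].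
    move=> u m' us cm'; rewrite (bigD1 i) //= eqxx big1 ?addr0 // => j ji.
    by rewrite (negbTE ji) mul0r.
  have [c' ac' c'm] := matlas_cover m.
  exists c', (cdom c' `&` ~` K), (fun _ => cst 0); split => //.
    by apply: openI; [exact: matlas_dom|exact: closed_openC].
  split; first by move=> j; exact: smooth_in_cst.
  move=> u m' us [c'm' nK']; rewrite -[LHS]/(chi m' * _) K0 // mul0r big1 //.
  by move=> j _; rewrite mul0r.
- by move=> i u m [Um _]; rewrite -[LHS]/(chi m * _) U1 // mul1r.
- move=> j; apply: (smooth_in_extend openT co Kc Kc' K0 cs); rewrite setTI.
  exact: smooth_in_coord.
- move=> i j m [Um cm]; rewrite -(partial_coord i j ac cm).
  apply: (partial_ext i ac Uo Um cm) => m' Um'.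
  by rewrite -[LHS]/(chi m' * _) U1 // mul1r.
Qed.

(** Near a point the i-th coefficient is Y applied to the i-th coordinate, cut off so as to be
    globally smooth. *)
Lemma vfield_coef Y c : vfield Y -> matlas c -> exists a : 'I_n -> M -> R,
  (forall i, smooth_in (cdom c) (a i)) /\
  forall u m, smooth_in setT u -> cdom c m -> Y u m = \sum_i a i m * partial c
    i u m.
Proof.
move=> [Ys Yc] ac.
have /choice [a aE] : forall m, exists a : 'I_n -> R, cdom c m ->
    forall u, smooth_in setT u -> Y u m = \sum_i a i * partial c i u m.
  move=> m; have [cm|ncm] := pselect (cdom c m); last by exists (fun=> 0).
  by have [a aE] := Yc c m ac cm; exists a.
exists (fun i m => a m i); split; last by move=> u m us cm; exact: aE.
move=> i; apply: smooth_in_local => m0 cm0.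
have co : open (cdom c) by exact: matlas_dom.
have [chi [U [K [cs Uo Um0 Kc [Kc' U1 K0]]]]] := bump_exists co cm0.
have ws : smooth_in setT (chi * (fun m => cmap c m 0 i)).
  by apply: (smooth_in_extend openT co Kc Kc' K0 cs); rewrite setTI;
    exact: smooth_in_coord.
exists (U `&` cdom c) => //.
apply: (smooth_in_ext (openI Uo co) _ (smooth_in_all (Ys _ ws))) => m [Um cm].
rewrite (aE m cm _ ws) (bigD1 i) //= big1 ?addr0 => [|j ji]; last first.
  rewrite (_ : partial c j _ m = 0) ?mulr0 //.
  transitivity (partial c j (fun m' => cmap c m' 0 i) m).
    apply: (partial_ext j ac Uo Um cm) => m' Um'.
    by rewrite -[LHS]/(chi m' * _) U1 // mul1r.
  by rewrite partial_coord // eq_sym (negbTE ji).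
rewrite (_ : partial c i _ m = 1) ?mulr1 //.
transitivity (partial c i (fun m' => cmap c m' 0 i) m).
  apply: (partial_ext i ac Uo Um cm) => m' Um'.
  by rewrite -[LHS]/(chi m' * _) U1 // mul1r.
by rewrite partial_coord // eqxx.
Qed.

Lemma vfield_cst Y (a : R) m : vfield Y -> Y (cst a) m = 0.
Proof.
move=> [_ Yc]; have [c ac cm] := matlas_cover m.
have [b ->] := Yc c m ac cm; last exact: smooth_in_cst.
by rewrite big1 // => i _; rewrite partial_cst mulr0.
Qed.

Lemma vfield0 : vfield (fun _ => cst 0).
Proof.
split; first by move=> u us; exact: smooth_in_cst.
move=> c m ac cm; exists (fun=> 0) => u us.
by rewrite big1 // => i _; rewrite mul0r.
Qed.

Lemma vfield_lin Y Y' (a b : R) : vfield Y -> vfield Y' ->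
  vfield (fun u m => a * Y u m + b * Y' u m).
Proof.
move=> [Ys Yc] [Y's Y'c]; split.
  move=> u us; apply: (smooth_inD openT).
    exact: (smooth_inM openT (@smooth_in_cst R n M setT a) (Ys u us)).
  exact: (smooth_inM openT (@smooth_in_cst R n M setT b) (Y's u us)).
move=> c m ac cm; have [[d dE] [d' d'E]] := (Yc c m ac cm, Y'c c m ac cm).
exists (fun i => a * d i + b * d' i) => u us; rewrite dE // d'E //.
rewrite !mulr_sumr -big_split; apply: eq_bigr => i _ /=.
by rewrite mulrDl !mulrA.
Qed.

End VectorFields.

(** * The normal form of the operators *)

Section Operators.
Variables (R : realType) (n : nat) (M : manifold R n) (Z : AVbundle M).
Variable s0 : sec Z.
Implicit Types (u : M -> R) (Y : (M -> R) -> M -> R) (c : chart R M n) (m : M)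
  (f g : Cinf Z) (z : Z) (D : Cinf Z -> Cinf Z).

Let F : Cinf Z := FZ s0.
Let e : 'I_(n + 1) := rshift n ord0.

Definition const_sec (t : R) : sec Z := shift_sec s0
  (@smooth_in_cst R n M setT t).

Definition height z : R := sub z (s0 (zeta z)).

Lemma const_secE t m : const_sec t m = act (s0 m) t.
Proof. by []. Qed.

Lemma const_sec_height z : const_sec (height z) (zeta z) = z.
Proof. by rewrite const_secE sub_act // zeta_sec. Qed.

Lemma height_act z t : height (act z t) = height z + t.
Proof. by rewrite /height zeta_act sub_actl // zeta_sec. Qed.

Lemma F_height z : F z = - height z.
Proof.
rewrite -[LHS]/(sub (s0 (zeta z)) z) /height; apply: sub_unique.
by rewrite -{1}(const_sec_height z) const_secE -actD subrr act0.
Qed.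

Lemma F_act z t : F (act z t) = F z - t.
Proof. by rewrite !F_height height_act opprD. Qed.

Lemma F_s0 m t : F (act (s0 m) t) = - t.
Proof. by rewrite F_height height_act /height zeta_sec subzz add0r. Qed.

Lemma XZ_F z : XZ F z = 1.
Proof.
have d : is_derive (0 : R) (1 : R) (fun t => F (act z t)) (-1).
  have -> : (fun t => F (act z t)) = cst (F z) - id.
    by apply/funext => t; rewrite F_act.
  apply: is_derive_eq (is_deriveB (is_derive_cst _ _ _) (is_derive_id _ _)) _.
  by rewrite sub0r.
by rewrite -[LHS]/(XZ_fun F z) (XZ_of_derive d) opprK.
Qed.

(** Horizontal lift of Y for the flat connection whose leaves are the translates of [s0]: f is
    restricted to the leaf through z. *)
Definition lift_field Y (f : Z -> R) z : R :=
  Y (f \o const_sec (height z)) (zeta z).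

Lemma lift_chart Y c l (a : 'I_n -> M -> R) f z :
  matlas c -> @avatlas R n M Z l ->
  (forall u m, smooth_in setT u -> cdom c m -> Y u m = \sum_i a i m * partial c
    i u m) ->
  cdom (avchart c l) z ->
  lift_field Y f z = \sum_i a i (zeta z) *
    (partial (avchart c l) (lshift 1 i) f z +
     partial c i (sec_coord l s0) (zeta z) * partial (avchart c l) e f z).
Proof.
move=> ac al aE kz; have [lz cz] := kz.
rewrite /lift_field aE //; last exact: smooth_comp_sec.
have lo := avatlas_open al.
(* Translates of [s0] have equal slopes, so the coefficients of the lift do not depend on the
   height. *)
have E i : partial c i (sec_coord l (const_sec (height z))) (zeta z) =
    partial c i (sec_coord l s0) (zeta z).
  transitivity (partial c i (sec_coord l s0 + cst (height z)) (zeta z)).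
    apply: (partial_ext i ac lo lz cz) => m lm.
    by rewrite /sec_coord const_secE sub_actl // zeta_sec avatlas_sec.
  rewrite (partialD i ac lz cz (smooth_sec_coord s0 al)
    (@smooth_in_cst _ _ _ _ _)).
  by rewrite partial_cst addr0.
apply: eq_bigr => i _.
by rewrite (partial_sec ac al _ _ _ lz cz) E const_sec_height.
Qed.

(** The lift commutes with X_Z: its chart coefficients are constant along fibres, and coordinate
    derivatives commute with X_Z. *)
Lemma is_derive_lift Y f z : vfield Y ->
  is_derive (0 : R) (1 : R) (fun t => lift_field Y f (act z t))
    (- lift_field Y (XZ f) z).
Proof.
move=> Yv; have [c [l [ac al cz lz]]] := chart_at Z (zeta z).
have [a [_ aE]] := vfield_coef Yv ac.
have kz : cdom (avchart c l) z by [].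
have -> := lift_chart (XZ f) ac al aE kz.
have -> : (fun t => lift_field Y f (act z t)) = \sum_i (fun t => a i (zeta z) *
    (partial (avchart c l) (lshift 1 i) f (act z t) +
     partial c i (sec_coord l s0) (zeta z) * partial (avchart c l) e f
       (act z t))).
  apply/funext => t; rewrite (lift_chart f ac al aE) ?cdom_act // fct_sumE.
  by rewrite zeta_act.
rewrite -sumrN; apply: is_derive_sum => i.
have d1 := is_derive_partial_fib ac al (lshift 1 i) f kz.
have d2 := is_derive_partial_fib ac al e f kz.
apply: is_derive_eq (is_deriveZ _ (is_deriveD d1 (is_deriveZ _ d2))) _.
by rewrite /GRing.scale /= mulrN -opprD mulrN.
Qed.

Definition op_fun Y (A B C : M -> R) (f : Cinf Z) z : R :=
  lift_field Y f z + (A (zeta z) * F z + B (zeta z)) * XZ f z + C (zeta z) * f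
    z.

Definition is_op D Y (A B C : M -> R) : Prop :=
  [/\ vfield Y, smooth_in setT A, smooth_in setT B, smooth_in setT C &
    forall f z, D f z = op_fun Y A B C f z].

Lemma smooth_chart_lift Y c l f : vfield Y -> matlas c -> @avatlas R n M Z l ->
  smooth_chart c l (lift_field Y f).
Proof.
move=> Yv ac al; have [a [as_ aE]] := vfield_coef Yv ac.
have lo := avatlas_open al.
apply: (@smooth_chart_ext _ _ _ _ _ _ ac al (\sum_i (a i \o @zeta _ _ _ _) *
    (partial (avchart c l) (lshift 1 i) f +
     (partial c i (sec_coord l s0) \o @zeta _ _ _ _) * partial (avchart c l) e
       f))).
  by move=> z kz; rewrite (lift_chart f ac al aE) // fct_sumE.
apply: (smooth_chart_sum ac al) => i _; apply: (smooth_chartM ac al).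
  by apply: (smooth_chart_pull ac al); apply: smooth_in_subset (as_ i) => m [].
apply: (smooth_chartD ac al); first exact: smooth_chart_partial.
apply: (smooth_chartM ac al); last exact: smooth_chart_partial.
apply: (smooth_chart_pull ac al); exact: smooth_in_partial
  (smooth_sec_coord s0 al).
Qed.

Lemma smooth_pull u : smooth_in setT u -> smoothZ (u \o @zeta R n M Z).
Proof.
move=> us; apply: smoothZ_chart => c l ac al; apply: (smooth_chart_pull ac al).
exact: smooth_in_all.
Qed.

Definition pull u (us : smooth_in setT u) : Cinf Z := exist _ _
  (smooth_pull us).

Lemma smooth_op Y A B C f : vfield Y -> smooth_in setT A -> smooth_in setT B ->
  smooth_in setT C ->
  smoothZ (op_fun Y A B C f).
Proof.
move=> Yv As Bs Cs; apply: smoothZ_chart => c l ac al.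
have P u : smooth_in setT u -> smooth_chart c l (u \o @zeta R n M Z).
  by move=> us; apply: (smooth_chart_pull ac al); exact: smooth_in_all.
apply: (smooth_chartD ac al); last by apply: (smooth_chartM ac al);
  [exact: P|exact: smooth_chart_Cinf].
apply: (smooth_chartD ac al); first exact: smooth_chart_lift.
apply: (smooth_chartM ac al); last exact: smooth_chart_Cinf.
apply: (smooth_chartD ac al); last exact: P.
by apply: (smooth_chartM ac al); [exact: P|exact: smooth_chart_Cinf].
Qed.

Lemma op_exists Y A B C : vfield Y -> smooth_in setT A -> smooth_in setT B ->
  smooth_in setT C ->
  exists D, is_op D Y A B C.
Proof.
move=> Yv As Bs Cs.
by exists (fun f => exist _ _ (smooth_op f Yv As Bs Cs)).
Qed.

Lemma is_op_eq D D' Y Y' A A' B B' C C' : is_op D Y A B C -> is_op D' Y' A' B'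
  C' ->
  (forall u m, smooth_in setT u -> Y u m = Y' u m) -> (forall m, A m = A' m) ->
  (forall m, B m = B' m) -> (forall m, C m = C' m) -> D = D'.
Proof.
move=> [_ _ _ _ DE] [_ _ _ _ D'E] YY AA BB CC; apply/funext => f;
  apply: Cinf_ext => z.
rewrite DE D'E /op_fun AA BB CC; congr (_ + _ + _); apply: YY.
exact: smooth_comp_sec.
Qed.

Lemma is_op_lin D D' Y Y' A A' B B' C C' (a b : R) :
  is_op D Y A B C -> is_op D' Y' A' B' C' ->
  exists2 D'', is_op D'' (fun u m => a * Y u m + b * Y' u m)
    (fun m => a * A m + b * A' m) (fun m => a * B m + b * B' m)
    (fun m => a * C m + b * C' m) &
    forall f z, D'' f z = a * D f z + b * D' f z.
Proof.
move=> [Yv As Bs Cs DE] [Y'v A's B's C's D'E].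
have lin u u' : smooth_in setT u -> smooth_in setT u' -> smooth_in setT
  (fun m => a * u m + b * u' m).
  move=> us u's; apply: (smooth_inD openT).
    exact: (smooth_inM openT (@smooth_in_cst R n M setT a) us).
  exact: (smooth_inM openT (@smooth_in_cst R n M setT b) u's).
have [D'' D''op] := op_exists (vfield_lin a b Yv Y'v) (lin _ _ As A's)
  (lin _ _ Bs B's) (lin _ _ Cs C's).
exists D'' => // f z; case: D''op => _ _ _ _ ->;
  rewrite DE D'E /op_fun /lift_field.
by ring.
Qed.

(** The lift commutes with X_Z and A, B, C are constant along fibres, so the commutator comes from A
    F alone, where X_Z F = 1. *)
Lemma commute_op D Y A B C f z : is_op D Y A B C ->
  XZ (D f) z = D (XZ f) z + A (zeta z) * XZ f z.
Proof.
move=> [Yv As Bs Cs DE].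
have dL := is_derive_lift f z Yv.
have df := is_derive_fib f z 0; have dX := is_derive_fib (XZ f) z 0.
rewrite act0 in df; rewrite act0 in dX.
have dF : is_derive (0 : R) (1 : R)
    (cst (A (zeta z)) * (cst (F z) - id) + cst (B (zeta z))) (- A (zeta z)).
  apply: is_derive_eq (is_deriveD (is_deriveM (is_derive_cst _ _ _)
    (is_deriveB (is_derive_cst _ _ _) (is_derive_id _ _)))
      (is_derive_cst _ _ _)) _.
  by rewrite /GRing.scale /= sub0r mulr0 !addr0 mulrN1.
have dD := is_deriveD (is_deriveD dL (is_deriveM dF dX))
  (is_deriveM (is_derive_cst (C (zeta z)) _ _) df).
have E : (fun t => D f (act z t)) =
    (fun t => lift_field Y f (act z t)) +
    (cst (A (zeta z)) * (cst (F z) - id) + cst (B (zeta z))) *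
      (fun t => XZ f (act z t)) + cst (C (zeta z)) * (fun t => f (act z t)).
  apply/funext => t; rewrite DE /op_fun zeta_act F_act.
  by rewrite /= !fctE.
rewrite -E in dD; rewrite -[LHS]/(XZ_fun (D f) z) (XZ_of_derive dD).
rewrite /GRing.scale /= DE /op_fun !fctE /= subr0 act0; ring.
Qed.

End Operators.

(** * Operators in normal form: action on sections, phi^0, phi^1 and membership in [D1ah] *)

Section Structure.
Variables (R : realType) (n : nat) (M : manifold R n) (Z : AVbundle M).
Variable s0 : sec Z.
Implicit Types (u : M -> R) (Y : (M -> R) -> M -> R) (c : chart R M n) (m : M)
  (f g : Cinf Z) (z : Z) (D X : Cinf Z -> Cinf Z).

Let F : Cinf Z := FZ s0.
Let e : 'I_(n + 1) := rshift n ord0.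

Lemma vfield_shift Y u (a : R) m : vfield Y -> smooth_in setT u ->
  Y (u - cst a) m = Y u m.
Proof.
move=> [_ Yc] us; have [c ac cm] := matlas_cover m.
have [b bE] := Yc c m ac cm; have as_ := @smooth_in_cst R n M setT a.
rewrite (bE _ us) (bE _ (smooth_inB openT us as_)).
apply: eq_bigr => i _; rewrite (partialB i ac I cm us as_).
by rewrite partial_cst subr0.
Qed.

Lemma XZ_FZ (s : sec Z) z : XZ (FZ s) z = 1.
Proof. exact: XZ_F. Qed.

Lemma FZ_height (s : sec Z) z :
  FZ s z = sub (s (zeta z)) (s0 (zeta z)) + F z.
Proof.
rewrite -[LHS]/(sub (s (zeta z)) z) -[X in _ + X]/(sub (s0 (zeta z)) z).
by rewrite -sub_trans // !zeta_sec.
Qed.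

Lemma op_FZ D Y A B C (s : sec Z) z : is_op s0 D Y A B C ->
  let m := zeta z in let u := fun m => sub (s m) (s0 m) in
  D (FZ s) z = Y u m + B m + C m * u m + (A m + C m) * F z.
Proof.
move=> [Yv As Bs Cs DE] m u; rewrite DE /op_fun XZ_FZ mulr1 (FZ_height s).
(* On the leaf of height h the function F_s is u - h, and Y does not see the constant h. *)
have -> : lift_field s0 Y (FZ s) z = Y u m.
  rewrite /lift_field -/m -[RHS](vfield_shift (height s0 z) m Yv
    (sub_sec_smooth s s0)).
  congr (Y _ _); apply/funext => m'.
  rewrite -[LHS]/(sub (s (zeta (const_sec s0 (height s0 z) m')))
     (const_sec s0 (height s0 z) m')) zeta_sec const_secE.
  by rewrite sub_actr // !zeta_sec.
by rewrite -/m -/(u m) -/F; ring.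
Qed.

Lemma op_one D Y A B C z : is_op s0 D Y A B C -> D (Cinf_cst Z 1) z = C
  (zeta z).
Proof.
move=> [Yv As Bs Cs DE]; rewrite DE /op_fun.
have -> : lift_field s0 Y (Cinf_cst Z 1) z = 0 by exact:
  (vfield_cst 1 (zeta z) Yv).
have -> : XZ (Cinf_cst Z 1) z = 0 by exact: derive1_cst.
by rewrite mulr0 !add0r mulr1.
Qed.

Lemma op_phi1 D Y A B C m : is_op s0 D Y A B C -> phi1 D m = C m.
Proof.
move=> Dop; have [z <-] := zeta_surj Z m; rewrite -(op_one z Dop).
by apply/esym; apply: (xgetPex (cst 0) (P := [set a : M -> R |
  forall z, D (Cinf_cst Z 1) z = a (zeta z)])); exists C => z';
    exact: op_one Dop.
Qed.

(** [phi0] is picked by [xget]: the commutator formula shows that a value exists, and testing on F,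
    where X_Z F = 1, identifies the one picked. *)
Lemma op_phi0 D Y A B C m : is_op s0 D Y A B C -> phi0 D m = - A m.
Proof.
move=> Dop; have P f z : D (XZ f) z - XZ (D f) z = - A (zeta z) * XZ f z.
  by rewrite (commute_op f z Dop) opprD addrA subrr add0r mulNr.
have Q : forall f z, D (XZ f) z - XZ (D f) z = phi0 D (zeta z) * XZ f z.
  apply: (xgetPex (cst 0) (P := [set a : M -> R | forall f z,
    D (XZ f) z - XZ (D f) z = a (zeta z) * XZ f z])).
  by exists (fun m => - A m) => f z; rewrite P.
have [z <-] := zeta_surj Z m.
by have := Q F z; rewrite P XZ_F !mulr1.
Qed.

Lemma op_zero D Y A B C f z : is_op s0 D Y A B C -> (forall z, f z = 0) -> D f
  z = 0.
Proof.
move=> [Yv As Bs Cs DE] f0; rewrite DE /op_fun f0 mulr0 addr0.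
have -> : lift_field s0 Y f z = 0.
  rewrite -(vfield_cst 0 (zeta z) Yv) /lift_field; congr (Y _ _).
  by apply/funext => m; exact: f0.
have -> : XZ f z = 0; last by rewrite mulr0 addr0.
rewrite -[LHS]/(derive1 (fun t : R => f (act z (- t))) 0).
have -> : (fun t : R => f (act z (- t))) = cst 0 by apply/funext => t;
  exact: f0.
exact: derive1_cst.
Qed.

(** Since X_Z D = (D + A) X_Z, each passage of X_Z adds A to C and leaves the other coefficients
    unchanged. *)
Lemma iter_commute k D Y A B C : is_op s0 D Y A B C ->
  exists D' C', is_op s0 D' Y A B C' /\
    forall f, iter k (@XZ R n M Z) (D f) = D' (iter k (@XZ R n M Z) f).
Proof.
move=> Dop; elim: k => [|k [D' [C' [D'op IH]]]]; first by exists D, C.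
have [Yv As Bs Cs DE] := D'op.
have [D'' D''op] := op_exists s0 Yv As Bs (smooth_inD openT Cs As).
exists D'', (C' + A); split => // f; rewrite !iterS IH; apply: Cinf_ext => z.
rewrite (commute_op _ _ D'op) DE; have [_ _ _ _ ->] := D''op.
by rewrite /op_fun -addrA -mulrDl.
Qed.

Lemma op_vector_field D Y A B : is_op s0 D Y A B (cst 0) -> vector_field D.
Proof.
move=> [Yv As Bs _ DE] _ [c [l [ac al ->]]].
have [a [as_ aE]] := vfield_coef Yv ac; have lo := avatlas_open al.
have P u : smooth_in (l.1 `&` cdom c) u -> smooth_chart c l
  (u \o @zeta R n M Z) by exact: smooth_chart_pull.
have P1 i : smooth_chart c l (a i \o @zeta R n M Z).
  by apply: P; apply: smooth_in_subset (as_ i) => m [].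
(* The last coefficient collects the slope of the lifted field and, with a minus sign because X_Z is
   minus the fibre derivative, the coefficient of X_Z. *)
pose b (j : 'I_(n + 1)) : Z -> R := match fintype.split j with
  | inl i => a i \o @zeta R n M Z
  | inr _ => \sum_i (a i \o @zeta R n M Z) *
               (partial c i (sec_coord l s0) \o @zeta R n M Z) +
             cst (-1) * ((A \o @zeta R n M Z) * (F : Z -> R) +
               (B \o @zeta R n M Z))
  end.
exists b.
  move=> j; have : smooth_chart c l (b j);
    last by rewrite /smooth_chart /avimg setTI.
  rewrite /b; case: (fintype.split j) => [i|_]; first exact: P1.
  apply: (smooth_chartD ac al).
    apply: (smooth_chart_sum ac al) => i _; apply: (smooth_chartM ac al) => //;
      apply: P.
    exact: smooth_in_partial (smooth_sec_coord s0 al).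
  apply: (smooth_chartM ac al); first exact: smooth_chart_cst.
  apply: (smooth_chartD ac al); last by apply: P; exact: smooth_in_all.
  by apply: (smooth_chartM ac al); [apply: P;
    exact: smooth_in_all|exact: smooth_chart_Cinf].
move=> f z kz; rewrite DE /op_fun mul0r addr0 big_split_ord big_ord1.
rewrite (lift_chart s0 f ac al aE kz) (XZ_partial ac al f kz) -/e.
have -> : b (rshift n ord0) z = \sum_i a i (zeta z) * partial c i
  (sec_coord l s0) (zeta z)
    - (A (zeta z) * F z + B (zeta z)).
  rewrite /b; case: fintype.splitP => [j /= H|j _].
    by have := ltn_ord j; rewrite -H addn0 ltnn.
  by rewrite fctE /= fct_sumE !fctE /= mulN1r.
have bl i : b (lshift 1 i) z = a i (zeta z).
  rewrite /b; case: fintype.splitP => [j /= H|j /= H].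
    by congr (a _ _); apply: val_inj.
  by have := ltn_ord i; rewrite H -ltn_subRL subnn.
rewrite -[RHS]/(_ + _) mulrN mulrBl addrA; congr (_ - _).
rewrite mulr_suml -big_split; apply: eq_bigr => i _ /=.
by rewrite bl mulrDr mulrA.
Qed.

Lemma op_D1ah D Y A B C : is_op s0 D Y A B C -> D1ah D.
Proof.
move=> Dop; have [Yv As Bs Cs DE] := Dop; split.
  have [X Xop] := op_exists s0 Yv As Bs (@smooth_in_cst R n M setT 0).
  exists X, (pull Z Cs); split; first exact: op_vector_field Xop.
  move=> f z; rewrite DE; case: Xop => _ _ _ _ ->.
  by rewrite /op_fun mul0r addr0.
move=> k _ [f fP <-] z.
have [D' [C' [D'op ->]]] := iter_commute k.+1 Dop.
exact: op_zero D'op fP.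
Qed.

End Structure.

(** * Every operator of [D1ah] has the normal form *)

Section StructureConverse.
Variables (R : realType) (n : nat) (M : manifold R n) (Z : AVbundle M).
Variable s0 : sec Z.
Implicit Types (u : M -> R) (Y : (M -> R) -> M -> R) (c : chart R M n) (m : M)
  (f g : Cinf Z) (z : Z) (D X : Cinf Z -> Cinf Z).

Let F : Cinf Z := FZ s0.
Let e : 'I_(n + 1) := rshift n ord0.

Lemma XZ_invariant (h : Z -> R) z : (forall t, h (act z t) = h z) -> XZ_fun h z
  = 0.
Proof.
move=> hE; rewrite /XZ_fun (_ : (fun t => _) = cst (h z));
  first exact: derive1_cst.
by apply/funext => t; rewrite hE.
Qed.

Lemma XZ0_s0 f z : (forall z, XZ f z = 0) -> f z = f (s0 (zeta z)).
Proof.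
move=> f0; rewrite -{1}(const_sec_height s0 z) const_secE.
by rewrite XZ0_fib.
Qed.

(** With q the constant value of X_Z f on the fibre, f - q F has zero derivative along it, and F
    vanishes on [s0]. *)
Lemma XZ_XZ0_s0 f z : (forall z, XZ (XZ f) z = 0) ->
  f z = f (s0 (zeta z)) + XZ f (s0 (zeta z)) * F z.
Proof.
move=> f2; set z0 := s0 (zeta z); set q := XZ f z0.
pose h t := f (act z0 t) - q * F (act z0 t).
have h0 t : is_derive (t : R) (1 : R) h 0.
  have XE : XZ f (act z0 t) = q by rewrite /q XZ0_fib.
  have XF : XZ F (act z0 t) = 1 by exact: XZ_F.
  have Q := is_deriveB (is_derive_fib f z0 t)
    (is_deriveZ q (is_derive_fib F z0 t)).
  rewrite XE XF in Q; apply: is_derive_eq Q _.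
  by rewrite /GRing.scale /= mulrN1 subrr.
have := is_derive_0_is_cst (height s0 z) 0 h0; rewrite /h act0.
have -> : act z0 (height s0 z) = z.
  by rewrite -[RHS](const_sec_height s0) const_secE.
have -> : F z0 = 0 by rewrite -[z0]act0 F_s0 oppr0.
by rewrite mulr0 subr0 => /eqP; rewrite subr_eq => /eqP.
Qed.

Section Fields.
Variables (X : Cinf Z -> Cinf Z) (c : chart R M n) (l : set M * (M -> Z)).
Hypotheses (ac : matlas c) (al : @avatlas R n M Z l).
Let k := avchart c l.
Variables (a : 'I_(n + 1) -> Z -> R) (z : Z).
Hypotheses (kz : cdom k z)
  (Xa : forall f, X f z = \sum_i a i z * partial k i f z).
Let w i := partial c i (sec_coord l (const_sec s0 (height s0 z))) (zeta z).

(** [partial_sec] is applied to the translate of [s0] through z; its vertical term drops out because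
    a pull-back is killed by X_Z. *)
Lemma partial_pull u (us : smooth_in setT u) i :
  partial k (lshift 1 i) (pull Z us) z = partial c i u (zeta z).
Proof.
have [lz cz] := kz.
have := partial_sec ac al (pull Z us) (const_sec s0 (height s0 z)) i lz cz.
rewrite const_sec_height => E.
have X0 : XZ (pull Z us) z = 0.
  by apply: XZ_invariant => t; rewrite /= zeta_act.
rewrite (XZ_partial ac al _ kz) in X0; move/eqP: X0;
  rewrite oppr_eq0 => /eqP X0.
rewrite X0 mulr0 addr0 in E; rewrite -[LHS]E; congr (partial c i _ _).
by apply/funext => m; rewrite /= zeta_act zeta_sec.
Qed.

Lemma partial_e_pull u (us : smooth_in setT u) : partial k e (pull Z us) z = 0.
Proof.
have X0 : XZ (pull Z us) z = 0.
  by apply: XZ_invariant => t; rewrite /= zeta_act.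
by apply/eqP; rewrite -oppr_eq0 -(XZ_partial ac al _ kz) X0.
Qed.

Lemma field_pull u (us : smooth_in setT u) :
  X (pull Z us) z = \sum_(i < n) a (lshift 1 i) z * partial c i u (zeta z).
Proof.
rewrite Xa big_split_ord big_ord1 -[LHS]/(_ + _) -/e partial_e_pull mulr0 addr0.
by apply: eq_bigr => i _; rewrite partial_pull.
Qed.

Lemma field_F :
  X F z = \sum_(i < n) a (lshift 1 i) z * w i - a e z.
Proof.
have [lz cz] := kz.
have Fe : partial k e F z = -1.
  by apply/eqP; rewrite -eqr_opp opprK -(XZ_partial ac al F kz) XZ_F.
rewrite Xa big_split_ord big_ord1 -[LHS]/(_ + _) -/e Fe mulrN1; congr (_ - _).
apply: eq_bigr => i _; congr (_ * _).
have := partial_sec ac al F (const_sec s0 (height s0 z)) i lz cz.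
have -> : F \o const_sec s0 (height s0 z) = cst (- height s0 z).
  by apply/funext => m; exact: F_s0.
rewrite partial_cst const_sec_height -/k -/e Fe -/(w i) mulrN1 => /eqP.
by rewrite eq_sym subr_eq0 => /eqP.
Qed.

(** Eliminating the vertical coefficient by [field_F] leaves the horizontal ones acting along the
    translate of [s0] through z, on which F is constant, plus a multiple of X_Z read off from F. *)
Lemma field_expand f :
  X f z = \sum_(i < n) a (lshift 1 i) z *
      partial c i (f \o const_sec s0 (height s0 z)) (zeta z) + X F z * XZ f z.
Proof.
have [lz cz] := kz.
rewrite field_F (XZ_partial ac al f kz) -/k -/e Xa big_split_ord big_ord1.
rewrite -[LHS]/(_ + _) -/e mulrN mulrBl opprB addrA addrAC.
congr (_ + _).
rewrite mulr_suml -sumrB; apply: eq_bigr => i _.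
by rewrite (partial_sec ac al _ _ _ lz cz) const_sec_height -/k -/e -/(w i);
  ring.
Qed.

End Fields.

Lemma D1ah_op D : D1ah D -> exists Y A B C, is_op s0 D Y A B C.
Proof.
move=> [[X [d [Xv DX]]] DPol].
have P0 f : (forall z, XZ f z = 0) -> forall z, XZ (D f) z = 0.
  move=> f0; apply: (DPol 0%N); exists f => //.
have P1 : forall z, XZ (XZ (D F)) z = 0.
  apply: (DPol 1%N); exists F => // z; apply: XZ_invariant => t.
  by rewrite !XZ_F.
have local z : exists c l (a : 'I_(n + 1) -> Z -> R),
  [/\ matlas c, @avatlas R n M Z l,
    cdom (avchart c l) z &
    forall f z', cdom (avchart c l) z' ->
      X f z' = \sum_i a i z' * partial (avchart c l) i f z'].
  have [c [l [ac al cz lz]]] := chart_at Z (zeta z).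
  have [|a _ aE] := Xv (avchart c l); first by exists c, l.
  by exists c, l, a; split.
have dE z : d z = D (Cinf_cst Z 1) z.
  have [c [l [a [ac al kz aE]]]] := local z.
  rewrite DX aE // big1 ?add0r ?mulr1 // => i _.
  have -> : partial (avchart c l) i (Cinf_cst Z 1) z = 0 by exact: derive_cst.
  by rewrite mulr0.
have d0 z : d z = d (s0 (zeta z)).
  rewrite !dE; apply: XZ0_s0; apply: P0 => z'.
  by apply: XZ_invariant.
(* Restriction to [s0] loses nothing: d = D 1 is constant along fibres, and D F has value B on [s0]
   and constant derivative A + C along X_Z. *)
pose C := d \o s0; have Cs : smooth_in setT C by exact: smooth_comp_sec.
pose B := D F \o s0; have Bs : smooth_in setT B by exact: smooth_comp_sec.
pose A := XZ (D F) \o s0 - C.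
have As : smooth_in setT A by exact: (smooth_inB openT (smooth_comp_sec _ _)
  Cs).
(* The default 0 is taken at functions that are not smooth, on which [vfield] imposes nothing. *)
pose Y u m := if pselect (smooth_in setT u) is left us
  then D (pull Z us) (s0 m) - C m * u m else 0.
(* Although Y is defined on [s0], the identity holds on the whole fibre because D maps pull-backs
   into Pol^0. *)
have YE u (us : smooth_in setT u) z : X (pull Z us) z = Y u (zeta z).
  rewrite /Y; case: pselect => // us'; rewrite (Prop_irrelevance us' us).
  have -> : X (pull Z us) z = D (pull Z us) z - d z * u (zeta z).
    by rewrite DX addrK.
  rewrite d0 -[d _]/(C (zeta z)); congr (_ - _); apply: XZ0_s0; apply: P0 => z'.
  by apply: XZ_invariant => t; rewrite /= zeta_act.
have XF z : X F z = A (zeta z) * F z + B (zeta z).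
  have -> : X F z = D F z - d z * F z by rewrite DX addrK.
  rewrite (XZ_XZ0_s0 z P1) d0.
  rewrite -[A _]/(XZ (D F) (s0 (zeta z)) - d (s0 (zeta z)))
    -[B _]/(D F (s0 (zeta z))).
  by ring.
have Yv : vfield Y.
  split.
    move=> u us; have : smooth_in setT (D (pull Z us) \o s0 - C * u).
      by apply: (smooth_inB openT); [exact: smooth_comp_sec|exact: smooth_inM
        openT _ _].
    apply: (smooth_in_ext openT) => m _; rewrite /Y; case: pselect => // us'.
    by rewrite (Prop_irrelevance us' us).
  move=> c m ac cm; have [l al lm] := @avatlas_cover R n M Z m.
  have [|a _ aE] := Xv (avchart c l); first by exists c, l.
  have kz : cdom (avchart c l) (s0 m) by rewrite /= zeta_sec.
  exists (fun i => a (lshift 1 i) (s0 m)) => u us.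
  have := field_pull ac al kz (fun f => aE f _ kz) us.
  by rewrite YE zeta_sec.
exists Y, A, B, C; split => // f z; rewrite DX /op_fun -XF d0; congr (_ + _).
have [c [l [a [ac al kz aE]]]] := local z.
rewrite (field_expand ac al kz (fun f => aE f z kz) f); congr (_ + _).
rewrite -[RHS](YE _ (smooth_comp_sec f (const_sec s0 (height s0 z))) z).
by rewrite (field_pull ac al kz (fun f => aE f z kz)).
Qed.

End StructureConverse.

(** * Subbundles *)

Section Subbundles.
Variables (R : realType) (n : nat) (M : manifold R n) (Z : AVbundle M).
Variable s0 : sec Z.
Implicit Types (u : M -> R) (m : M) (f g : Cinf Z) (z : Z)
  (D : Cinf Z -> Cinf Z).

Let F : Cinf Z := FZ s0.

Lemma lift_pull Y u (us : smooth_in setT u) z :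
  lift_field s0 Y (pull Z us) z = Y u (zeta z).
Proof.
rewrite /lift_field; congr (Y _ _); apply/funext => m.
by rewrite /= zeta_act zeta_sec.
Qed.

Lemma valueE D m f z : zeta z = m -> value D m f z = D f z.
Proof. by move=> zm; rewrite /value patchE mem_set. Qed.

Lemma valueN D m f z : zeta z <> m -> value D m f z = 0.
Proof. by move=> zm; rewrite /value patchE memNset. Qed.

Lemma value_eqP D D' m :
  value D m = value D' m <-> forall f z, zeta z = m -> D f z = D' f z.
Proof.
split=> [e f z zm|e]; first by rewrite -(valueE D f zm) e valueE.
apply/funext => f; apply/funext => z.
have [zm|zm] := pselect (zeta z = m); first by rewrite !valueE // e.
by rewrite !valueN.
Qed.

Lemma op_F D Y A B C z : is_op s0 D Y A B C ->
  D F z = B (zeta z) + (A (zeta z) + C (zeta z)) * F z.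
Proof.
move=> Dop; rewrite (op_FZ s0 z Dop) subzz mulr0 addr0; congr (_ + _).
rewrite -[RHS]add0r; congr (_ + _); have [Yv _ _ _ _] := Dop.
rewrite -[RHS](vfield_cst 0 (zeta z) Yv); congr (Y _ _).
by apply/funext => m; rewrite subzz.
Qed.

(** The coefficients are recovered over m alone: D 1 gives C, and D F at two points of the fibre,
    where F is 0 and 1, gives A + C by difference. *)
Lemma value_phi D D' m : D1ah D -> D1ah D' -> value D m = value D' m ->
  phi0 D m = phi0 D' m /\ phi1 D m = phi1 D' m.
Proof.
move=> /(D1ah_op s0)[Y [A [B [C Dop]]]] /(D1ah_op s0)[Y' [A' [B' [C' D'op]]]].
move=> /value_eqP e.
rewrite (op_phi0 m Dop) (op_phi0 m D'op) (op_phi1 m Dop) (op_phi1 m D'op).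
have CC : C m = C' m.
  have := e (Cinf_cst Z 1) _ (zeta_sec s0 m).
  by rewrite (op_one _ Dop) (op_one _ D'op) zeta_sec.
split=> //; congr (- _).
have zm t : zeta (act (s0 m) t) = m by rewrite zeta_act zeta_sec.
have := e F _ (zm 0); have := e F _ (zm (-1)).
rewrite !(op_F _ Dop) !(op_F _ D'op) !F_s0 !zm CC; lra.
Qed.

(** A point of the locus is witnessed by an operator that may differ from D away from the fibre;
    [value_phi] transfers the relation to D. *)
Lemma SecP (P : R -> R -> Prop) D :
  Sec (locus (Z := Z) P) D <-> D1ah D /\ forall m, P (phi0 D m) (phi1 D m).
Proof.
split=> [[DD H]|[DD H]]; split => // m.
  have [D' [D'D PD'] e] := H m.
  by have [<- <-] := value_phi D'D DD e.
by exists D.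
Qed.

Lemma vfield_sum (I : finType) (Y : I -> (M -> R) -> M -> R) (x : I -> R) :
  (forall i, vfield (Y i)) -> vfield (fun u m => \sum_i x i * Y i u m).
Proof.
move=> Yv; split.
  move=> u us; have : smooth_in setT (\sum_i cst (x i) * Y i u).
    apply: smooth_in_sum => [|i _]; first exact: openT.
    by apply: (smooth_inM openT); [exact: smooth_in_cst|exact: (Yv i).1].
  by rewrite fct_sumE.
move=> c m ac cm.
have /choice [b bE] i : exists b : 'I_n -> R, forall u, smooth_in setT u ->
    Y i u m = \sum_j b j * partial c j u m by exact: (Yv i).2.
exists (fun j => \sum_i x i * b i j) => u us.
under eq_bigr => i _.
  rewrite bE // mulr_sumr; under eq_bigr do rewrite mulrA; over.
by rewrite exchange_big /=; apply: eq_bigr => j _; rewrite mulr_suml.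
Qed.

Let i0 : 'I_(n + 3) := rshift n ord0.
Let i1 : 'I_(n + 3) := rshift n (lift ord0 ord0).
Let i2 : 'I_(n + 3) := rshift n (lift ord0 (lift ord0 ord0)).

(* The frame consists of n coordinate vector fields, X_Z, a F X_Z + b and 1. *)
Lemma frame_subbundle (P : R -> R -> Prop) (a b : R) (k : nat) :
  (k <= n + 3)%N -> (n <= k)%N -> a != 0 ->
  (forall x0 x1 x2 : R, P (- (a * x1)) (b * x1 + x2) <->
    [/\ (k <= n)%N -> x0 = 0, (k <= n + 1)%N -> x1 = 0 & (k <= n + 2)%N -> x2 =
      0]) ->
  vector_subbundle (locus (Z := Z) P).
Proof.
(* If x0, x1, x2 are the coordinates along the last three frame members, then phi^0 = - a x1 and
   phi^1 = b x1 + x2; [HP] says that P holds exactly when the coordinates of index at least k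
   vanish. *)
move=> k3 nk a0 HP; exists (n + 3)%N, k; split => // m0.
have [c [U [Y [w [ac Uo Um0 Uc [Yv YE ws wE]]]]]] := local_frame m0.
have cs t : smooth_in setT (cst t : M -> R) by exact: smooth_in_cst.
pose t (j : 'I_(n + 3)) f z := match fintype.split j with
  | inl i => lift_field s0 (Y i) f z
  | inr q => nth 0 [:: XZ f z; a * F z * XZ f z + b * f z; f z] q
  end.
have /choice [E Et] j : exists E, D1ah E /\ forall f z, E f z = t j f z.
  rewrite /t; case: (fintype.split j) => [i|q].
    have [E Eop] := op_exists s0 (Yv i) (cs 0) (cs 0) (cs 0).
    exists E; split; first exact: op_D1ah Eop.
    by case: Eop => _ _ _ _ EE f z; rewrite EE /op_fun /cst /=; ring.
  have [E Eop] := op_exists s0 (vfield0 M) (cs (nth 0 [:: 0; a; 0] q))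
     (cs (nth 0 [:: 1; 0; 0] q)) (cs (nth 0 [:: 0; b; 1] q)).
  exists E; split; first exact: op_D1ah Eop.
  case: Eop => _ _ _ _ EE f z; rewrite EE /op_fun /lift_field /cst /=.
  by case: q EE => [[|[|[|q]]] hq] //= _; ring.
have tE (x : 'I_(n + 3) -> R) f z : \sum_j x j * t j f z =
    op_fun s0 (fun u m => \sum_i x (lshift 3 i) * Y i u m)
      (cst (a * x i1)) (cst (x i0)) (cst (b * x i1 + x i2)) f z.
  rewrite big_split_ord !big_ord_recl big_ord0 /op_fun /lift_field /cst /=.
  have tl i : t (lshift 3 i) f z = lift_field s0 (Y i) f z.
    by rewrite /t (unsplitK (inl i : 'I_n + 'I_3)%type).
  have tr q : t (rshift n q) f z =
      nth 0 [:: XZ f z; a * F z * XZ f z + b * f z; f z] q.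
    by rewrite /t (unsplitK (inr q : 'I_n + 'I_3)%type).
  rewrite !tr /= -/i0 -/i1 -/i2; under eq_bigr do rewrite tl.
  by rewrite /lift_field; ring.
have comb (x : 'I_(n + 3) -> R) : exists2 D, is_op s0 D
    (fun u m => \sum_i x (lshift 3 i) * Y i u m)
      (cst (a * x i1)) (cst (x i0)) (cst (b * x i1 + x i2)) &
    forall f z, D f z = \sum_j x j * t j f z.
  have [D Dop] := op_exists s0 (vfield_sum (fun i => x (lshift 3 i)) Yv)
    (cs (a * x i1)) (cs (x i0)) (cs (b * x i1 + x i2)).
  by exists D => // f z; rewrite tE; case: Dop.
exists U, E; split => // [j|m Um]; first by have [] := Et j.
(* The coordinates are the coefficients of D at m, with the linear relation between (x1, x2) and (A,
   C) inverted. *)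
have decomp D : D1ah D -> exists x : 'I_(n + 3) -> R,
    [/\ forall f z, value D m f z = \sum_j x j * value (E j) m f z,
      phi0 D m = - (a * x i1) & phi1 D m = b * x i1 + x i2].
  move=> /(D1ah_op s0)[Y' [A [B [C Dop]]]]; have [Y'v _ _ _ DE] := Dop.
  have [d dE] := Y'v.2 c m ac (Uc _ Um).
  pose x (j : 'I_(n + 3)) := match fintype.split j with
    | inl i => d i
    | inr q => nth 0 [:: B m; A m / a; C m - b * (A m / a)] q
    end.
  have xl i : x (lshift 3 i) = d i by rewrite /x
    (unsplitK (inl i : 'I_n + 'I_3)%type).
  have xr q : x (rshift n q) = nth 0 [:: B m; A m / a; C m - b * (A m / a)] q.
    by rewrite /x (unsplitK (inr q : 'I_n + 'I_3)%type).
  have x1 : a * x i1 = A m by rewrite xr /= mulrC divfK.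
  have x2 : b * x i1 + x i2 = C m by rewrite !xr /= addrC subrK.
  exists x; split; last 2 first.
  - by rewrite (op_phi0 _ Dop) x1.
  - by rewrite (op_phi1 _ Dop) x2.
  move=> f z; have [zm|zm] := pselect (zeta z = m); last first.
    by rewrite valueN // big1 // => j _; rewrite valueN // mulr0.
  rewrite valueE //; under eq_bigr => j _ do rewrite valueE // (Et j).2.
  rewrite tE x1 x2 (xr ord0) DE /op_fun /lift_field zm; congr (_ + _ + _).
  rewrite dE; last exact: smooth_comp_sec.
  by apply: eq_bigr => i _; rewrite xl YE.
have span (x : 'I_(n + 3) -> R) : exists2 D, D1ah D &
    [/\ forall f z, value D m f z = \sum_j x j * value (E j) m f z,
      phi0 D m = - (a * x i1) & phi1 D m = b * x i1 + x i2].
  have [D Dop DE] := comb x; exists D; first exact: op_D1ah Dop.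
  split; [|exact: (op_phi0 m Dop)|exact: (op_phi1 m Dop)].
  move=> f z; have [zm|zm] := pselect (zeta z = m); last first.
    by rewrite valueN // big1 // => j _; rewrite valueN // mulr0.
  by rewrite valueE // DE; apply: eq_bigr => j _; rewrite valueE // (Et j).2.
have split3 (j : 'I_(n + 3)) : [\/ exists i, j = lshift 3 i, j = i0, j = i1 | j
  = i2].
  have [i ->|q ->] := fintype.split_ordP j; first by constructor 1; exists i.
  case: q => [[|[|[|q]]] hq] //.
  - by constructor 2; congr rshift; apply: val_inj.
  - by constructor 3; congr rshift; apply: val_inj.
  - by constructor 4; congr rshift; apply: val_inj.
have vi0 : i0 = n :> nat by rewrite /= addn0.
have vi1 : i1 = (n + 1)%N :> nat by [].
have vi2 : i2 = (n + 2)%N :> nat by [].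
split.
(* Independence is tested on 1, then on F at points where F is 0 and 1, which kills the last three
   coordinates, and finally on the functions [w i]. *)
- move=> x x0.
  have [D Dop DE] := comb x.
  have D0 f z : zeta z = m -> D f z = 0.
    move=> zm; rewrite DE -[RHS](x0 f z).
    by apply: eq_bigr => j _; rewrite valueE // (Et j).2.
  have zm t' : zeta (act (s0 m) t') = m by rewrite zeta_act zeta_sec.
  have C0 : b * x i1 + x i2 = 0.
    exact: etrans (esym (op_one (act (s0 m) 0) Dop)) (D0 _ _ (zm 0)).
  have h t' : 0 = x i0 + (a * x i1 + (b * x i1 + x i2)) * - t'.
    by rewrite -[LHS](D0 F _ (zm t')) (op_F _ Dop) F_s0.
  have x00 : 0 = x i0 by have := h 0; rewrite oppr0 mulr0 addr0.
  have x10 : x i1 = 0.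
    have := h (-1); rewrite C0 -x00 add0r addr0 opprK mulr1 => /esym/eqP.
    by rewrite mulf_eq0 (negbTE a0) => /eqP.
  have x20 : x i2 = 0 by move: C0; rewrite x10 mulr0 add0r.
  move=> j; have [[i ->]|->|->|->] := split3 j => //.
  have [_ _ _ _ DE'] := Dop.
  have H : \sum_j x (lshift 3 j) * Y j (w i) m = 0.
    rewrite -[RHS](D0 (pull Z (ws i)) _ (zeta_sec s0 m)) DE' /op_fun /cst.
    by rewrite lift_pull zeta_sec x10 x20 -x00; ring.
  rewrite -[RHS]H (bigD1 i) //= YE // wE // eqxx mulr1 big1 ?addr0 // => j' ji.
  by rewrite YE // wE // eq_sym (negbTE ji) mulr0.
- apply/seteqP; split=> [_ [D DD <-]|v [x vE]].
    by have [x [xE _ _]] := decomp D DD; exists x.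
  have [D DD [DE _ _]] := span x; exists D => //.
  by apply/funext => f; apply/funext => z; rewrite DE vE.
- apply/seteqP; split=> [_ [D [DD PD] <-]|v [x vE]].
    have [x [xE e0 e1]] := decomp D DD; exists x => f z; rewrite xE.
    move: PD; rewrite e0 e1 => /(HP (x i0))[h0 h1 h2].
    rewrite (bigID (fun j : 'I_(n + 3) => (j < k)%N)) /= [X in _ + X]big1
      ?addr0 //.
    move=> j; rewrite -leqNgt => kj.
    have -> : x j = 0; last by rewrite mul0r.
    have [[i ej]|ej|ej|ej] := split3 j; rewrite ej in kj *.
    + by have := leq_ltn_trans (leq_trans nk kj) (ltn_ord i); rewrite ltnn.
    + by apply: h0; rewrite -vi0.
    + by apply: h1.
    + by apply: h2.
  (* Dropping the coordinates from k on leaves the combination unchanged and meets the form required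
     by [HP]. *)
  pose x' (j : 'I_(n + 3)) := if (j < k)%N then x j else 0.
  have [D DD [DE e0 e1]] := span x'; exists D.
    split => //; rewrite e0 e1; apply/(HP (x' i0)); rewrite /x'.
    by split => h; rewrite ltnNge ?h // vi0 h.
  apply/funext => f; apply/funext => z; rewrite DE vE [RHS]big_mkcond /=.
  by apply: eq_bigr => j _; rewrite /x'; case: ifP => // _; rewrite mul0r.
Qed.

End Subbundles.

(** * Affine operators on sections *)

Section AffineOperators.
Variables (R : realType) (n : nat) (M : manifold R n) (Z : AVbundle M).
Variable s0 : sec Z.
Implicit Types (u : M -> R) (m : M) (f g : Cinf Z) (z : Z)
  (D : Cinf Z -> Cinf Z)
  (s : sec Z).

Let F : Cinf Z := FZ s0.

Lemma sec_ext s s' : (forall m, s m = s' m) -> s = s'.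
Proof.
case: s s' => s ss [s' ss'] /= /funext e; rewrite e in ss *.
by congr exist; exact: Prop_irrelevance.
Qed.

(** The common ground of operators on Z and bundle morphisms: an affine formula in the first
    derivatives and, when [jet] holds, the value of the section. *)
Definition local_affine (jet : bool) (H : sec Z -> M -> R) : Prop :=
  forall c l, matlas c -> @avatlas R n M Z l ->
  exists (a : 'I_n -> M -> R) (d b : M -> R),
    [/\ forall i, smooth_in (l.1 `&` cdom c) (a i), smooth_in (l.1 `&` cdom c)
      d,
      smooth_in (l.1 `&` cdom c) b, (~~ jet -> d = cst 0) &
      forall s m, l.1 m -> cdom c m -> H s m =
        \sum_i a i m * partial c i (sec_coord l s) m + d m * sec_coord l s m +
          b m].

(* kappa is 0 for operators with values in functions, 1 for those with values in
   sections of Z; jet is false for derivations. *)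
Definition op_class (jet : bool) (kappa : R) : set (Cinf Z -> Cinf Z) :=
  [set D | D1ah D /\ forall m, phi1 D m - phi0 D m = kappa /\
                               (~~ jet -> phi1 D m = 0)].

Lemma op_classP jet kappa D : op_class jet kappa D ->
  exists Y B C, [/\ is_op s0 D Y (fun m => kappa - C m) B C,
    (~~ jet -> forall m, C m = 0) &
    forall s z, D (FZ s) z = Y (fun m => sub (s m) (s0 m)) (zeta z) + B
      (zeta z) +
      C (zeta z) * sub (s (zeta z)) (s0 (zeta z)) + kappa * F z].
Proof.
move=> [/(D1ah_op s0)[Y [A [B [C Dop]]]] H].
have AC : A = (fun m => kappa - C m).
  apply/funext => m; have [<- _] := H m.
  by rewrite (op_phi0 _ Dop) (op_phi1 _ Dop) opprK [C m + _]addrC addrK.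
rewrite AC in Dop; exists Y, B, C; split => //.
  by move=> nj m; have [_] := H m; rewrite (op_phi1 _ Dop) => /(_ nj).
by move=> s z; rewrite (op_FZ s z Dop) subrK.
Qed.

Lemma op_class_FZ jet kappa D s z : op_class jet kappa D ->
  D (FZ s) z = D (FZ s) (s0 (zeta z)) + kappa * F z.
Proof.
move=> /op_classP[Y [B [C [_ _ DE]]]]; rewrite !DE zeta_sec.
have -> : F (s0 (zeta z)) = 0 by rewrite -[s0 _]act0 F_s0 oppr0.
by rewrite mulr0 addr0.
Qed.

Lemma sec_coord_sub l s s' m : @avatlas R n M Z l -> l.1 m ->
  sub (s m) (s' m) = sec_coord l s m - sec_coord l s' m.
Proof.
move=> al lm; have zl : zeta (l.2 m) = m by exact: avatlas_sec.
by rewrite /sec_coord (@sub_trans _ _ _ _ (s m) (s' m) (l.2 m)) ?zeta_sec ?zl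
  // addrK.
Qed.

Lemma partial_sub c l s s' i m : matlas c -> @avatlas R n M Z l -> l.1 m ->
  cdom c m -> partial c i (fun m => sub (s m) (s' m)) m =
    partial c i (sec_coord l s) m - partial c i (sec_coord l s') m.
Proof.
move=> ac al lm cm; have lo := avatlas_open al.
rewrite -(partialB i ac lm cm (smooth_sec_coord s al) (smooth_sec_coord s' al)).
by apply: (partial_ext i ac lo lm cm) => m' lm'; exact: sec_coord_sub.
Qed.

Lemma op_class_affine jet kappa D : op_class jet kappa D ->
  local_affine jet (fun s m => D (FZ s) (s0 m)).
Proof.
move=> /op_classP[Y [B [C [[Yv _ Bs Cs _] C0 DE]]]] c l ac al.
have [a [as_ aE]] := vfield_coef Yv ac.
have lo := avatlas_open al; have co := matlas_dom ac.
have Uo : open (l.1 `&` cdom c) by exact: openI.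
have as' i : smooth_in (l.1 `&` cdom c) (a i) by apply: smooth_in_subset
  (as_ i) => ? [].
have ls : smooth_in (l.1 `&` cdom c) (sec_coord l s0) by apply:
  smooth_in_subset (smooth_sec_coord s0 al) => ? [].
exists a, C, (B - (\sum_i a i * partial c i (sec_coord l s0) + C * sec_coord l
  s0)).
split; [exact: as'|exact: smooth_in_all| | |].
- apply: (smooth_inB Uo); first exact: smooth_in_all.
  apply: (smooth_inD Uo); last exact: (smooth_inM Uo (smooth_in_all Cs) ls).
  apply: smooth_in_sum => [|i _]; [exact: Uo|]; apply: (smooth_inM Uo (as' i)).
  exact: (smooth_in_partial i ac lo (smooth_sec_coord s0 al)).
- by move=> /C0 E; apply/funext.
move=> s m lm cm; rewrite DE zeta_sec.
have -> : F (s0 m) = 0 by rewrite -[s0 _]act0 F_s0 oppr0.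
rewrite mulr0 addr0 (sec_coord_sub s s0 al lm)
  (aE _ _ (sub_sec_smooth s s0) cm).
under eq_bigr do rewrite (partial_sub s s0 _ ac al lm cm) mulrBr.
rewrite -[(B - _) m]/(B m - ((\sum_i a i * partial c i (sec_coord l s0)) m + C
  m * sec_coord l s0 m)).
by rewrite sumrB fct_sumE; ring.
Qed.

(** The section s0 determines B, its translate by 1 then determines C as fields kill constants, and
    general sections s0 + u determine Y. *)
Lemma op_class_inj jet kappa D D' : op_class jet kappa D -> op_class jet kappa
  D' ->
  (forall s m, D (FZ s) (s0 m) = D' (FZ s) (s0 m)) -> D = D'.
Proof.
move=> /op_classP[Y [B [C [Dop _ DE]]]] /op_classP[Y' [B' [C' [D'op _ D'E]]]] e.
have [Yv _ _ _ _] := Dop; have [Y'v _ _ _ _] := D'op.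
have E u (us : smooth_in setT u) m : Y u m + B m + C m * u m = Y' u m + B' m +
  C' m * u m.
  have := e (shift_sec s0 us) m; rewrite DE D'E zeta_sec => /addIr.
  have -> : (fun m' => sub (shift_sec s0 us m') (s0 m')) = u.
    by apply/funext => m'; rewrite sub_actl // subzz add0r.
  by have -> : sub (shift_sec s0 us m) (s0 m) = u m by rewrite sub_actl //
    subzz add0r.
have BB m : B m = B' m.
  by have := E _ (@smooth_in_cst R n M setT 0) m;
    rewrite !vfield_cst // !mulr0 !addr0 !add0r.
have CC m : C m = C' m.
  have := E _ (@smooth_in_cst R n M setT 1) m;
    rewrite !vfield_cst // BB !mulr1 !add0r.
  exact: addrI.
apply: (is_op_eq Dop D'op) => // [u m us|m]; last by rewrite CC.
by have := E u us m; rewrite BB CC => /addIr /addIr.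
Qed.

(** The coefficients are read off from H: B from s0, C from the increment under the unit
    translation, and Y from what remains at s0 + u. The choice A = kappa - C realizes the prescribed
    sum. *)
Lemma local_affine_op jet kappa H : local_affine jet H ->
  exists2 D, op_class jet kappa D & forall s m, D (FZ s) (s0 m) = H s m.
Proof.
move=> Ha; pose B := H s0; pose C m := H (const_sec s0 1) m - H s0 m.
pose Y u m := if pselect (smooth_in setT u) is left us
  then H (shift_sec s0 us) m - B m - C m * u m else 0.
have YE u (us : smooth_in setT u) m : Y u m = H (shift_sec s0 us) m - B m - C m
  * u m.
  by rewrite /Y; case: pselect => // us'; rewrite (Prop_irrelevance us' us).
have loc_shift l u (us : smooth_in setT u) m : @avatlas R n M Z l -> l.1 m ->
    sec_coord l (shift_sec s0 us) m = sec_coord l s0 m + u m.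
  by move=> al lm; rewrite /sec_coord sub_actl // zeta_sec avatlas_sec.
have partial_shift c l u (us : smooth_in setT u) m i : matlas c -> @avatlas R n
  M Z l ->
    l.1 m -> cdom c m -> partial c i (sec_coord l (shift_sec s0 us)) m =
      partial c i (sec_coord l s0) m + partial c i u m.
  move=> ac al lm cm; have lo := avatlas_open al.
  rewrite -(partialD i ac lm cm (smooth_sec_coord s0 al) (smooth_in_all us)).
  by apply: (partial_ext i ac lo lm cm) => m' lm'; exact: loc_shift.
have local m0 : exists c l (a : 'I_n -> M -> R) (d b : M -> R),
  [/\ matlas c, @avatlas R n M Z l, (l.1 `&` cdom c) m0,
    [/\ forall i, smooth_in (l.1 `&` cdom c) (a i), smooth_in (l.1 `&` cdom c)
      d,
      smooth_in (l.1 `&` cdom c) b & (~~ jet -> d = cst 0)] &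
    [/\ forall m, l.1 m -> cdom c m -> B m =
        \sum_i a i m * partial c i (sec_coord l s0) m + d m * sec_coord l s0 m
          + b m,
      forall m, l.1 m -> cdom c m -> C m = d m &
      forall u m, smooth_in setT u -> l.1 m -> cdom c m ->
        Y u m = \sum_i a i m * partial c i u m]].
  have [c [l [ac al cm lm]]] := chart_at Z m0.
  have [a [d [b [as_ ds bs d0 HE]]]] := Ha c l ac al.
  exists c, l, a, d, b; split => //.
  have HS u (us : smooth_in setT u) m : l.1 m -> cdom c m -> H
    (shift_sec s0 us) m - H s0 m =
      \sum_i a i m * partial c i u m + d m * u m.
    move=> lm' cm'; rewrite !HE // loc_shift //.
    under eq_bigr do rewrite partial_shift // mulrDr.
    by rewrite big_split /=; ring.
  have CE m : l.1 m -> cdom c m -> C m = d m.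
    move=> lm' cm'; rewrite /C HS // big1 ?add0r ?mulr1 // => i _.
    by rewrite partial_cst mulr0.
  split => // [m lm' cm'|u m us lm' cm']; first by rewrite /B HE.
  by rewrite YE /B HS // CE // addrK.
have Bs : smooth_in setT B.
  apply: smooth_in_local => m0 _.
  have [c [l [a [d [b [ac al Um [as_ ds bs _] [BE _ _]]]]]]] := local m0.
  exists (l.1 `&` cdom c); first exact: Um.
  have lo := avatlas_open al.
  have Uo : open (l.1 `&` cdom c) by apply: openI => //; exact: matlas_dom.
  apply: (@smooth_in_ext _ _ _ _ (\sum_i a i * partial c i (sec_coord l s0) + d
    * sec_coord l s0 + b) _ Uo).
    by move=> m [lm cm]; rewrite BE // -[LHS]/((\sum_i a i * partial c i
      (sec_coord l s0)) m +
      d m * sec_coord l s0 m + b m) fct_sumE.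
  apply: (smooth_inD Uo _ bs); apply: (smooth_inD Uo).
    apply: smooth_in_sum => [|i _]; [exact: Uo|];
      apply: (smooth_inM Uo (as_ i)).
    exact: (smooth_in_partial i ac lo (smooth_sec_coord s0 al)).
  by apply: (smooth_inM Uo ds); apply: smooth_in_subset
    (smooth_sec_coord s0 al) => ? [].
have Cs : smooth_in setT C.
  apply: smooth_in_local => m0 _.
  have [c [l [a [d [b [ac al Um [as_ ds bs _] [_ CE _]]]]]]] := local m0.
  exists (l.1 `&` cdom c); first exact: Um.
  apply: (smooth_in_ext _ _ ds); last by move=> m [lm cm]; rewrite CE.
  by apply: openI; [exact: avatlas_open|exact: matlas_dom].
have Yv : vfield Y.
  apply: vfield_of_local => m0.
  have [c [l [a [d [b [ac al Um [as_ ds bs _] [_ _ Ya]]]]]]] := local m0.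
  exists c, (l.1 `&` cdom c), a; split => //.
  - by apply: openI; [exact: avatlas_open|exact: matlas_dom].
  - by split => // u m us [lm cm]; exact: Ya.
have As : smooth_in setT (fun m => kappa - C m).
  exact: (smooth_inB openT (@smooth_in_cst R n M setT kappa) Cs).
have [D Dop] := op_exists s0 Yv As Bs Cs.
exists D.
  split; first exact: op_D1ah Dop.
  move=> m; rewrite (op_phi0 _ Dop) (op_phi1 _ Dop) opprK addrC subrK;
    split => // nj.
  have [c [l [a [d [b [ac al [lm cm] [_ _ _ d0] [_ CE _]]]]]]] := local m.
  by rewrite CE // d0.
move=> s m; rewrite (op_FZ s (s0 m) Dop) zeta_sec.
have -> : FZ s0 (s0 m) = 0 by rewrite -[s0 m]act0 F_s0 oppr0.
rewrite mulr0 addr0 (YE _ (sub_sec_smooth s s0)).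
have -> : shift_sec s0 (sub_sec_smooth s s0) = s.
  by apply: sec_ext => m'; rewrite /= sub_act // !zeta_sec.
by ring.
Qed.

(** This is what lets H descend to the phase bundle or, when values enter, to the contact bundle. *)
Lemma local_affine_eq jet H s s' m : local_affine jet H ->
  differential_zero (fun m => sub (s' m) (s m)) m -> (jet -> s m = s' m) ->
  H s m = H s' m.
Proof.
move=> Ha dz jz; have [c [l [ac al cm lm]]] := chart_at Z m.
have [a [d [b [_ _ _ d0 HE]]]] := Ha c l ac al.
rewrite !HE //; congr (_ + _ + _).
  apply: eq_bigr => i _; congr (_ * _).
  have /eqP := dz c ac cm i; rewrite (partial_sub s' s i ac al lm cm) subr_eq0.
  by move=> /eqP.
by case: jet jz d0 {Ha} => [/(_ isT) e _|_ /(_ isT) ->];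
  rewrite ?/sec_coord ?e // !mul0r.
Qed.

End AffineOperators.

(** * Affine morphisms on bundles of classes of sections *)

Lemma qclassK (T : Type) (e : T -> set T) (q : quot e) : qclass e (qrepr q) = q.
Proof.
have quot_ext (x y : quot e) : sval x = sval y -> x = y.
  case: x y => [P HP] [P' HP'] /= eP; subst P'.
  by congr exist; exact: Prop_irrelevance.
by apply: quot_ext; rewrite /= -(svalP (cid (svalP q))).
Qed.

(** The chosen t satisfies e t = e p as sets, and p lies in the second by reflexivity. *)
Lemma qrepr_qclass (T : Type) (e : T -> set T) p : (forall t, e t t) ->
  e (qrepr (qclass e p)) p.
Proof.
by move=> e_refl; rewrite /qrepr /=; case: (cid _) => t /= <-; exact: e_refl.
Qed.

Section Identification.
Variables (R : realType) (n : nat) (M : manifold R n) (Z : AVbundle M).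
Variable s0 : sec Z.
Implicit Types (m : M) (z : Z) (D : Cinf Z -> Cinf Z) (s : sec Z).

Let F : Cinf Z := FZ s0.

Lemma partial_dzero c l s s' i m : matlas c -> @avatlas R n M Z l -> l.1 m ->
  cdom c m -> differential_zero (fun m => sub (s' m) (s m)) m ->
  partial c i (sec_coord l s) m = partial c i (sec_coord l s') m.
Proof.
move=> ac al lm cm dz; have /eqP := dz c ac cm i.
by rewrite (partial_sub s' s i ac al lm cm) subr_eq0 => /eqP.
Qed.

Section Target.
Variables (T : Type) (pr : T -> M) (tv : set (set M * (T -> 'rV[R]_1))).
(* T is M * R or Z; wr m r is the point over m with coordinate r, measured from
   s0 in the case of Z. *)
Variables (wr : M -> R -> T) (rd : T -> R).
Hypotheses (pr_wr : forall m r, pr (wr m r) = m)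
  (rd_wr : forall m r, rd (wr m r) = r)
  (wr_rd : forall t, wr (pr t) (rd t) = t)
  (tvE : forall v, tv v -> open v.1 /\ exists2 g, smooth_in v.1 g &
     forall t, v.1 (pr t) -> v.2 t = (rd t + g (pr t))%:M)
  (tv_cover : forall l, @avatlas R n M Z l -> exists2 v, tv v & l.1 `<=` v.1).
Let TB : affbundle M := AffBundle pr tv.

Section Source.
(* e and coord are the equivalence and the fibre coordinates defining PZ or CZ;
   the rows La i and Ld of L hold the coefficients of derivatives and value. *)
Variables (jet : bool) (e : M * sec Z -> set (M * sec Z)) (r : nat)
  (coord : chart R M n -> set M * (M -> Z) -> M * sec Z -> 'rV[R]_r)
  (mkL : ('I_n -> R) -> R -> 'M[R]_(r, 1)) (La : 'I_n -> 'I_r)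
    (Ld : option 'I_r).
Hypotheses (e_refl : forall p, e p p) (e_fst : forall p q, e p q -> p.1 = q.1)
  (e_dz : forall p q, e p q ->
     differential_zero (fun m => sub (q.2 m) (p.2 m)) p.1)
  (e_jet : jet -> forall p q, e p q -> p.2 p.1 = q.2 p.1 :> Z)
  (jet_Ld : ~~ jet -> Ld = None)
  (mkL_sm : forall (U : set M) (a : 'I_n -> M -> R) (d : M -> R) i j,
     (forall i, smooth_in U (a i)) -> smooth_in U d -> smooth_in U
       (fun m => mkL (a^~ m) (d m) i j))
  (coord_mkL : forall c l p a d, (~~ jet -> d = 0) -> coord c l p *m mkL a d =
     (\sum_i a i * gradient c l p 0 i + d * local_rep l p p.1)%:M)
  (coordE : forall c l p (L : 'M[R]_(r, 1)), coord c l p *m L =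
     (\sum_i L (La i) 0 * gradient c l p 0 i +
      (if Ld is Some k then L k 0 else 0) * local_rep l p p.1)%:M).
Let JB : affbundle M := @AffBundle _ _ _ (quot e) (fun q => (qrepr q).1) r
  [set t | exists c l, [/\ matlas c, @avatlas R n M Z l &
     t = (l.1 `&` cdom c, fun q => coord c l (qrepr q))]].
Let j s m : JB := qclass e (m, s).

Lemma qrepr_j_fst s m : (qrepr (j s m)).1 = m.
Proof. by rewrite (e_fst (qrepr_qclass (m, s) e_refl)). Qed.

Lemma local_affine_class H s m : local_affine jet H ->
  H (qrepr (j s m)).2 m = H s m.
Proof.
move=> Ha; have E := qrepr_qclass (m, s) e_refl; have E1 := qrepr_j_fst s m.
apply: (local_affine_eq Ha).
  by have := e_dz E; rewrite -/(j s m) E1.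
by move=> jt; have := e_jet jt E; rewrite -/(j s m) E1.
Qed.

Lemma local_affine_morphism H : local_affine jet H ->
  affine_morphism (A := JB) (B := TB)
    (fun q => wr (qrepr q).1 (H (qrepr q).2 (qrepr q).1)).
Proof.
move=> Ha; split; first by move=> q; rewrite /= pr_wr.
move=> _ v [c [l [ac al ->]]] tvv /=; have [vo [g gs gE]] := tvE tvv.
have [a [d [b [as_ ds bs d0 HE]]]] := Ha c l ac al.
have Uo : open ((l.1 `&` cdom c) `&` v.1).
  by do ![apply: openI] => //; [exact: avatlas_open|exact: matlas_dom].
have US k : smooth_in (l.1 `&` cdom c) k -> smooth_in
  ((l.1 `&` cdom c) `&` v.1) k.
  by apply: smooth_in_subset => m [].
exists (fun m => mkL (a^~ m) (d m)), (fun m => (b m + g m)%:M); split.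
- by move=> i k; apply: mkL_sm => [i'|]; [exact: US (as_ i')|exact: US ds].
- move=> k; have -> : (fun m : M => ((b m + g m)%:M : 'rV[R]_1) 0 k) = b + g.
    by apply/funext => m; rewrite ord1 mxE eqxx mulr1n.
  by apply: (smooth_inD Uo); [exact: US|apply: smooth_in_subset gs => m []].
- move=> q [lm cm] vm; rewrite gE ?pr_wr // rd_wr coord_mkL; last first.
    by move=> /d0 ->.
  rewrite -raddfD /= HE // addrA; congr (_ + _ + _ + _)%:M.
  by apply: eq_bigr => i _; rewrite mxE.
Qed.

Lemma morphism_local_affine (h : JB -> TB) : affine_morphism h ->
  local_affine jet (fun s m => rd (h (j s m))).
Proof.
move=> [hpr hE] c l ac al; have [v tvv lv] := tv_cover al.
have [vo [g gs gE]] := tvE tvv.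
have ju : @atrivs _ _ _ JB (l.1 `&` cdom c, fun q => coord c l (qrepr q)).
  by exists c, l.
have [L [b [Ls bs LE]]] := hE _ _ ju tvv.
have US k : smooth_in ((l.1 `&` cdom c) `&` v.1) k -> smooth_in
  (l.1 `&` cdom c) k.
  by apply: smooth_in_subset => m [lm cm]; split => //; exact: lv.
have Uo : open (l.1 `&` cdom c).
  by apply: openI; [exact: avatlas_open|exact: matlas_dom].
(* A trivialization of the target reads [rd] plus g, hence g is subtracted from the constant
   term. *)
exists (fun i m => L m (La i) 0), (fun m => if Ld is Some k then L m k 0 else
  0),
  ((fun m => b m 0 0) - g); split.
- by move=> i; apply: US; exact: Ls.
- by case: Ld => [k|]; [apply: US; exact: Ls|exact: smooth_in_cst].
- apply: (smooth_inB Uo); first by apply: US; exact: bs.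
  by apply: smooth_in_subset gs => m [lm cm]; exact: lv.
- by move=> /jet_Ld ->.
move=> s m lm cm; have E := qrepr_qclass (m, s) e_refl;
  have E1 := qrepr_j_fst s m.
have pm : pr (h (j s m)) = m by exact: etrans (hpr (j s m)) E1.
have := LE (j s m); rewrite /= E1 => /(_ (conj lm cm) (lv _ lm)).
rewrite gE ?pm; last exact: lv.
rewrite coordE => /matrixP /(_ 0 0); rewrite !mxE eqxx !mulr1n E1 => hm.
rewrite -[X in _ + X]/(b m 0 0 - g m) addrA; apply/eqP; rewrite -subr_eq opprK;
  apply/eqP.
have dz := e_dz E; rewrite -/(j s m) E1 in dz.
rewrite [LHS]hm; congr (_ + _ + _).
  apply: eq_bigr => i _; rewrite mxE E1; congr (_ * _).
  exact: (partial_dzero i ac al lm cm dz).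
case: (boolP jet) => [jt|/jet_Ld ->]; last by rewrite !mul0r.
have ej := e_jet jt E; rewrite -/(j s m) E1 in ej.
by rewrite /local_rep /sec_coord ej.
Qed.

(** F vanishes on [s0], so evaluation there removes the term kappa F and leaves the affine map on
    sections. A morphism read in charts is such a map, and the operator is rebuilt from it. *)
Lemma op_class_identified (kappa : R) :
  identified (op_class jet kappa) (affine_morphism (A := JB) (B := TB))
    (fun D h => forall s z,
       D (FZ s) z = rd (h (j s (zeta z))) + kappa * F z).
Proof.
pose Phi (D : Cinf Z -> Cinf Z) (q : JB) : TB :=
  wr (qrepr q).1 (D (FZ (qrepr q).2) (s0 (qrepr q).1)).
have PhiE D s m : op_class jet kappa D -> rd (Phi D (j s m)) = D (FZ s) (s0 m).
  move=> DS; rewrite /Phi rd_wr qrepr_j_fst.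
  exact: (local_affine_class s m (op_class_affine s0 DS)).
exists Phi; last by move=> D DS s z; rewrite PhiE //; exact: op_class_FZ DS.
split.
- by move=> D DS; exact: local_affine_morphism (op_class_affine s0 DS).
- move=> D D' /set_mem DS /set_mem D'S PP.
  by apply: (op_class_inj (s0 := s0) DS D'S) => s m; rewrite -!PhiE // PP.
- move=> h hm; have Ha := morphism_local_affine hm.
  have [D DS DE] := local_affine_op s0 kappa Ha; exists D => //.
  apply/funext => q; rewrite /Phi DE.
  have -> : j (qrepr q).2 (qrepr q).1 = q.
    by rewrite /j -surjective_pairing qclassK.
  have <- : pr (h q) = (qrepr q).1 by have [hpr _] := hm; exact: hpr.
  exact: wr_rd.
Qed.

End Source.
End Target.
End Identification.

(** * The phase and contact bundles, the two targets and the five subbundles *)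

Section Instances.
Variables (R : realType) (n : nat) (M : manifold R n) (Z : AVbundle M).
Variable s0 : sec Z.
Implicit Types (m : M) (z : Z) (D : Cinf Z -> Cinf Z) (s : sec Z).

Let F : Cinf Z := FZ s0.

Lemma differential_zero0 m : differential_zero (cst 0 : M -> R) m.
Proof. by move=> c ac cm i; exact: partial_cst. Qed.

Lemma phase_equiv_refl p : phase_equiv (Z := Z) p p.
Proof.
split => //; rewrite (_ : (fun m => _) = cst 0);
  first exact: differential_zero0.
by apply/funext => m; rewrite subzz.
Qed.

Lemma jet_equiv_refl p : jet_equiv (Z := Z) p p.
Proof. by split => //; have [] := phase_equiv_refl p. Qed.

Section Target.
Variables (T : Type) (pr : T -> M) (tv : set (set M * (T -> 'rV[R]_1))).
Variables (wr : M -> R -> T) (rd : T -> R).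
Hypotheses (pr_wr : forall m r, pr (wr m r) = m)
  (rd_wr : forall m r, rd (wr m r) = r)
  (wr_rd : forall t, wr (pr t) (rd t) = t)
  (tvE : forall v, tv v -> open v.1 /\ exists2 g, smooth_in v.1 g &
     forall t, v.1 (pr t) -> v.2 t = (rd t + g (pr t))%:M)
  (tv_cover : forall l, @avatlas R n M Z l -> exists2 v, tv v & l.1 `<=` v.1).
Let TB : affbundle M := AffBundle pr tv.

Lemma ADer_identified kappa :
  identified (op_class (Z := Z) false kappa) (ADer Z TB)
    (fun D h => forall s z,
       D (FZ s) z = rd (h (dsec Z s (zeta z))) + kappa * F z).
Proof.
apply: (@op_class_identified R n M Z s0 T pr tv wr rd pr_wr rd_wr wr_rd tvE
  tv_cover
  false (@phase_equiv R n M Z) n (@gradient R n M Z) (fun a _ => \col_i a i)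
  id None).
- exact: phase_equiv_refl.
- by move=> p q [].
- by move=> p q [].
- by [].
- by [].
- by move=> U a d i j as_ _; under eq_fun do rewrite mxE; exact: as_.
- move=> c l p a d -> //; rewrite mul0r addr0; apply/matrixP => i j.
  rewrite !ord1 !mxE eqxx mulr1n; apply: eq_bigr => k _.
  by rewrite !mxE mulrC.
- move=> c l p L; rewrite mul0r addr0; apply/matrixP => i j.
  rewrite !ord1 !mxE eqxx mulr1n; apply: eq_bigr => k _.
  by rewrite !mxE mulrC.
Qed.

Lemma ADO1_identified kappa :
  identified (op_class (Z := Z) true kappa) (ADO1 Z TB)
    (fun D h => forall s z,
       D (FZ s) z = rd (h (jsec Z s (zeta z))) + kappa * F z).
Proof.
apply: (@op_class_identified R n M Z s0 T pr tv wr rd pr_wr rd_wr wr_rd tvE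
  tv_cover
  true (@jet_equiv R n M Z) (1 + n)%N
  (fun c l p => row_mx (local_rep l p p.1)%:M (gradient c l p))
  (fun a d => col_mx d%:M (\col_i a i)) (@rshift 1 n) (Some (lshift n ord0))).
- exact: jet_equiv_refl.
- by move=> p q [].
- by move=> p q [].
- by move=> _ p q [].
- by [].
- move=> U a d i j as_ ds; rewrite ord1.
  have [k ->|k ->] := fintype.split_ordP i.
    under eq_fun do rewrite col_mxEu mxE ord1 eqxx mulr1n; exact: ds.
  by under eq_fun do rewrite col_mxEd mxE; exact: as_.
- move=> c l p a d _; rewrite mul_row_col; apply/matrixP => i j.
  rewrite !ord1 !mxE eqxx mulr1n big_ord1 !mxE !mulr1n addrC; congr (_ + _).
    by apply: eq_bigr => k _; rewrite !mxE mulrC.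
  exact: mulrC.
- move=> c l p L; apply/matrixP => i j.
  rewrite !ord1 [LHS]mxE big_split_ord /= big_ord1 [RHS]mxE mulr1n addrC.
  congr (_ + _).
    by apply: eq_bigr => k _; rewrite row_mxEr mulrC.
  by rewrite row_mxEl mxE mulr1n mulrC.
Qed.

End Target.

Lemma identified_agree T T' (S : set T) (S' : set T')
  (agree agree' : T -> T' -> Prop) :
  (forall (D : T) (h : T'), S D -> S' h -> agree D h -> agree' D h) ->
  identified S S' agree -> identified S S' agree'.
Proof.
move=> H [Phi bij ag]; exists Phi => // D SD; apply: H => //; last exact: ag.
by case: bij => + _ _; apply.
Qed.

(** Collects what M x R and Z have in common as affine line bundles, [s0] being the origin of Z. *)
Definition target_spec T (pr : T -> M) tv (wr : M -> R -> T) (rd : T -> R) :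
  Prop :=
  [/\ forall m r, pr (wr m r) = m, forall m r, rd (wr m r) = r,
    forall t, wr (pr t) (rd t) = t,
    forall v, tv v -> open v.1 /\ exists2 g, smooth_in v.1 g &
     forall t, v.1 (pr t) -> v.2 t = ((rd t + g (pr t))%:M : 'rV[R]_1) &
    forall l, @avatlas R n M Z l -> exists2 v, tv v & l.1 `<=` v.1].

Lemma trivial_target : target_spec fst (@atrivs _ _ _ (trivial_bundle M)) pair
  snd.
Proof.
split => //; first by case.
  move=> _ ->; split; first exact: openT.
  by exists (cst 0); [exact: smooth_in_cst|move=> t _; rewrite addr0].
by move=> l al; eexists; first by [].
Qed.

Lemma av_target : target_spec (@zeta R n M Z) (@atrivs _ _ _ (av_bundle Z))
  (fun m r => act (s0 m) r) (height s0).
Proof.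
split.
- by move=> m r; rewrite zeta_act zeta_sec.
- by move=> m r; rewrite height_act /height zeta_sec subzz add0r.
- by move=> z; exact: const_sec_height.
- move=> _ [l al <-]; split; first exact: avatlas_open.
  exists (sec_coord l s0); first exact: smooth_sec_coord.
  move=> z lz; congr (_%:M); rewrite /height /sec_coord.
  by rewrite -sub_trans // ?zeta_sec // avatlas_sec.
- by move=> l al; eexists; first by exists l.
Qed.

(** For kappa = 1 this turns height plus F into F_tau, which converts an identity of functions on Z
    into an action with values in sections. *)
Lemma sub_height z z' : zeta z = zeta z' -> sub z z' = height s0 z + F z'.
Proof.
move=> e; rewrite F_height /height -e.
have -> : - sub z' (s0 (zeta z)) = sub (s0 (zeta z)) z'.
  apply/eqP; rewrite -subr_eq0 -opprD oppr_eq0; apply/eqP.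
  by rewrite -sub_trans ?subzz // ?zeta_sec.
by rewrite -sub_trans // ?zeta_sec.
Qed.

Lemma Sec_Ttilde : Sec (Ttilde Z) = op_class false 0.
Proof.
rewrite /Ttilde; apply/seteqP; split=> D;
  [move=> /(SecP s0)[DD H]|move=> [DD H]].
  by split=> // m; have [-> ->] := H m; rewrite subrr.
by apply/(SecP s0); split=> // m; have [+ /(_ isT) e] := H m;
   rewrite e sub0r => /eqP; rewrite oppr_eq0 => /eqP.
Qed.

Lemma Sec_Tbar : Sec (Tbar Z) = op_class false 1.
Proof.
rewrite /Tbar; apply/seteqP; split=> D; [move=> /(SecP s0)[DD H]|move=> [DD H]].
  by split=> // m; have [-> ->] := H m; rewrite sub0r opprK.
by apply/(SecP s0); split=> // m; have [+ /(_ isT) e] := H m;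
   rewrite e sub0r => <-; rewrite opprK.
Qed.

Lemma Sec_Ltilde : Sec (Ltilde Z) = op_class true 0.
Proof.
rewrite /Ltilde; apply/seteqP; split=> D;
  [move=> /(SecP s0)[DD H]|move=> [DD H]].
  by split.
by apply/(SecP s0); split=> // m; have [] := H m.
Qed.

Lemma Sec_Lbar : Sec (Lbar Z) = op_class true 1.
Proof.
rewrite /Lbar; apply/seteqP; split=> D; [move=> /(SecP s0)[DD H]|move=> [DD H]].
  by split.
by apply/(SecP s0); split=> // m; have [] := H m.
Qed.

Lemma vector_field_zero (X : Cinf Z -> Cinf Z) (f : Cinf Z) (a : R) z :
  vector_field X -> (forall z, f z = a) -> X f z = 0.
Proof.
move=> Xv fa; have [c [l [ac al cz lz]]] := chart_at Z (zeta z).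
have [|b _ bE] := Xv (avchart c l); first by exists c, l.
rewrite bE; last by split.
rewrite big1 // => i _; rewrite /partial.
have -> : f \o cinv (avchart c l) = cst a by apply/funext => y; exact: fa.
by rewrite derive_cst mulr0.
Qed.

(** A field commuting with X_Z preserves every Pol^k and so has a normal form; there C = 0 because
    fields kill constants, and A = 0 by testing the commutator on F. *)
Lemma Sec_Ttilde_invariant : Sec (Ttilde Z) = invariant_fields Z.
Proof.
rewrite Sec_Ttilde; apply/seteqP; split=> D.
  move=> /(op_classP s0)[Y [B [C [Dop C0 _]]]].
  have CE : C = cst 0 by apply/funext => m; exact: C0.
  rewrite CE in Dop; split; first exact: op_vector_field Dop.
  by move=> f z; rewrite (commute_op f z Dop) subrr mul0r addr0 subrr.
move=> [Dv Dinv].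
have DD : D1ah D.
  split.
    exists D, (Cinf_cst Z 0); split => // f z.
    by rewrite mul0r addr0.
  move=> k _ [f fP <-] z.
  have -> : iter k.+1 (@XZ R n M Z) (D f) = D (iter k.+1 (@XZ R n M Z) f).
    elim: (k.+1) => [//|k' IH]; rewrite !iterS IH; apply: Cinf_ext => z'.
    by apply/eqP; rewrite -subr_eq0 Dinv.
  exact: (vector_field_zero z Dv fP).
split => // m; have [Y [A [B [C Dop]]]] := D1ah_op s0 DD.
have C0 : C m = 0.
  have := op_one (s0 m) Dop; rewrite zeta_sec => <-.
  exact: (@vector_field_zero D (Cinf_cst Z 1) 1 (s0 m) Dv).
have A0 : A m = 0.
  have /eqP := Dinv F (s0 m); rewrite (commute_op F _ Dop) addrC addKr.
  by rewrite XZ_F mulr1 zeta_sec => /eqP.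
by rewrite (op_phi0 _ Dop) (op_phi1 _ Dop) A0 C0 oppr0 subrr.
Qed.

Lemma D1ah_lin D D' (a b : R) : D1ah D -> D1ah D' -> exists2 D'', D1ah D'' &
  [/\ forall f z, D'' f z = a * D f z + b * D' f z,
    forall m, phi0 D'' m = a * phi0 D m + b * phi0 D' m &
    forall m, phi1 D'' m = a * phi1 D m + b * phi1 D' m].
Proof.
move=> /(D1ah_op s0)[Y [A [B [C Dop]]]] /(D1ah_op s0)[Y' [A' [B' [C' D'op]]]].
have [D'' D''op DE] := is_op_lin a b Dop D'op; exists D'';
  first exact: op_D1ah D''op.
split => // m.
  by rewrite (op_phi0 _ Dop) (op_phi0 _ D'op) (op_phi0 _ D''op) !mulrN opprD.
by rewrite (op_phi1 _ Dop) (op_phi1 _ D'op) (op_phi1 _ D''op).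
Qed.

(** A single global operator [A] serves as origin: phi^0 and phi^1 are linear, so subtracting it
    carries the one locus onto the other. *)
Lemma affine_locus (P P' : R -> R -> Prop) (A : Cinf Z -> Cinf Z) : D1ah A ->
  (forall m p0 p1, P' (phi0 A m + p0) (phi1 A m + p1) <-> P p0 p1) ->
  vector_subbundle (locus (Z := Z) P) ->
  affine_subbundle (locus (Z := Z) P') (locus P).
Proof.
move=> AD PP sb; split => // m0; exists setT, A; split => //;
  first exact: openT.
move=> m _; apply/seteqP; split=> [_ [D [DD PD] <-]|_ [_ [D [DD PD] <-] <-]].
  have [D' D'D [D'E e0 e1]] := D1ah_lin 1 (-1) DD AD.
  exists (value D' m).
    exists D' => //; split => //; apply/(PP m); rewrite e0 e1 !mul1r !mulN1r.
    by rewrite addrC subrK addrC subrK.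
  apply/funext => f; apply/funext => z.
  have [zm|zm] := pselect (zeta z = m); last by rewrite !valueN // addr0.
  by rewrite !valueE // D'E mul1r mulN1r addrC subrK.
have [D' D'D [D'E e0 e1]] := D1ah_lin 1 1 AD DD.
exists D'.
  by split => //; rewrite e0 e1 !mul1r; apply/PP.
apply/funext => f; apply/funext => z.
have [zm|zm] := pselect (zeta z = m); last by rewrite !valueN // addr0.
by rewrite !valueE // D'E !mul1r.
Qed.

End Instances.

Theorem theorem18 (R : realType) (n : nat) (M : manifold R n)
    (Z : AVbundle M) :
  [/\ vector_subbundle (Ttilde Z),
      vector_subbundle (Ltilde Z),
      vector_subbundle (Lbreve Z),
      affine_subbundle (Tbar Z) (Ttilde Z) &
      affine_subbundle (Lbar Z) (Ltilde Z)] /\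
  [/\ identified (Sec (Ttilde Z)) (ADer Z (trivial_bundle M))
        (same_action_fun (dsec Z)) /\
      Sec (Ttilde Z) = invariant_fields Z,
      identified (Sec (Tbar Z)) (ADer Z (av_bundle Z))
        (same_action_sec (dsec Z)),
      identified (Sec (Ltilde Z)) (ADO1 Z (trivial_bundle M))
        (same_action_fun (jsec Z)) &
      identified (Sec (Lbar Z)) (ADO1 Z (av_bundle Z))
        (same_action_sec (jsec Z))].
Proof.
have [s0] := section_exists Z.
have cs t : smooth_in setT (cst t : M -> R) by exact: smooth_in_cst.
have n3 : (n + 1 <= n + 3)%N by rewrite leq_add2l.
have n3' : (n + 2 <= n + 3)%N by rewrite leq_add2l.
have nk k : (n <= n + k)%N by exact: leq_addr.
have nn k : (n + k.+1 <= n)%N = false by rewrite -[X in (_ <= X)%N]addn0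
  leq_add2l.
have n21 : (n + 2 <= n + 1)%N = false by rewrite leq_add2l.
have n12 : (n + 1 <= n + 2)%N by rewrite leq_add2l.
have sT : vector_subbundle (Ttilde Z).
  (* Here phi^0 = - x1 and phi^1 = x2, so both vanish exactly on combinations of the first n + 1
     members, the coordinate fields and X_Z. *)
  apply: (frame_subbundle s0 (a := 1) (b := 0) n3 (nk 1%N));
    first exact: oner_neq0.
  move=> x0 x1 x2; rewrite nn leqnn n12; split.
    move=> [/eqP]; rewrite mul1r oppr_eq0 => /eqP -> H.
    by split => // _; move: H; rewrite mul0r add0r.
  by move=> [_ -> // -> //]; rewrite !mulr0 oppr0 addr0.
have sL : vector_subbundle (Ltilde Z).
  (* The member 1 - F X_Z has phi^0 = phi^1 = 1, so in this frame phi^1 - phi^0 = x2. *)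
  apply: (frame_subbundle s0 (a := -1) (b := 1) n3' (nk 2%N)).
    by rewrite oppr_eq0 oner_neq0.
  move=> x0 x1 x2; rewrite nn leqnn n21 (_ : 1 * x1 + x2 - - (-1 * x1) = x2);
    last by ring.
  by split => [->|[_ _ ->]].
have sB : vector_subbundle (Lbreve Z).
  apply: (frame_subbundle s0 (a := 1) (b := 0) n3' (nk 2%N));
    first exact: oner_neq0.
  move=> x0 x1 x2; rewrite nn leqnn n21 mul0r add0r.
  by split => [->|[_ _ ->]].
split; split => //.
(* The origin is F X_Z, with phi^0 = -1 and phi^1 = 0. *)
- have [E Eop] := op_exists s0 (vfield0 M) (cs 1) (cs 0) (cs 0).
  apply: (affine_locus s0 (op_D1ah Eop)) sT => m p0 p1.
  rewrite (op_phi0 m Eop) (op_phi1 m Eop) /cst add0r; split => [[h ->]|[-> ->]].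
    by split => //; apply: (addrI (-1)); rewrite h addr0.
  by rewrite addr0.
(* The origin is the identity, with phi^0 = 0 and phi^1 = 1. *)
- have [E Eop] := op_exists s0 (vfield0 M) (cs 0) (cs 0) (cs 1).
  apply: (affine_locus s0 (op_D1ah Eop)) sL => m p0 p1.
  rewrite (op_phi0 m Eop) (op_phi1 m Eop) /cst oppr0 add0r -addrA.
  split => [h|->]; last by rewrite addr0.
  by apply: (addrI 1); rewrite h addr0.
- split; last exact: Sec_Ttilde_invariant s0.
  have [h1 h2 h3 h4 h5] := trivial_target Z.
  rewrite (Sec_Ttilde s0); apply: identified_agree
    (ADer_identified s0 h1 h2 h3 h4 h5 0).
  move=> D h DS hS ag s; apply/funext => z; rewrite ag mul0r addr0 //.
- have [h1 h2 h3 h4 h5] := av_target s0.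
  rewrite (Sec_Tbar s0); apply: identified_agree
    (ADer_identified s0 h1 h2 h3 h4 h5 1).
  move=> D h DS [hpr _] ag s; apply/funext => z; rewrite ag mul1r /Fsec.
  rewrite (sub_height s0) //; apply: etrans (hpr _) _.
  by have [] := qrepr_qclass (zeta z, s) (@phase_equiv_refl R n M Z).
- have [h1 h2 h3 h4 h5] := trivial_target Z.
  rewrite (Sec_Ltilde s0); apply: identified_agree
    (ADO1_identified s0 h1 h2 h3 h4 h5 0).
  by move=> D h DS hS ag s; apply/funext => z; rewrite ag mul0r addr0.
- have [h1 h2 h3 h4 h5] := av_target s0.
  rewrite (Sec_Lbar s0); apply: identified_agree
    (ADO1_identified s0 h1 h2 h3 h4 h5 1).
  move=> D h DS [hpr _] ag s; apply/funext => z; rewrite ag mul1r /Fsec.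
  rewrite (sub_height s0) //; apply: etrans (hpr _) _.
  by have [] := qrepr_qclass (zeta z, s) (@jet_equiv_refl R n M Z).
Qed.
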